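(* Let $\tau\ge0$, $\sigma\ge0$, $f\in\mathcal{A}_1$, and assume there is a constant $C_U>0$ such that $|\nabla U(\theta)|\le C_U(1+|\theta|)$ for all $\theta\in\mathbb{R}^d$. If $\nu\in\mathcal{P}_1(\mathbb{R}^d)$ is a local maximum of $J^{\tau,\sigma}$ and has full support, then $\nu$ is a measure-valued solution of $$L_\nu^*\nu=0,$$ that is, $\int_{\mathbb{R}^d}L_\nu\phi(\theta)\,\nu(d\theta)=0$ for all $\phi\in C_c^\infty(\mathbb{R}^d)$, where $$L_\nu\phi=\frac{\sigma^2}{2}\Delta\phi+\Big(\nabla\frac{\delta J^{\tau,0}}{\delta\nu}(\nu,\cdot)-\frac{\sigma^2}{2}\nabla U\Big)\cdot\nabla\phi .$$
   Context: Markov decision model. $S$ and $A$ are Polish spaces with Borel $\sigma$-algebras; $P(ds'|s,a)$ is a stochastic kernel from $S\times A$ to $S$; $r:S\times A\to\mathbb{R}$ is bounded measurable; $\gamma\in[0,1)$; $\tau\ge0$; $\mu$ is a strictly positive finite measure on $A$; $\rho\in\mathcal{P}(S)$ is a fixed initial distribution. Standing assumption: if $\tau=0$, then additionally $A$ is compact, for each $a\in A$ the map $s\mapsto\int_S h(s')P(ds'|s,a)$ is continuous for every bounded measurable $h$, and $r(s,\cdot)$ is upper semicontinuous for each $s\in S$. For a stochastic kernel (policy) $\pi(da|s)$ from $S$ to $A$, let $P_\pi(ds'|s)=\int_A P(ds'|s,a)\pi(da|s)$, $d^\pi(ds'|s)=(1-\gamma)\sum_{n\ge0}\gamma^nP_\pi^n(ds'|s)$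 (with $P_\pi^0(\cdot|s)=\delta_s$), and $d^\pi_\rho(ds)=\int_S d^\pi(ds|s')\rho(ds')$. For $\pi$ with bounded log-density $\ln\frac{d\pi}{d\mu}$, $$V^\pi_\tau(s)=\mathbb{E}^\pi_s\Big[\sum_{n\ge0}\gamma^n\big(r(s_n,a_n)-\tau\ln\tfrac{d\pi}{d\mu}(a_n|s_n)\big)\Big],\quad V^\pi_\tau(\rho)=\int_SV^\pi_\tau(s)\rho(ds),\quad Q^\pi_\tau(s,a)=r(s,a)+\gamma\int_SV^\pi_\tau(s')P(ds'|s,a),$$ where under $\mathbb{E}^\pi_s$ the chain starts at $s_0=s$, $a_n\sim\pi(\cdot|s_n)$, $s_{n+1}\sim P(\cdot|s_n,a_n)$. Class $\mathcal{A}_k$ ($k\in\mathbb{N}_0$): jointly measurable $h:\mathbb{R}^d\times S\times A\to\mathbb{R}$ such that for all $s\in S$ and $\mu$-a.a. $a\in A$, $h$ is $k$-times differentiable in $\theta$, and $|h|_{\mathcal{A}_k}:=\max_{0\le j\le k}\operatorname{ess\,sup}_{a\in A}\sup_{s\in S}\operatorname{ess\,sup}_{\theta\in\mathbb{R}^d}|\nabla^jh(\theta,s,a)|<\infty$ (essential suprema with respect to $\mu$ and Lebesgue measure). Throughout $\nabla=\nabla_\theta$. Mean-field softmax policy: for $\nu\in\mathcal{P}(\mathbb{R}^d)$, $$\pi_\nu(da|s)=\frac{\exp(\int_{\mathbb{R}^d}f(\theta,s,a)\nu(d\theta))}{\int_A\exp(\int_{\mathbb{R}^d}f(\theta,s,a')\nu(d\theta))\mu(da')}\mu(da).$$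 $U:\mathbb{R}^d\to\mathbb{R}$ is a measurable, positive, differentiable potential with $\int_{\mathbb{R}^d}e^{-U(\theta)}d\theta=1$. Objective: $J^{\tau,\sigma}(\nu)=V^{\pi_\nu}_\tau(\rho)-\frac{\sigma^2}{2}\mathrm{KL}(\nu|e^{-U})$, where $e^{-U}$ denotes the measure with this Lebesgue density, $\mathrm{KL}=+\infty$ if $\nu$ is not absolutely continuous, and the KL term is absent if $\sigma=0$. Thus $J^{\tau,0}(\nu)=V^{\pi_\nu}_\tau(\rho)$. Its linear functional derivative is $$\frac{\delta J^{\tau,0}}{\delta\nu}(\nu,\theta)=\frac1{1-\gamma}\int_S\int_A\Big(Q^{\pi_\nu}_\tau(s,a)-\tau\ln\tfrac{d\pi_\nu}{d\mu}(a|s)\Big)\Big(f(\theta,s,a)-\int_Af(\theta,s,a')\pi_\nu(da'|s)\Big)\pi_\nu(da|s)\,d^{\pi_\nu}_\rho(ds).$$ $\mathcal{P}_1(\mathbb{R}^d)$ is the set of probability measures with finite first moment with the metric $W_1$ (1-Wasserstein). ''Local maximum'' means: there is $\delta>0$ with $J^{\tau,\sigma}(\nu)\ge J^{\tau,\sigma}(\nu')$ for all $\nu'\in\mathcal{P}_1(\mathbb{R}^d)$ with $W_1(\nu,\nu')<\delta$. *)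

(* Defs.v *)
From HB Require Import structures.
From mathcomp Require Import all_boot all_order all_algebra.
From mathcomp Require Import all_classical all_reals all_analysis.
From mathcomp Require Import measurable_realfun ess_sup_inf.

Set Implicit Arguments.
Unset Strict Implicit.
Unset Printing Implicit Defensive.

Import Order.TTheory GRing.Theory Num.Theory.
Import numFieldNormedType.Exports.

Local Open Scope classical_set_scope.
Local Open Scope ring_scope.

Notation borel T := (g_sigma_algebraType (@open T)).

Definition polish (R : realType) (T : topologicalType) : Prop :=
  (exists m : T -> T -> R,
    [/\ (forall x y, m x y = 0 <-> x = y) /\ (forall x y, m x y = m y x),
        forall x y z, m x z <= m x y + m y z,
        forall x B, nbhs x B <->
          (exists2 e : R, 0 < e & [set y | m x y < e] `<=` B)
      & forall u : nat -> T,
          (forall e : R, 0 < e -> exists N : nat, forall i j : nat,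
            (N <= i)%N -> (N <= j)%N -> m (u i) (u j) < e) ->
          exists l : T, u @ \oo --> l])
  /\ (exists2 D : set T, countable D & dense D).

Definition upper_semicontinuous (R : realType) (T : topologicalType)
  (g : T -> R) : Prop := lower_semicontinuous (fun x => (- g x)%:E).

(* Integrals against mere set functions: the policies and occupation measures
   below are only measures under the measurability assumptions on the data. *)
Definition rint (R : realType) d (T : measurableType d)
  (m : set T -> \bar R) (g : T -> R) : R := fine (\int[m]_x (g x)%:E)%E.

Section euclidean.
Context {R : realType} {d : nat}.
Implicit Types (g : 'rV[R]_d -> R) (x y : 'rV[R]_d).

(* The library norm on 'rV[R]_d is the maximum norm. *)
Definition dotv x y : R := \sum_(i < d) x 0 i * y 0 i.
Definition enorm x : R := Num.sqrt (dotv x x).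

Definition partial (i : 'I_d) g : 'rV[R]_d -> R := 'D_(delta_mx 0 i) g.
Definition grad g x : 'rV[R]_d := \row_i partial i g x.
Definition laplacian g x : R := \sum_(i < d) partial i (partial i g) x.

Definition smooth g : Prop := forall (l : seq 'I_d) x,
  let h := foldr partial g l in
  {for x, continuous h} /\ forall i : 'I_d, derivable h x (delta_mx 0 i).

Definition compactly_supported g : Prop := compact (closure [set x | g x != 0]).

End euclidean.

Section lebesgue.
Context {R : realType}.

Lemma borel_measurable_coord n (i : 'I_n) :
  measurable_fun [set: borel 'rV[R]_n] (fun v : 'rV[R]_n => v 0 i).
Proof.
apply: (measurability _ (RGenOpens.measurableE R)).
move=> _ [_ [a [b ->] <-]]; rewrite setTI; apply: sub_sigma_algebra.
by apply: open_comp; [move=> v _; exact: coord_continuous|exact: interval_open].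
Qed.

Lemma open_rV_rat n (U : set 'rV[R]_n) : open U ->
  U = \bigcup_(p in [set p : 'rV[rat]_n * rat |
        ball (map_mx ratr p.1 : 'rV[R]_n) (ratr p.2) `<=` U])
      ball (map_mx ratr p.1 : 'rV[R]_n) (ratr p.2).
Proof.
move=> oU; apply/seteqP; split => [x Ux|x [p /= pU]]; last exact: pU.
have := open_nbhs_nbhs (conj oU Ux); rewrite -nbhs_ballE => -[e /= e0 eU].
have [q] : exists q : rat, ratr q \in `]0, (e / 2)[.
  by apply: rat_in_itvoo; rewrite divr_gt0.
rewrite in_itv/= => /andP[q0 qe].
have /choice[c cP] (i : 'I_n) : exists c : rat, `|ratr c - x 0 i| < ratr q.
  have [c] : exists c : rat, ratr c \in `](x 0 i - ratr q), (x 0 i + ratr q)[.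
    by apply: rat_in_itvoo; rewrite ltrD2l gt0_cp.
  rewrite in_itv/= => /andP[c1 c2]; exists c.
  by rewrite ltr_distl c1 c2.
have bx : ball (map_mx ratr (\row_i c i) : 'rV[R]_n) (ratr q) x.
  split=> // i j; rewrite !mxE ord1 /ball/=; exact: cP.
exists (\row_i c i, q) => //= y yb; apply: eU.
apply: (@ball_split _ _ (map_mx ratr (\row_i c i) : 'rV[R]_n)).
  by apply: ball_sym; apply: le_ball bx; exact: ltW.
by apply: le_ball yb; exact: ltW.
Qed.

Lemma measurable_fun_rV d0 (T : measurableType d0) n (g : T -> borel 'rV[R]_n) :
  (forall i, measurable_fun [set: T] (fun t => (g t : 'rV[R]_n) 0 i)) ->
  measurable_fun [set: T] g.
Proof.
move=> mg; apply: measurability; first by [].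
move=> _ [U oU <-]; rewrite setTI (open_rV_rat oU) preimage_bigcup.
rewrite bigcup_mkcond; apply: countable_bigcupT_measurable => [|[q e]].
  exact: countableP.
case: ifPn => // _; rewrite /=.
rewrite [X in measurable X](_ : _ = [set t | 0 < ratr e :> R] `&`
    \bigcap_(i in [set: 'I_n]) [set t | `|ratr (q 0 i) - (g t : 'rV[R]_n) 0 i|
      < ratr e]); last first.
  apply/seteqP; split => t /=.
    by move=> [e0 gt]; split => // i _; have := gt 0 i; rewrite !mxE.
  by move=> [e0 gt]; split => // i j; rewrite !mxE ord1; exact: gt.
apply: measurableI.
  have [e0|e0] := pselect (0 < ratr e :> R).
    by rewrite (_ : [set _ | _] = setT) //; apply/seteqP; split.
  by rewrite (_ : [set _ | _] = set0) //; apply/seteqP; split.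
apply: fin_bigcap_measurable => [|i _]; first exact: finite_finset.
rewrite -[X in measurable X]setTI.
have -> : [set t | `|ratr (q 0 i) - (g t : 'rV[R]_n) 0 i| < ratr e] =
    (fun t => (g t : 'rV[R]_n) 0 i) @^-1` ball (ratr (q 0 i) : R) (ratr e).
  by [].
apply: mg => //; exact: measurable_ball.
Qed.

Definition consv n (x : borel 'rV[R]_n * measurableTypeR R) : borel 'rV[R]_n.+1 :=
  \row_(i < n.+1) (if unlift ord0 i is Some j then (x.1 : 'rV[R]_n) 0 j else x.2).

Lemma measurable_consv n : measurable_fun [set: borel 'rV[R]_n * measurableTypeR R]
  (@consv n).
Proof.
apply: measurable_fun_rV => i.
rewrite (_ : (fun _ => _) = fun x =>
  if unlift ord0 i is Some j then (x.1 : 'rV[R]_n) 0 j else x.2); last first.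
  by apply/funext => x; rewrite mxE.
case: unliftP => [j _|_]; last exact: measurable_snd.
exact: (measurableT_comp (@borel_measurable_coord n j) measurable_fst).
Qed.

Definition lebesgue_succ n (m : {measure set (borel 'rV[R]_n) -> \bar R}) :
  set (borel 'rV[R]_n.+1) -> \bar R :=
  pushforward (m \x @lebesgue_measure R)%E (@consv n).

Section lebesgue_succ_measure.
Variables (n : nat) (m : {measure set (borel 'rV[R]_n) -> \bar R}).

Let lebesgue_succ0 : (lebesgue_succ m set0 = 0)%E.
Proof. by rewrite /lebesgue_succ /pushforward preimage_set0 measure0. Qed.

Let lebesgue_succ_ge0 B : (0 <= lebesgue_succ m B)%E.
Proof. by rewrite /lebesgue_succ /pushforward; exact: measure_ge0. Qed.

Let lebesgue_succ_sigma_additive : semi_sigma_additive (lebesgue_succ m).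
Proof.
move=> F mF tF mUF; rewrite /lebesgue_succ /pushforward preimage_bigcup.
have mc B : measurable B -> measurable (@consv n @^-1` B).
  by move=> mB; rewrite -[X in measurable X]setTI; exact: measurable_consv.
apply: measure_semi_sigma_additive => [k||]; first exact: mc.
  apply/trivIsetP => /= i j _ _ ij; rewrite -preimage_setI.
  by move/trivIsetP : tF => /(_ _ _ _ _ ij) ->//; rewrite preimage_set0.
by rewrite -preimage_bigcup; exact: mc.
Qed.

HB.instance Definition _ := isMeasure.Build _ _ _ (lebesgue_succ m)
  lebesgue_succ0 lebesgue_succ_ge0 lebesgue_succ_sigma_additive.

End lebesgue_succ_measure.

(* Lebesgue measure on R^n, as the iterated product of one-dimensional ones. *)
Fixpoint lebesgue_rV (n : nat) : {measure set (borel 'rV[R]_n) -> \bar R} :=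
  match n return {measure set (borel 'rV[R]_n) -> \bar R} with
  | 0 => [the {measure set (borel 'rV[R]_0) -> \bar R} of @dirac _ (borel 'rV[R]_0) (0 : 'rV[R]_0) R]
  | n'.+1 => [the {measure set (borel 'rV[R]_n'.+1) -> \bar R} of
                lebesgue_succ (lebesgue_rV n')]
  end.

End lebesgue.

Section mdp.
Context {R : realType} {S A : ptopologicalType}.
Variables (P : R.-pker (borel S * borel A)%type ~> borel S) (r : S -> A -> R).
Variables (gamma tau : R) (mu : {finite_measure set (borel A) -> \bar R}).

(* A policy is given by its density p s a = dpi/dmu (a | s). *)
Section policy.
Variable p : S -> A -> R.

Definition policy (s : S) : set (borel A) -> \bar R :=
  fun B => (\int[mu]_(a in B) (p s a)%:E)%E.

(* The laws of a_n and of s_{n+1} given the past are prescribed on the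
   pi-systems of past cylinders, which generate the respective sigma-algebras. *)
Definition trajectory (s0 : S) d (Om : measurableType d) (Pr : probability Om R)
    (st : nat -> Om -> borel S) (ac : nat -> Om -> borel A) : Prop :=
  [/\ forall n, measurable_fun setT (st n),
      forall n, measurable_fun setT (ac n),
      forall B, measurable B -> Pr (st 0%N @^-1` B) = \d_(s0 : borel S) B
    & forall (n : nat) (E : nat -> set (borel S)) (F : nat -> set (borel A)),
      (forall k, measurable (E k)) -> (forall k, measurable (F k)) ->
      let H := [set w | (forall k, (k <= n)%N -> E k (st k w)) /\
                        (forall k, (k < n)%N -> F k (ac k w))] in
      let H' := H `&` ac n @^-1` F n in
      (forall B, measurable B ->
        Pr (H `&` ac n @^-1` B) = (\int[Pr]_(w in H) policy (st n w) B)%E) /\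
      (forall B, measurable B ->
        Pr (H' `&` st n.+1 @^-1` B) =
        (\int[Pr]_(w in H') P (st n w, ac n w) B)%E)].

Definition reg_reward (s : S) (a : A) : R := r s a - tau * ln (p s a).

Definition discounted_return (Om : Type) (st : nat -> Om -> S)
    (ac : nat -> Om -> A) (w : Om) : R :=
  limn (series (fun n : nat => gamma ^+ n * reg_reward (st n w) (ac n w))).

(* The expectation depends only on the law of the trajectory, and a trajectory
   exists by the Ionescu-Tulcea theorem, so the value below is unique. *)
Definition value (s : S) : R := get [set v : R |
  exists d (Om : measurableType d) (Pr : probability Om R)
    (st : nat -> Om -> borel S) (ac : nat -> Om -> borel A),
    trajectory s Pr st ac /\
    v%:E = ('E_Pr[discounted_return st ac])%E].

Definition value_at (rho : probability (borel S) R) : R := rint rho value.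

Definition qvalue (s : S) (a : A) : R := r s a + gamma * rint (P (s, a)) value.

Definition state_kernel (s : S) : set (borel S) -> \bar R :=
  fun B => (\int[policy s]_a P (s, a) B)%E.

Fixpoint state_kernel_iter (n : nat) (s : S) : set (borel S) -> \bar R :=
  if n is n'.+1
  then fun B => (\int[state_kernel s]_s' state_kernel_iter n' s' B)%E
  else \d_(s : borel S).

Definition occupancy (s : S) : set (borel S) -> \bar R := fun B =>
  ((1 - gamma)%:E *
   \sum_(0 <= n <oo) ((gamma ^+ n)%:E * state_kernel_iter n s B))%E.

Definition occupancy_at (rho : probability (borel S) R) :
  set (borel S) -> \bar R := fun B => (\int[rho]_s occupancy s B)%E.

End policy.

Section mean_field.
Context {d : nat}.
Variable f : 'rV[R]_d -> S -> A -> R.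

Definition normA1 : \bar R :=
  let esup (h : 'rV[R]_d -> S -> A -> R) : \bar R :=
    ess_sup mu (fun a => ereal_sup [set
      ess_sup (@lebesgue_rV R d) (fun theta => (h theta s a)%:E) | s in setT]) in
  maxe (esup (fun theta s a => `|f theta s a|))
       (esup (fun theta s a => enorm (grad (fun x => f x s a) theta))).

Definition classA1 : Prop :=
  [/\ measurable_fun [set: borel 'rV[R]_d * (borel S * borel A)]
        (fun x => f x.1 x.2.1 x.2.2),
      forall s, \forall a \ae mu,
        forall theta, differentiable (fun x => f x s a) theta
    & (normA1 < +oo)%E].

Definition logits (nu : probability (borel 'rV[R]_d) R) (s : S) (a : A) : R :=
  rint nu (fun theta => f theta s a).

Definition softmax (nu : probability (borel 'rV[R]_d) R) (s : S) (a : A) : R :=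
  expR (logits nu s a) / rint mu (fun a' : borel A => expR (logits nu s a')).

Variable rho : probability (borel S) R.

(* Linear functional derivative of J^{tau,0}. *)
Definition dJ (nu : probability (borel 'rV[R]_d) R) (theta : 'rV[R]_d) : R :=
  let p := softmax nu in
  (1 - gamma)^-1 *
  rint (occupancy_at p rho) (fun s : borel S =>
    rint (policy p s) (fun a : borel A =>
      (qvalue p s a - tau * ln (p s a)) *
      (f theta s a - rint (policy p s) (fun a' : borel A => f theta s a')))).

End mean_field.
End mdp.

Section potential.
Context {R : realType} {d : nat}.
Variable U : 'rV[R]_d -> R.

Definition gibbs : set (borel 'rV[R]_d) -> \bar R :=
  fun B => (\int[@lebesgue_rV R d]_(x in B) (expR (- U x))%:E)%E.

End potential.

Section divergence.
Context {R : realType} d (T : measurableType d).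

Definition is_density (nu m : set T -> \bar R) (q : T -> R) : Prop :=
  [/\ measurable_fun setT q, forall x, 0 <= q x
    & forall B, measurable B -> nu B = (\int[m]_(x in B) (q x)%:E)%E].

(* Any two densities agree nu-almost everywhere, so the choice is immaterial. *)
Definition KL (nu m : set T -> \bar R) : \bar R :=
  if `[< nu `<< m >]
  then (\int[nu]_x (ln (xget (cst 0) (is_density nu m) x))%:E)%E
  else +oo%E.

End divergence.

Section wasserstein.
Context {R : realType} {d : nat}.
Implicit Types nu : probability (borel 'rV[R]_d) R.

Definition P1 nu : Prop := (\int[nu]_x (enorm x)%:E < +oo)%E.

Definition coupling nu nu' : set (probability (borel 'rV[R]_d * borel 'rV[R]_d)%type R) :=
  [set g | forall B, measurable B -> g (B `*` setT) = nu B /\ g (setT `*` B) = nu' B].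

Definition W1 nu nu' : \bar R :=
  ereal_inf [set (\int[g]_xy (enorm (xy.1 - xy.2 : 'rV[R]_d))%:E)%E
            | g in coupling nu nu'].

Definition full_support nu : Prop :=
  forall O : set 'rV[R]_d, open O -> O !=set0 -> (0 < nu O)%E.

Definition local_max (J : probability (borel 'rV[R]_d) R -> \bar R) nu : Prop :=
  exists2 delta : R, 0 < delta &
    forall nu', P1 nu' -> (W1 nu nu' < delta%:E)%E -> (J nu' <= J nu)%E.

End wasserstein.

Section objective.
Context {R : realType} {S A : ptopologicalType} {d : nat}.
Variables (P : R.-pker (borel S * borel A)%type ~> borel S) (r : S -> A -> R).
Variables (gamma tau sigma : R).
Variables (mu : {finite_measure set (borel A) -> \bar R}).
Variables (rho : probability (borel S) R).
Variables (f : 'rV[R]_d -> S -> A -> R) (U : 'rV[R]_d -> R).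

Definition J (nu : probability (borel 'rV[R]_d) R) : \bar R :=
  ((value_at P r gamma tau mu (softmax mu f nu) rho)%:E -
   (if (sigma == 0)%R then 0 else (sigma ^+ 2 / 2)%R%:E * KL nu (gibbs U)))%E.

Definition L (nu : probability (borel 'rV[R]_d) R) (phi : 'rV[R]_d -> R)
    (theta : 'rV[R]_d) : R :=
  sigma ^+ 2 / 2 * laplacian phi theta +
  dotv (grad (dJ P r gamma tau mu f rho nu) theta -
        (sigma ^+ 2 / 2) *: grad U theta) (grad phi theta).

End objective.

(* Main.v *)
(* The objective at [nu] is compared with its values along the mixtures (1 - e) nu + e nu',
   which are W1-close to [nu] for small e. Performance differences show that the value changes by
   at least e (\int D dnu' - \int D dnu) - O(e^2), where D is the linear functional derivative.

   If sigma = 0, Dirac masses nu' give D <= \int D dnu everywhere; by full support and continuity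
   D is constant, so its gradient vanishes.

   If sigma > 0, a comparison with a smoothed truncation of [nu] shows that KL(nu) is finite, and
   convexity of KL gives \int D d(nu' - nu) <= (sigma^2 / 2) (KL(nu') - KL(nu)). Testing this with
   the restrictions to balls of the Gibbs measure proportional to exp(2 D / sigma^2 - U)
   identifies [nu] with that measure. The integral of L_nu phi is then a sum of integrals of
   partial derivatives of compactly supported functions, which vanish by translation
   invariance of Lebesgue measure.

   As grad f is only essentially bounded, the Lipschitz continuity of f, hence of D, along
   coordinate lines comes from the Goldowsky-Tonelli theorem. *)

From HB Require Import structures.
Require Import Defs.
From mathcomp Require Import all_boot all_order all_algebra.
From mathcomp Require Import all_classical all_reals all_analysis.
From mathcomp Require Import measurable_realfun ess_sup_inf ring lra.

Set Implicit Arguments.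
Unset Strict Implicit.
Unset Printing Implicit Defensive.

Import Order.TTheory GRing.Theory Num.Theory.
Import numFieldNormedType.Exports.

Local Open Scope classical_set_scope.
Local Open Scope ring_scope.

(** * Bounded measurable functions and positive functionals *)

(** The definitions put three obstacles in the way. Policies, state kernels and occupancy measures
    are bare set functions, and the value is picked by [get] among expectations over trajectories:
    measures have to be rebuilt, from positive functionals, and the value has to be shown to exist,
    by constructing the path measure, and to be unique. The features are regular only for almost
    every action; they are replaced by a truncation [g] with the same values and the same linear
    derivative. Finally, competitors must have a first moment, which the Gibbs law may lack since
    nothing bounds [U] from below at infinity; this is why it is restricted to balls.

    As [nu] is a maximum, only a lower bound on the value along mixtures is wanted: the relative
    entropy between the two policies has the favourable sign and is dropped. The remaining term is
    expanded explicitly, because logits are affine in the parameter law and a mixture of laws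
    therefore acts on the softmax policy by an exponential tilt. *)

Section setfun_integral.
Context d (T : measurableType d) (R : realType).
Local Open Scope ereal_scope.
Import HBNNSimple.

(** The integral is a supremum over simple functions, whose level sets are measurable. This is what
    lets the set functions of the model be exchanged for measures. *)
Lemma eq_setfun_integral (m1 m2 : set T -> \bar R) (f : T -> \bar R) :
  (forall B, measurable B -> m1 B = m2 B) -> \int[m1]_x f x = \int[m2]_x f x.
Proof.
move=> m12; rewrite /integral.
have E g : ereal_sup [set sintegral m1 h |
    h in [set h : {nnsfun T >-> R} | forall x, (h x)%:E <= g x]] =
  ereal_sup [set sintegral m2 h |
    h in [set h : {nnsfun T >-> R} | forall x, (h x)%:E <= g x]].
  congr ereal_sup; apply/seteqP; split => _ [h hg <-];
    exists h => //; rewrite /sintegral; apply: eq_fsbigr => r _;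
    by rewrite m12//; exact: measurable_funPTI.
by rewrite !E.
Qed.

End setfun_integral.

Section posfun.
Context d (T : measurableType d) (R : realType).
Local Open Scope ereal_scope.
Implicit Types (F : (T -> \bar R) -> \bar R) (f g : T -> \bar R).

Definition nnmfun f := measurable_fun setT f /\ forall x, 0 <= f x.

(* Kernels and policies are composed as functionals; [meas_posfun] recovers the measure. *)
Definition posfun F := [/\ forall f, nnmfun f -> 0 <= F f,
  forall f g, nnmfun f -> nnmfun g -> F (fun x => f x + g x) = F f + F g,
  forall (c : R) f, (0 <= c)%R -> nnmfun f -> F (fun x => c%:E * f x) = c%:E * F f,
  forall f g, nnmfun f -> nnmfun g -> (forall x, f x <= g x) -> F f <= F g
  & forall h : nat -> T -> \bar R, (forall n, nnmfun (h n)) ->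
    (forall x, nondecreasing_seq (h ^~ x)) ->
    F (fun x => limn (h ^~ x)) = limn (fun n => F (h n))].

Lemma nnmfun_cst (c : R) : (0 <= c)%R -> nnmfun (fun=> c%:E).
Proof. by move=> c0; split => // x; rewrite lee_fin. Qed.

Lemma nnmfunM f g : nnmfun f -> nnmfun g -> nnmfun (fun x => f x * g x).
Proof. by move=> [mf f0] [mg g0]; split => [|x]; [exact: emeasurable_funM|exact: mule_ge0]. Qed.

Lemma nnmfunZ (c : R) f : (0 <= c)%R -> nnmfun f -> nnmfun (fun x => c%:E * f x).
Proof. by move=> c0 hf; apply: nnmfunM => //; exact: nnmfun_cst. Qed.

Lemma nnmfun_indic (A : set T) : measurable A -> nnmfun (fun x => (\1_A x)%:E).
Proof.
move=> mA; split => [|x]; last by rewrite lee_fin.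
by apply/measurable_EFinP; exact: measurable_indic.
Qed.

Lemma posfun_integral (m : {measure set T -> \bar R}) :
  posfun (fun f => \int[m]_x f x).
Proof.
split => [f [mf f0]|f g [mf f0] [mg g0]|c f c0 [mf f0]|f g [mf f0] [mg g0] fg|h hh ndh].
- exact: integral_ge0.
- by rewrite ge0_integralD.
- by rewrite ge0_integralZl.
- exact: ge0_le_integral.
- rewrite monotone_convergence// => n; first by case: (hh n).
  by move=> x _; case: (hh n).
Qed.

Lemma posfun0 F : posfun F -> F (fun=> 0) = 0.
Proof.
case=> _ _ FZ _ _; have := FZ 0%R (fun=> 0) (lexx _) (nnmfun_cst (lexx _)).
by under eq_fun do rewrite mul0e; move=> ->; rewrite mul0e.
Qed.

Lemma posfun_sum F (I : Type) (s : seq I) (h : I -> T -> \bar R) : posfun F ->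
  (forall i, nnmfun (h i)) ->
  F (fun x => \sum_(i <- s) h i x) = \sum_(i <- s) F (h i).
Proof.
move=> hF hh; have nns l : nnmfun (fun x => \sum_(i <- l) h i x).
  split=> [|x]; last by apply: sume_ge0 => i _; case: (hh i).
  by apply: emeasurable_sum => i; case: (hh i).
elim: s => [|i s ih].
  by rewrite big_nil; under eq_fun do rewrite big_nil; exact: posfun0.
rewrite big_cons -ih; under eq_fun do rewrite big_cons.
by case: hF => _ FD _ _ _; exact: FD.
Qed.

Section posfun_measure.
Variables (F : (T -> \bar R) -> \bar R) (hF : posfun F).

(** The value 0 off the measurable sets keeps the function nonnegative on all sets, as the measure
    structure asks; the proof argument is there for the instance declared below. *)
Definition mposfun (_ : posfun F) (A : set T) : \bar R :=
  if `[< measurable A >] then F (fun x => (\1_A x)%:E) else 0.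

Let mF := mposfun hF.

Lemma mposfunE A : measurable A -> mF A = F (fun x => (\1_A x)%:E).
Proof. by move=> mA; rewrite /mF /mposfun asboolT. Qed.

Let mposfun0 : mF set0 = 0.
Proof.
rewrite mposfunE//; under eq_fun do rewrite indic0; exact: posfun0.
Qed.

Let mposfun_ge0 A : 0 <= mF A.
Proof.
rewrite /mF /mposfun; case: asboolP => // mA.
by case: hF => F0 _ _ _ _; apply: F0; exact: nnmfun_indic.
Qed.

Let mposfun_sigma_additive : semi_sigma_additive mF.
Proof.
move=> A mA tA mUA; rewrite mposfunE//.
have -> : (fun x : T => (\1_(\bigcup_n A n) x)%:E) =
    (fun x => limn (fun n => \sum_(0 <= i < n) (\1_(A i) x)%:E : \bar R)).
  apply/funext => x; rewrite indic_bigcup//.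
set G := fun n x => \sum_(0 <= i < n) (\1_(A i) x)%:E : \bar R.
have hG n : nnmfun (G n).
  split => [|x]; last by apply: sume_ge0 => i _; rewrite lee_fin.
  by apply: emeasurable_sum => i; case: (nnmfun_indic (mA i)).
have ndG x : nondecreasing_seq (G ^~ x).
  apply/nondecreasing_seqP => n; rewrite /G big_nat_recr//=.
  by rewrite leeDl// lee_fin.
have E n : \sum_(0 <= i < n) mF (A i) = F (G n).
  rewrite posfun_sum//; last by move=> i; exact: nnmfun_indic.
  by apply: eq_bigr => i _; rewrite mposfunE.
rewrite (_ : (fun _ => _) = (fun n => F (G n))); last exact/funext.
have [_ _ _ Fle Flim] := hF.
rewrite (Flim G hG ndG).
apply: ereal_nondecreasing_is_cvgn => a b ab; apply: Fle => // x; exact: ndG.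
Qed.

HB.instance Definition _ := isMeasure.Build _ _ _ mF
  mposfun0 mposfun_ge0 mposfun_sigma_additive.

Definition meas_posfun : {measure set T -> \bar R} := mF.

Import HBNNSimple.

(** By linearity both sides agree on simple functions, and both pass to increasing limits. *)
Lemma integral_posfun f : nnmfun f -> \int[meas_posfun]_x f x = F f.
Proof.
move=> [mf f0].
have nn (h : {nnsfun T >-> R}) : \int[meas_posfun]_x (h x)%:E = F (fun x => (h x)%:E).
  (* The coefficient is written with an absolute value because homogeneity wants a nonnegative
     scalar for every index, including reals that are not values of [h]. *)
  have hE : (fun x => (h x)%:E) =
      (fun x => \sum_(r <- finmap.enum_fset (fset_set (range h))) (`|r|%:E * (\1_(h @^-1` [set r]) x)%:E)).
    apply/funext => x; rewrite fimfunE -fsumEFin// fsbig_finite//=.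
    rewrite big_seq [RHS]big_seq; apply: eq_bigr => r.
    rewrite in_fset_set// inE/= => -[y _ <-].
    by rewrite ger0_norm// EFinM.
  rewrite hE.
  have mh (r : R) : measurable (h @^-1` [set r]) by exact: measurable_funPTI.
  have hp (r : R) := nnmfunZ (normr_ge0 r) (nnmfun_indic (mh r)).
  rewrite (posfun_sum _ hF)// (posfun_sum _ (posfun_integral _))//.
  apply: eq_bigr => r _; have [_ _ FZ _ _] := hF.
  rewrite FZ//; last exact: nnmfun_indic.
  have [_ _ IZ _ _] := posfun_integral meas_posfun.
  rewrite IZ//; last exact: nnmfun_indic.
  rewrite integral_indic// setIT; congr (_ * _); exact: mposfunE.
pose f_ := nnsfun_approx measurableT mf.
have hf_ n : nnmfun (fun x => (f_ n x)%:E).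
  by split=> [|x]; [exact/measurable_EFinP|rewrite lee_fin].
have ndf_ x : nondecreasing_seq (fun n => (f_ n x)%:E).
  by move=> a b ab; rewrite lee_fin; exact/lefP/nd_nnsfun_approx.
have fE : f = (fun x => limn (fun n => (f_ n x)%:E)).
  by apply/funext => x; apply/esym/cvg_lim => //; exact: cvg_nnsfun_approx.
rewrite fE; have [_ _ _ _ ->//] := posfun_integral meas_posfun.
have [_ _ _ _ ->//] := hF.
by congr (limn _); apply/funext => n; exact: nn.
Qed.

End posfun_measure.

End posfun.

(** An alias that carries the proof of unit mass, so that the probability structure can be attached
    to it. *)
Definition mkprob_fun d (T : measurableType d) (R : realType)
  (m : {measure set T -> \bar R}) (_ : m setT = 1%E) : set T -> \bar R := m.

Section mkprob.
Context d (T : measurableType d) (R : realType).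
Variables (m : {measure set T -> \bar R}) (m1 : m setT = 1%E).

HB.instance Definition _ := Measure.on (mkprob_fun m1).
HB.instance Definition _ := Measure_isProbability.Build _ _ _ (mkprob_fun m1) m1.

Definition mkprob : probability T R := mkprob_fun m1.

End mkprob.

Section bounded_measurable.
Context d (T : measurableType d) (R : realType).
Implicit Types (h g : T -> R).

Definition bmf h := measurable_fun setT h /\ exists M, forall x, `|h x| <= M.

Lemma bmf_cst (c : R) : bmf (fun=> c).
Proof. by split; [exact: measurable_cst|exists `|c|]. Qed.

Lemma bmfD h g : bmf h -> bmf g -> bmf (fun x => h x + g x).
Proof.
move=> [mh [M hM]] [mg [N gN]]; split; first exact: measurable_funD.
by exists (M + N) => x; rewrite (le_trans (ler_normD _ _))// lerD.
Qed.

Lemma bmfM h g : bmf h -> bmf g -> bmf (fun x => h x * g x).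
Proof.
move=> [mh [M hM]] [mg [N gN]]; split; first exact: measurable_funM.
by exists (M * N) => x; rewrite normrM ler_pM.
Qed.

Lemma bmfZ c h : bmf h -> bmf (fun x => c * h x).
Proof. by move=> hh; apply: bmfM => //; exact: bmf_cst. Qed.

Lemma bmfN h : bmf h -> bmf (fun x => - h x).
Proof.
by move=> hh; under eq_fun do rewrite -mulN1r; exact: bmfZ.
Qed.

Lemma bmfB h g : bmf h -> bmf g -> bmf (fun x => h x - g x).
Proof. by move=> hh hg; apply: bmfD => //; exact: bmfN. Qed.

Lemma bmf_indic (A : set T) : measurable A -> bmf (\1_A : T -> R).
Proof.
move=> mA; split; first exact: measurable_indic.
by exists 1 => x; rewrite indicE; case: (_ \in _); rewrite ?normr1 ?normr0.
Qed.

Lemma bmf_expR h : bmf h -> bmf (fun x => expR (h x)).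
Proof.
move=> [mh [M hM]]; split; first exact: measurableT_comp.
exists (expR M) => x; rewrite ger0_norm ?expR_ge0// ler_expR.
exact: le_trans (ler_norm _) (hM x).
Qed.

Lemma bmf_nnmfun h : bmf h -> (forall x, 0 <= h x) -> nnmfun (fun x => (h x)%:E).
Proof.
by move=> [mh _] h0; split => [|x]; [exact/measurable_EFinP|rewrite lee_fin].
Qed.

Section rint.
Variable m : {measure set T -> \bar R}.
Hypothesis fm : (m setT < +oo)%E.

Lemma bmf_integrable h : bmf h -> m.-integrable setT (EFin \o h).
Proof.
move=> [mh [M hM]]; apply: measurable_bounded_integrable => //.
exists M; split; first exact: num_real.
by move=> N MN x _ /=; rewrite (le_trans (hM x))// ltW.
Qed.

Lemma rintE h : bmf h -> (\int[m]_x (h x)%:E)%E = (rint m h)%:E.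
Proof.
by move=> /bmf_integrable hh; rewrite /rint fineK//; exact: integrable_fin_num.
Qed.

Lemma rint_cst c : rint m (fun=> c) = c * fine (m setT).
Proof.
rewrite /rint integral_cst// fineM// fin_numElt fm andbT.
exact: lt_le_trans (measure_ge0 m setT).
Qed.

Lemma rintD h g : bmf h -> bmf g -> rint m (fun x => h x + g x) = rint m h + rint m g.
Proof.
move=> hh hg; apply: EFin_inj; rewrite EFinD -!rintE//; last exact: bmfD.
by rewrite -integralD_EFin//; exact: bmf_integrable.
Qed.

Lemma rintZ c h : bmf h -> rint m (fun x => c * h x) = c * rint m h.
Proof.
move=> hh; apply: EFin_inj; rewrite EFinM -!rintE//; last exact: bmfZ.
under eq_integral do rewrite EFinM; rewrite integralZl//.
exact: bmf_integrable.
Qed.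

Lemma rintB h g : bmf h -> bmf g -> rint m (fun x => h x - g x) = rint m h - rint m g.
Proof.
move=> hh hg; rewrite rintD//; last exact: bmfN.
congr (_ + _); rewrite -[RHS]mulN1r -rintZ//; congr rint.
by apply/funext => x; rewrite mulN1r.
Qed.

Lemma le_rint h g : bmf h -> bmf g -> (forall x, h x <= g x) -> rint m h <= rint m g.
Proof.
move=> hh hg hg'; rewrite -lee_fin -!rintE//; apply: le_integral => //.
- exact: bmf_integrable.
- exact: bmf_integrable.
- by move=> x _; rewrite lee_fin.
Qed.

Lemma rint_abs_le h M : bmf h -> (forall x, `|h x| <= M) ->
  `|rint m h| <= M * fine (m setT).
Proof.
move=> hh hM; rewrite ler_norml -mulNr -!rint_cst; apply/andP; split;
  (apply: le_rint => //; first exact: bmf_cst);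
  by move=> x; have := hM x; rewrite ler_norml => /andP[].
Qed.

Lemma eq_rint h g : (forall x, h x = g x) -> rint m h = rint m g.
Proof. by move=> hg; congr rint; exact/funext. Qed.

Lemma ae_eq_rint h g : measurable_fun setT h -> measurable_fun setT g ->
  (\forall x \ae m, h x = g x) -> rint m h = rint m g.
Proof.
move=> mh mg hg; rewrite /rint; congr fine; apply: ae_eq_integral => //.
- exact/measurable_EFinP.
- exact/measurable_EFinP.
- by apply: filterS hg => x hgx _ /=; rewrite hgx.
Qed.

Lemma cvg_rint (h : nat -> T -> R) g M : (forall n, bmf (h n)) ->
  (forall n x, `|h n x| <= M) -> measurable_fun setT g ->
  (\forall x \ae m, h n x @[n --> \oo] --> g x) ->
  rint m (h n) @[n --> \oo] --> rint m g.
Proof.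
move=> hh hM mg hg.
have mh n : measurable_fun setT (EFin \o h n) by apply/measurable_EFinP; case: (hh n).
have [gi c] : m.-integrable setT (fun x => (g x)%:E) /\
    ([sequence \int[m]_x (h n x)%:E]_n @ \oo --> \int[m]_x (g x)%:E)%E.
  suff [gi _ c] : [/\ m.-integrable setT (fun x => (g x)%:E),
      [sequence \int[m]_x `|(h n x)%:E - (g x)%:E|]_n @ \oo --> 0%E
    & [sequence \int[m]_x (h n x)%:E]_n @ \oo --> \int[m]_x (g x)%:E]%E by [].
  apply: (@dominated_convergence _ _ _ m setT measurableT
    (fun n x => (h n x)%:E) (fun x => (g x)%:E) (fun=> M%:E)) => //.
  - exact/measurable_EFinP.
  - by apply: filterS hg => x hx _; apply: cvg_EFin => //; exact: nearW.
  - by apply: bmf_integrable; exact: bmf_cst.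
  - by apply: aeW => x n _; rewrite lee_fin.
rewrite /rint; apply: fine_cvg; rewrite fineK//; exact: integrable_fin_num.
Qed.

End rint.

End bounded_measurable.

Lemma bmf_comp d d' (T : measurableType d) (T' : measurableType d') (R : realType)
    (h : T -> R) (g : T' -> T) : bmf h -> measurable_fun setT g -> bmf (fun x => h (g x)).
Proof.
move=> [mh [M hM]] mg; split; first exact: measurableT_comp.
by exists M => x.
Qed.

Section bounded_measurable_product.
Context d d' (X : measurableType d) (Y : measurableType d') (R : realType).

(* Shifting by a bound reduces identities between bounded functions to
   nonnegative ones. *)
Lemma bmf_shift (h : X -> R) : bmf h -> exists2 M, 0 <= M & forall x, 0 <= h x + M.
Proof.
move=> [_ [M hM]]; exists `|M| => // x.
by rewrite -lerBlDr sub0r; have := le_trans (hM x) (ler_norm M); rewrite ler_norml => /andP[].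
Qed.

Lemma bmf_rint_kernel (k : R.-fker X ~> Y) (h : X * Y -> R) C : bmf h ->
  (forall x, (k x setT <= C%:E)%E) ->
  bmf (fun x => rint (k x) (fun y => h (x, y))).
Proof.
move=> hh kC; have [mh [M hM]] := hh.
have fk x : (k x setT < +oo)%E by apply: le_lt_trans (kC x) _; rewrite ltry.
have hx x : bmf (fun y => h (x, y)).
  by apply: bmf_comp => //; exact: measurable_pair1.
split.
  have [N N0 hN] : exists2 N, 0 <= N & forall x, 0 <= h x + N.
    exists `|M| => // x; rewrite -lerBlDr sub0r.
    by have := le_trans (hM x) (ler_norm M); rewrite ler_norml => /andP[].
  rewrite (_ : (fun x => _) = fun x => fine (\int[k x]_y (h (x, y) + N)%:E) - N * fine (k x setT)).
    apply: measurable_funB.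
      apply: measurableT_comp => //.
      apply: (measurable_fun_integral_finite_kernel (fun z => (h z + N)%:E)).
        by move=> z; rewrite lee_fin.
      by apply/measurable_EFinP; exact: measurable_funD.
    apply: measurable_funM => //.
    by apply: measurableT_comp => //; exact: measurable_kernel.
  apply/funext => x; rewrite -[X in X - _]/(rint (k x) (fun y => h (x, y) + N)) rintD//.
    by rewrite rint_cst// addrK.
  exact: bmf_cst.
exists (`|M| * `|C|) => x; apply: le_trans (rint_abs_le (fk x) (hx x) (fun y => hM (x, y))) _.
rewrite (le_trans (ler_norm _))// normrM ler_wpM2l// ger0_norm ?fine_ge0//.
apply: le_trans (ler_norm C); rewrite -lee_fin fineK//.
by rewrite ge0_fin_numE.
Qed.

Variables (m1 : {finite_measure set X -> \bar R}) (m2 : {finite_measure set Y -> \bar R}).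

Let f1 : (m1 setT < +oo)%E. Proof. exact: fin_num_fun_lty. Qed.
Let f2 : (m2 setT < +oo)%E. Proof. exact: fin_num_fun_lty. Qed.

Lemma bmf_pair1 (h : X * Y -> R) x : bmf h -> bmf (fun y => h (x, y)).
Proof. by move=> hh; apply: bmf_comp => //; exact: measurable_pair1. Qed.

Lemma bmf_pair2 (h : X * Y -> R) y : bmf h -> bmf (fun x => h (x, y)).
Proof. by move=> hh; apply: bmf_comp => //; exact: measurable_pair2. Qed.

Lemma bmf_rint1 (h : X * Y -> R) : bmf h -> bmf (fun x => rint m2 (fun y => h (x, y))).
Proof.
move=> hh; have [mh [M hM]] := hh; split; last first.
  by exists (M * fine (m2 setT)) => x; apply: rint_abs_le => //; exact: bmf_pair1.
have [N N0 hN] : exists2 N, 0 <= N & forall x, 0 <= h x + N.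
  exists `|M| => // x; rewrite -lerBlDr sub0r.
  by have := le_trans (hM x) (ler_norm M); rewrite ler_norml => /andP[].
rewrite (_ : (fun x => _) = fun x => fine (\int[m2]_y (h (x, y) + N)%:E) - N * fine (m2 setT)).
  apply: measurable_funB => //; apply: measurableT_comp => //.
  apply: (measurable_fun_fubini_tonelli_F (fun z => (h z + N)%:E)).
    by apply/measurable_EFinP; exact: measurable_funD.
  by move=> z; rewrite lee_fin.
apply/funext => x; rewrite -[X in X - _]/(rint m2 (fun y => h (x, y) + N)) rintD//.
- by rewrite rint_cst// addrK.
- exact: bmf_pair1.
- exact: bmf_cst.
Qed.

Lemma rint_fubini (h : X * Y -> R) : bmf h ->
  rint m1 (fun x => rint m2 (fun y => h (x, y))) =
  rint m2 (fun y => rint m1 (fun x => h (x, y))).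
Proof.
move=> hh; rewrite [LHS]/rint [RHS]/rint; congr fine.
under eq_integral do rewrite -(rintE f2 (bmf_pair1 _ hh)).
under [RHS]eq_integral do rewrite -(rintE f1 (bmf_pair2 _ hh)).
apply: (@Fubini _ _ _ _ _ m1 m2 (fun z => (h z)%:E)).
apply: bmf_integrable => //.
apply: (@le_lt_trans _ _ (m1 setT * m2 setT)%E).
  by rewrite -(product_measure1E m1 m2 measurableT measurableT) setXTT.
by rewrite lte_mul_pinfty// fin_num_measure.
Qed.

End bounded_measurable_product.

Lemma bmf_rint2 d d' (X : measurableType d) (Y : measurableType d') (R : realType)
    (m1 : {finite_measure set X -> \bar R}) (h : X * Y -> R) :
  bmf h -> bmf (fun y => rint m1 (fun x => h (x, y))).
Proof.
move=> hh; pose g (z : Y * X) := h (z.2, z.1).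
have hg : bmf g by apply: bmf_comp => //; exact: measurable_swap.
exact: (bmf_rint1 m1 hg).
Qed.

Lemma prob_fin d (T : measurableType d) (R : realType) (m : probability T R) :
  (m setT < +oo)%E.
Proof. by apply: le_lt_trans (probability_le1 m measurableT) _; rewrite ltry. Qed.

Lemma rint_pcst d (T : measurableType d) (R : realType) (m : probability T R) (c : R) :
  rint m (fun=> c) = c.
Proof.
have m1 : (m : {measure set T -> \bar R}) setT = 1%E by exact: probability_setT.
by rewrite (rint_cst (prob_fin m)) m1 mulr1.
Qed.

Lemma rint_pabs_le d (T : measurableType d) (R : realType) (m : probability T R)
  (h : T -> R) M : bmf h -> (forall x, `|h x| <= M) -> `|rint m h| <= M.
Proof.
have m1 : (m : {measure set T -> \bar R}) setT = 1%E by exact: probability_setT.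
by move=> hh hM; have := rint_abs_le (prob_fin m) hh hM; rewrite m1 mulr1.
Qed.

Section posfun_constructions.
Local Open Scope ereal_scope.
Context d (T : measurableType d) (R : realType).

Lemma posfun_comp d' (X : measurableType d') (F : (X -> \bar R) -> \bar R)
    (G : X -> (T -> \bar R) -> \bar R) : posfun F -> (forall x, posfun (G x)) ->
  (forall f, nnmfun f -> measurable_fun setT (G ^~ f)) ->
  posfun (fun f => F (G ^~ f)).
Proof.
move=> [F0 FD FZ Fle Flim] hG mG.
have nnG f : nnmfun f -> nnmfun (G ^~ f).
  by move=> hf; split; [exact: mG|move=> x; case: (hG x) => + _ _ _ _; exact].
split => [f hf|f g hf hg|c f c0 hf|f g hf hg fg|h hh ndh].
- exact/F0/nnG.
- rewrite -FD; [congr F|exact: nnG..].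
  by apply/funext => x; case: (hG x) => _ + _ _ _; exact.
- rewrite -FZ//; [congr F|exact: nnG].
  by apply/funext => x; case: (hG x) => _ _ + _ _; exact.
- by apply: Fle; [exact: nnG..|move=> x; case: (hG x) => _ _ _ + _; exact].
- rewrite -Flim; [congr F|by move=> n; exact: nnG|].
    by apply/funext => x; case: (hG x) => _ _ _ _; exact.
  move=> x a b ab; case: (hG x) => _ _ _ + _; apply => // y; exact: ndh.
Qed.

Lemma posfun_mul (F : (T -> \bar R) -> \bar R) (q : T -> R) : posfun F ->
  measurable_fun setT q -> (forall x, (0 <= q x)%R) ->
  posfun (fun f => F (fun x => f x * (q x)%:E)).
Proof.
move=> [F0 FD FZ Fle Flim] mq q0.
have hq : nnmfun (fun x => (q x)%:E) by split => [|x]; [exact/measurable_EFinP|rewrite lee_fin].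
split => [f hf|f g hf hg|c f c0 hf|f g hf hg fg|h hh ndh].
- by apply: F0; exact: nnmfunM.
- rewrite -FD; [congr F|exact: nnmfunM..].
  by apply/funext => x; rewrite ge0_muleDl//; [case: hf|case: hg].
- rewrite -FZ//; [congr F|exact: nnmfunM].
  by apply/funext => x; rewrite muleA.
- apply: Fle; [exact: nnmfunM..|move=> x].
  by rewrite lee_wpmul2r// lee_fin.
- rewrite -Flim; [congr F|by move=> n; exact: nnmfunM|].
    apply/funext => x; rewrite muleC -limeMl//.
      by congr (limn _); apply/funext => n; rewrite muleC.
    exact: ereal_nondecreasing_is_cvgn.
  by move=> x a b ab; rewrite lee_wpmul2r ?lee_fin//; exact: ndh.
Qed.

Lemma posfun_dirac (x : T) : posfun (fun f : T -> \bar R => f x).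
Proof.
by split => [f [_ ->]|f g _ _|c f _ _|f g _ _ ->|h _ _].
Qed.

Lemma posfun_setfun_integral (F : (T -> \bar R) -> \bar R) (m : set T -> \bar R) f :
  posfun F -> (forall B, measurable B -> m B = F (fun x => (\1_B x)%:E)) ->
  nnmfun f -> \int[m]_x f x = F f.
Proof.
move=> hF mF hf; rewrite -(integral_posfun hF hf); apply: eq_setfun_integral => B mB.
by rewrite mF// -(mposfunE hF mB).
Qed.

Lemma posfun_mix d' (X : measurableType d') (l : {measure set X -> \bar R})
    (k : X -> {measure set T -> \bar R}) :
  (forall U, measurable U -> measurable_fun setT (k ^~ U)) ->
  posfun (fun f => \int[l]_x \int[k x]_y f y).
Proof.
move=> mk; apply: (posfun_comp (posfun_integral l) (fun x => posfun_integral (k x))).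
by move=> f [mf f0]; exact: measurable_fun_integral_kernel.
Qed.

Lemma integral_density (m : {measure set T -> \bar R}) (m0 : set T -> \bar R) (q : T -> R) f :
  measurable_fun setT q -> (forall x, (0 <= q x)%R) ->
  (forall B, measurable B -> m0 B = \int[m]_(x in B) (q x)%:E) ->
  nnmfun f -> \int[m0]_x f x = \int[m]_x (f x * (q x)%:E).
Proof.
move=> mq q0 mE hf.
apply: (posfun_setfun_integral (posfun_mul (posfun_integral m) mq q0) _ hf) => B mB.
rewrite mE// integral_mkcond; apply: eq_integral => x _.
by rewrite patchE indicE; case: ifPn; rewrite ?mul1e ?mul0e.
Qed.

End posfun_constructions.

Section rint_constructions.
Context d (T : measurableType d) (R : realType).

Lemma eq_setfun_rint (m1 m2 : set T -> \bar R) (f : T -> R) :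
  (forall B, measurable B -> m1 B = m2 B) -> rint m1 f = rint m2 f.
Proof. by move=> m12; rewrite /rint (eq_setfun_integral _ m12). Qed.

(** Multiplication by [q >= 0] commutes with taking positive and negative parts, so the two
    integrals agree part by part, whether or not [f] is integrable. *)
Lemma rint_density (m : {measure set T -> \bar R}) (m0 : set T -> \bar R) (q : T -> R) f :
  measurable_fun setT q -> (forall x, 0 <= q x) ->
  (forall B, measurable B -> m0 B = (\int[m]_(x in B) (q x)%:E)%E) ->
  measurable_fun setT f -> rint m0 f = rint m (fun x => f x * q x).
Proof.
move=> mq q0 mE0 mf.
have hF := posfun_mul (posfun_integral m) mq q0; pose m' := meas_posfun hF.
have mm' B : measurable B -> m0 B = m' B.
  move=> mB; rewrite mE0// [m' B](mposfunE hF)// integral_mkcond.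
  by apply: eq_integral => x _; rewrite patchE indicE; case: ifPn; rewrite ?mul1e ?mul0e.
have mE B : measurable B -> m' B = (\int[m]_(x in B) (q x)%:E)%E.
  by move=> mB; rewrite -mm'// mE0.
rewrite (eq_setfun_rint _ mm') [LHS]/rint [RHS]/rint; congr fine.
rewrite [LHS]integralE [RHS]integralE; congr (_ - _)%E.
  rewrite (integral_density mq q0 mE); last first.
    by split => //; apply: measurable_funepos; exact/measurable_EFinP.
  apply: eq_integral => x _; rewrite !funeposE /= -EFin_max.
  by rewrite -EFin_max -EFinM -[in RHS](mul0r (q x)) maxr_pMl.
rewrite (integral_density mq q0 mE); last first.
  by split => //; apply: measurable_funeneg; exact/measurable_EFinP.
apply: eq_integral => x _; rewrite !funenegE /= -EFin_max.
by rewrite -EFin_max -EFinM -[in RHS](mul0r (q x)) -mulNr maxr_pMl.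
Qed.

Lemma rint_mix d' (X : measurableType d') (l : {measure set X -> \bar R})
    (k : X -> {measure set T -> \bar R}) (m : set T -> \bar R) (f : T -> R) :
  (l setT < +oo)%E -> (forall x, k x setT = 1%E) ->
  (forall U, measurable U -> measurable_fun setT (k ^~ U)) ->
  (forall B, measurable B -> m B = (\int[l]_x k x B)%E) ->
  bmf f -> rint m f = rint l (fun x => rint (k x) f).
Proof.
move=> fl k1 mk mE hf.
have fk x : (k x setT < +oo)%E by rewrite k1 ltry.
have [M M0 fM] := bmf_shift hf.
have hfM : bmf (fun x => f x + M) by apply: bmfD => //; exact: bmf_cst.
pose m' := meas_posfun (posfun_mix l mk).
have mm' B : measurable B -> m B = m' B.
  move=> mB; rewrite mE// [m' B](mposfunE (posfun_mix l mk))//.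
  by apply: eq_integral => x _; rewrite integral_indic// setIT.
rewrite (eq_setfun_rint _ mm').
have mT : m' setT = l setT.
  rewrite -mm'// mE//; under eq_integral do rewrite k1.
  by rewrite integral_cst// mul1e.
have fm' : (m' setT < +oo)%E by rewrite mT.
have bk : bmf (fun x => rint (k x) f).
  have mk' : measurable_fun setT (fun x => rint (k x) f).
    rewrite (_ : (fun x => _) = fun x => fine (\int[k x]_y (f y + M)%:E) - M).
      apply: measurable_funB => //; apply: measurableT_comp => //.
      apply: measurable_fun_integral_kernel => //.
      by case: (bmf_nnmfun hfM fM).
    apply/funext => x; rewrite -/(rint (k x) (fun y => f y + M)) rintD//; last exact: bmf_cst.
    by rewrite rint_cst// k1 mulr1 addrK.
  split => //; have [_ [N hN]] := hf; exists N => x.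
  by apply: le_trans (rint_abs_le (fk x) hf hN) _; rewrite k1 mulr1.
apply: (@addIr _ (M * fine (l setT))).
rewrite -{1}mT -[in LHS]rint_cst// -rintD//; last exact: bmf_cst.
rewrite -[in RHS]rint_cst// -rintD//; last exact: bmf_cst.
apply: EFin_inj; rewrite -!rintE//; last first.
  by apply: bmfD => //; exact: bmf_cst.
rewrite (integral_posfun (posfun_mix l mk) (bmf_nnmfun hfM fM)).
apply: eq_integral => x _; rewrite rintE// rintD//; last exact: bmf_cst.
by rewrite rint_cst// k1 mulr1.
Qed.

End rint_constructions.

(** * Occupancy measures *)

Section markov_occupancy.
Context d (X : measurableType d) (R : realType).
Variables (K : X -> {measure set X -> \bar R}) (gamma : R).
Hypothesis K1 : forall x, K x setT = 1%E.
Hypothesis mK : forall U, measurable U -> measurable_fun setT (K ^~ U).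
Hypothesis hgamma : 0 <= gamma < 1.

Let g0 : 0 <= gamma. Proof. by case/andP: hgamma. Qed.
Let g1 : gamma < 1. Proof. by case/andP: hgamma. Qed.

Let fK x : (K x setT < +oo)%E. Proof. by rewrite K1 ltry. Qed.

Lemma rint_prob_le (u : X -> R) M x : bmf u -> (forall y, `|u y| <= M) ->
  `|rint (K x) u| <= M.
Proof. by move=> hu uM; have := rint_abs_le (fK x) hu uM; rewrite K1 mulr1. Qed.

Lemma bmf_markov (u : X -> R) : bmf u -> bmf (fun x => rint (K x) u).
Proof.
move=> hu; have [M M0 uM] := bmf_shift hu.
have huM : bmf (fun x => u x + M) by apply: bmfD => //; exact: bmf_cst.
split.
  rewrite (_ : (fun x => _) = fun x => fine (\int[K x]_y (u y + M)%:E) - M).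
    apply: measurable_funB => //; apply: measurableT_comp => //.
    apply: measurable_fun_integral_kernel => //.
    by case: (bmf_nnmfun huM uM).
  apply/funext => x; rewrite -/(rint (K x) (fun y => u y + M)) rintD//; last exact: bmf_cst.
  by rewrite rint_cst// K1 mulr1 addrK.
by have [_ [N uN]] := hu; exists N => x; exact: rint_prob_le.
Qed.

(** A bound [M] on [|e|] improves to [c + gamma * M]; iterating gives
    [gamma ^+ n * M + c / (1 - gamma)], and [n] tends to infinity. *)
Lemma markov_contraction (e : X -> R) c : bmf e ->
  (forall x, `|e x - gamma * rint (K x) e| <= c) ->
  forall x, `|e x| <= c / (1 - gamma).
Proof.
move=> he ec x; have [_ [M eM]] := he.
have g1' : 1 - gamma != 0 by rewrite subr_eq0 eq_sym lt_eqF.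
have eMn n y : `|e y| <= gamma ^+ n * M + c / (1 - gamma).
  have c0 : 0 <= c / (1 - gamma).
    by rewrite divr_ge0 ?subr_ge0 ?(ltW g1)// (le_trans _ (ec y)).
  elim: n y => [|n ih] y; first by rewrite expr0 mul1r (le_trans (eM y))// lerDl.
  rewrite -[e y](subrK (gamma * rint (K y) e)) (le_trans (ler_normD _ _))//.
  apply: (@le_trans _ _ (c + gamma * (gamma ^+ n * M + c / (1 - gamma)))).
    by rewrite lerD// normrM (ger0_norm g0) ler_wpM2l// rint_prob_le.
  rewrite le_eqVlt; apply/orP; left; apply/eqP.
  by rewrite exprS; field.
have cv : gamma ^+ n * M + c / (1 - gamma) @[n --> \oo] --> 0 * M + c / (1 - gamma).
  apply: cvgD; last exact: cvg_cst.
  apply: cvgM; last exact: cvg_cst.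
  by apply: cvg_expr; rewrite ger0_norm.
have -> : c / (1 - gamma) = limn (fun n => gamma ^+ n * M + c / (1 - gamma)).
  by rewrite (cvg_lim _ cv)// mul0r add0r.
apply: limr_ge; first by apply/cvg_ex; exists (0 * M + c / (1 - gamma)).
exact: nearW.
Qed.

Local Open Scope ereal_scope.

Fixpoint markov_iter (n : nat) (f : X -> \bar R) : X -> \bar R :=
  if n is n'.+1 then fun x => \int[K x]_y markov_iter n' f y else f.

Lemma posfun_markov_iter n : (forall x, posfun (fun f => markov_iter n f x)) /\
  (forall f, nnmfun f -> measurable_fun setT (markov_iter n f)).
Proof.
elim: n => [|n [ih1 ih2]] /=.
  by split => [x|f []//]; exact: posfun_dirac.
split => [x|f hf].
  exact: (posfun_comp (posfun_integral (K x)) ih1 ih2).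
apply: measurable_fun_integral_kernel => // [y|]; last exact: ih2.
by case: (ih1 y) => + _ _ _ _; exact.
Qed.

Lemma markov_iter_ge0 n f x : nnmfun f -> 0 <= markov_iter n f x.
Proof. by move=> hf; case: (posfun_markov_iter n) => /(_ x)[+ _ _ _ _] _; exact. Qed.

(** The discounted series is written as an integral over the counting measure so that [posfun_comp]
    applies; [occ_funE] turns it back into the series of [occupancy]. *)
Definition occ_fun (f : X -> \bar R) (x : X) : \bar R :=
  (1 - gamma)%:E * \int[counting]_n ((gamma ^+ n)%:E * markov_iter n f x).

Lemma posfun_occ_fun x : posfun (fun f => occ_fun f x).
Proof.
have hp : posfun (fun f => \int[counting]_n ((gamma ^+ n)%:E * markov_iter n f x)).
  apply: (posfun_comp (posfun_integral counting) (G := fun n f => _)) => [n|f hf] //.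
  have [+ _] := posfun_markov_iter n; move=> /(_ x) [F0 FD FZ Fle Flim].
  have gn : (0 <= gamma ^+ n)%R by exact: exprn_ge0.
  split => [f hf|f g hf hg|c f c0 hf|f g hf hg fg|h hh ndh].
  - by rewrite mule_ge0// F0.
  - by rewrite FD// ge0_muleDr//; exact: F0.
  - by rewrite FZ// muleCA.
  - by rewrite lee_wpmul2l// Fle.
  - rewrite Flim// limeMl//; apply: ereal_nondecreasing_is_cvgn => a b ab.
    by apply: Fle => // y; exact: ndh.
case: hp => F0 FD FZ Fle Flim.
have gn : (0 <= 1 - gamma)%R by rewrite subr_ge0 ltW.
rewrite /occ_fun; split => [f hf|f g hf hg|c f c0 hf|f g hf hg fg|h hh ndh].
- by rewrite mule_ge0// F0.
- by rewrite FD// ge0_muleDr//; exact: F0.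
- by rewrite FZ// muleCA.
- by rewrite lee_wpmul2l// Fle.
- rewrite Flim// limeMl//; apply: ereal_nondecreasing_is_cvgn => a b ab.
  by apply: Fle => // y; exact: ndh.
Qed.

Lemma occ_funE f x : nnmfun f -> occ_fun f x =
  (1 - gamma)%:E * \sum_(0 <= n <oo) ((gamma ^+ n)%:E * markov_iter n f x).
Proof.
move=> hf; rewrite /occ_fun ge0_integral_count// => n.
by rewrite mule_ge0 ?markov_iter_ge0// lee_fin exprn_ge0.
Qed.

Lemma measurable_occ_fun f : nnmfun f -> measurable_fun setT (occ_fun f).
Proof.
move=> hf; rewrite (_ : occ_fun f = fun x => (1 - gamma)%:E *
    \sum_(0 <= n <oo) ((gamma ^+ n)%:E * markov_iter n f x)); last first.
  by apply/funext => x; exact: occ_funE.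
apply: emeasurable_funM => //; apply: ge0_emeasurable_sum => [n x _ _|n _].
  by rewrite mule_ge0 ?markov_iter_ge0// lee_fin exprn_ge0.
by apply: emeasurable_funM => //; case: (posfun_markov_iter n) => _; exact.
Qed.

Definition occ_measure x : {measure set X -> \bar R} := meas_posfun (posfun_occ_fun x).

(** The term [n = 0] is split off; one factor [gamma] and one transition come out of all the
    others. *)
Lemma occ_fun_step f x : nnmfun f ->
  occ_fun f x = (1 - gamma)%:E * f x + gamma%:E * \int[K x]_y occ_fun f y.
Proof.
move=> hf.
have nn n y : 0 <= (gamma ^+ n)%:E * markov_iter n f y.
  by rewrite mule_ge0 ?markov_iter_ge0// lee_fin exprn_ge0.
have mm n : measurable_fun setT (fun y => (gamma ^+ n)%:E * markov_iter n f y).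
  by apply: emeasurable_funM => //; case: (posfun_markov_iter n) => _; exact.
have gn : (0 <= (1 - gamma)%:E :> \bar R) by rewrite lee_fin subr_ge0 ltW.
under eq_integral do rewrite occ_funE//.
rewrite ge0_integralZl//; last 2 first.
- by apply: ge0_emeasurable_sum.
- by move=> y _; exact: nneseries_ge0.
rewrite muleCA occ_funE// -ge0_muleDr//; last 2 first.
- by case: hf.
- by rewrite mule_ge0// integral_ge0// => y _; exact: nneseries_ge0.
congr (_ * _); rewrite nneseries_recl//.
rewrite expr0 mul1e; congr (_ + _).
rewrite integral_nneseries// -nneseriesZl//; last first.
  by move=> n _; exact: integral_ge0.
rewrite -(nneseries_addn 1 (fun n => nn n x)).
apply: eq_eseriesr => n _; rewrite addn1 exprS /= EFinM -muleA; congr (_ * _).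
rewrite ge0_integralZl//.
- by case: (posfun_markov_iter n) => _; exact.
- by move=> y _; exact: markov_iter_ge0.
- by rewrite lee_fin exprn_ge0.
Qed.

Lemma occ_measure_prob x : occ_measure x setT = 1.
Proof.
have n1 : nnmfun (fun _ : X => 1 : \bar R) by exact: (@nnmfun_cst _ X R 1 ler01).
rewrite [LHS](mposfunE (posfun_occ_fun x))// (_ : (fun _ => _) = fun=> 1); last first.
  by apply/funext => y; rewrite indicT.
have it n y : markov_iter n (fun=> 1) y = 1.
  elim: n y => [//|n ih] y /=; under eq_integral do rewrite ih.
  by rewrite integral_cst// mul1e K1.
rewrite occ_funE//; under eq_eseriesr do rewrite it mule1.
have -> : \sum_(0 <= n <oo) (gamma ^+ n)%:E = ((1 - gamma)^-1)%:E.
  apply/cvg_lim => //.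
  rewrite (_ : (fun _ => _) = EFin \o series (geometric 1%R gamma)).
    apply: cvg_EFin; first exact: nearW.
    rewrite -(div1r (1 - gamma)%R).
    by apply: cvg_geometric_series; rewrite ger0_norm.
  apply/funext => n; rewrite /= /series /= sumEFin; congr EFin.
  by apply: eq_bigr => i _; rewrite mul1r.
by rewrite -EFinM mulfV// subr_eq0 eq_sym lt_eqF.
Qed.

Lemma measurable_occ_measure U : measurable U -> measurable_fun setT (occ_measure ^~ U).
Proof.
move=> mU; rewrite (_ : (fun x => occ_measure x U) = occ_fun (fun x => (\1_U x)%:E)).
  by apply: measurable_occ_fun; exact: nnmfun_indic.
by apply/funext => x; rewrite [LHS](mposfunE (posfun_occ_fun x)).
Qed.

Local Close Scope ereal_scope.

Let fO x : (occ_measure x setT < +oo)%E. Proof. by rewrite occ_measure_prob ltry. Qed.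

Lemma bmf_occ u : bmf u -> bmf (fun x => rint (occ_measure x) u).
Proof.
move=> hu; have [M M0 uM] := bmf_shift hu.
have huM : bmf (fun x => u x + M) by apply: bmfD => //; exact: bmf_cst.
split.
  rewrite (_ : (fun x => _) = fun x => fine (\int[occ_measure x]_y (u y + M)%:E) - M).
    apply: measurable_funB => //; apply: measurableT_comp => //.
    apply: measurable_fun_integral_kernel => //; first exact: measurable_occ_measure.
    by case: (bmf_nnmfun huM uM).
  apply/funext => x; rewrite -/(rint (occ_measure x) (fun y => u y + M)) rintD//; last exact: bmf_cst.
  by rewrite rint_cst// occ_measure_prob mulr1 addrK.
have [_ [N uN]] := hu; exists N => x.
by have := rint_abs_le (fO x) hu uN; rewrite occ_measure_prob mulr1.
Qed.

Lemma rint_occ_step u x : bmf u -> rint (occ_measure x) u =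
  (1 - gamma) * u x + gamma * rint (K x) (fun y => rint (occ_measure y) u).
Proof.
move=> hu; have [M M0 uM] := bmf_shift hu.
have huM : bmf (fun x => u x + M) by apply: bmfD => //; exact: bmf_cst.
have nuM := bmf_nnmfun huM uM.
have rO y : rint (occ_measure y) (fun y => u y + M) = rint (occ_measure y) u + M.
  by rewrite rintD//; [rewrite rint_cst// occ_measure_prob mulr1|exact: bmf_cst].
have oE y : occ_fun (fun y => (u y + M)%:E) y = (rint (occ_measure y) u + M)%:E.
  by rewrite -(integral_posfun (posfun_occ_fun y) nuM) -rO rintE//; exact: fO.
have := occ_fun_step x nuM; rewrite oE; under eq_integral do rewrite oE.
rewrite rintE//; last by apply: bmfD; [exact: bmf_occ|exact: bmf_cst].
rewrite -!EFinM -EFinD => -[]; rewrite rintD//; last 2 first.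
- exact: bmf_occ.
- exact: bmf_cst.
by rewrite rint_cst// K1 mulr1 => /eqP h; apply/eqP; move: h; lra.
Qed.

(** By [rint_occ_step] the difference of the two sides is a bounded fixed point of [gamma] times the
    kernel, so [markov_contraction] with [c = 0] makes it vanish. *)
Lemma rint_occ_flow W x : bmf W ->
  rint (occ_measure x) (fun y => W y - gamma * rint (K y) W) = (1 - gamma) * W x.
Proof.
move=> hW; set u := fun y => _.
have hu : bmf u by apply: bmfB => //; apply: bmfZ; exact: bmf_markov.
pose e y := rint (occ_measure y) u - (1 - gamma) * W y.
have he : bmf e by apply: bmfB; [exact: bmf_occ|exact: bmfZ].
have e0 : `|e x| <= 0 / (1 - gamma).
  apply: (markov_contraction he) => y.
  rewrite {2}/e (rintB (fK y) (bmf_occ hu) (bmfZ _ hW)) (rintZ (fK y))//.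
  rewrite {1}/e rint_occ_step// {1}/u normr_le0; apply/eqP; ring.
by move: e0; rewrite mul0r normr_le0 subr_eq0 => /eqP.
Qed.

End markov_occupancy.

(** * Policies with densities bounded away from zero *)

Section mdp_kernel.
Context {R : realType} {S A : ptopologicalType}.
Variables (P : R.-pker (borel S * borel A)%type ~> borel S).
Variables (gamma : R) (mu : {finite_measure set (borel A) -> \bar R}).

(** The uniform positive lower bound keeps [ln p] bounded, so that regularized rewards and action
    values are bounded measurable functions. *)
Definition good_density (p : S -> A -> R) : Prop :=
  [/\ bmf (fun x : borel S * borel A => p x.1 x.2),
      exists2 c : R, 0 < c & forall s a, c <= p s a
    & forall s, rint mu (fun a : borel A => p s a) = 1].

Lemma fin_mu : (mu setT < +oo)%E. Proof. exact: fin_num_fun_lty. Qed.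

Lemma P_prob x : P x setT = 1%E. Proof. exact: prob_kernel. Qed.

Variables (p : S -> A -> R) (hp : good_density p).
Hypothesis hgamma : 0 <= gamma < 1.

Lemma density_bmf s : bmf (fun a : borel A => p s a).
Proof.
case: hp => h _ _; apply: (@bmf_comp _ _ _ _ _ _ (fun a => (s : borel S, a)) h).
exact: measurable_pair1.
Qed.

Lemma density_gt0 s a : 0 < p s a.
Proof. by case: hp => _ [c c0 hc] _; exact: lt_le_trans (hc s a). Qed.

Lemma density_ge0 s a : 0 <= p s a. Proof. exact/ltW/density_gt0. Qed.

Definition act_posfun s := posfun_mul (posfun_integral mu)
  (proj1 (density_bmf s)) (density_ge0 s).

Definition act_measure s : {measure set (borel A) -> \bar R} := meas_posfun (act_posfun s).

Lemma act_measureE s B : measurable B -> policy mu p s B = act_measure s B.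
Proof.
move=> mB; rewrite [RHS](mposfunE (act_posfun s))// /policy [LHS]integral_mkcond.
apply: eq_integral => x _.
by rewrite patchE indicE; case: ifPn; rewrite ?mul1e ?mul0e.
Qed.

Lemma rint_policy s (h : borel A -> R) : measurable_fun setT h ->
  rint (policy mu p s) h = rint mu (fun a => h a * p s a).
Proof.
by move=> mh; apply: rint_density => //; [case: (density_bmf s)|exact: density_ge0].
Qed.

Lemma act_measure_prob s : act_measure s setT = 1%E.
Proof.
rewrite -act_measureE// /policy rintE//; last exact: density_bmf.
  by case: hp => _ _ ->.
exact: fin_mu.
Qed.

Lemma measurable_P_pair s (U : set (borel S)) : measurable U ->
  measurable_fun setT (fun a : borel A => P (s, a) U).
Proof.
move=> mU; apply: (measurableT_comp (measurable_kernel P U mU)).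
exact: measurable_pair1.
Qed.

Definition step_posfun s := posfun_mix (act_measure s)
  (k := fun a => P (s, a)) (measurable_P_pair s).

Definition step_measure (s : borel S) : {measure set (borel S) -> \bar R} := meas_posfun (step_posfun s).

Lemma step_measureE s B : measurable B -> state_kernel P mu p s B = step_measure s B.
Proof.
move=> mB; rewrite [RHS](mposfunE (step_posfun s))// /state_kernel.
rewrite (eq_setfun_integral _ (act_measureE s)).
by apply: eq_integral => a _; rewrite integral_indic// setIT.
Qed.

Lemma step_measure_prob s : step_measure s setT = 1%E.
Proof.
rewrite -step_measureE// /state_kernel (eq_setfun_integral _ (act_measureE s)).
under eq_integral do rewrite P_prob.
by rewrite integral_cst// mul1e act_measure_prob.
Qed.

Lemma bmf_P u : bmf u -> bmf (fun x => rint (P x) u).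
Proof.
move=> hu; have h2 : bmf (fun z : (borel S * borel A) * borel S => u z.2).
  by apply: (bmf_comp hu); exact: measurable_snd.
apply: (@bmf_rint_kernel _ _ _ _ _ P (fun z => u z.2) 1 h2) => x.
by rewrite P_prob.
Qed.

Lemma rint_step s u : bmf u ->
  rint (step_measure s) u = rint mu (fun a => rint (P (s, a)) u * p s a).
Proof.
move=> hu.
rewrite (rint_mix (l := act_measure s) (k := fun a => P (s, a)) (f := u)) //.
- rewrite -(eq_setfun_rint _ (act_measureE s)) rint_policy//.
  by case: (bmf_comp (bmf_P hu) (measurable_pair1 (s : borel S))).
- by rewrite act_measure_prob ltry.
- by move=> a; exact: P_prob.
- exact: measurable_P_pair.
- move=> B mB; rewrite [LHS](mposfunE (step_posfun s))//.
  by apply: eq_integral => a _; rewrite integral_indic// setIT.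
Qed.

Lemma measurable_step U : measurable U -> measurable_fun setT (step_measure ^~ U : borel S -> _).
Proof.
move=> mU; rewrite (_ : (fun s : borel S => step_measure s U) =
    (fun s => \int[mu]_a (P (s, a) U * (p s a)%:E))%E); last first.
  apply/funext => s; rewrite -step_measureE// /state_kernel.
  rewrite (integral_density (m := mu) (q := p s))//.
  - by case: (density_bmf s).
  - exact: density_ge0.
  - by split => //; exact: measurable_P_pair.
apply: (measurable_fun_fubini_tonelli_F (fun z => P z U * (p z.1 z.2)%:E)%E).
  apply: emeasurable_funM; first exact: measurable_kernel.
  by apply/measurable_EFinP; case: hp => -[].
by move=> z; rewrite mule_ge0// lee_fin density_ge0.
Qed.

Definition occ s := occ_measure measurable_step hgamma s.

Lemma state_kernel_iterE n s B : measurable B -> state_kernel_iter P mu p n s B =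
  markov_iter step_measure n (fun x => (\1_B x)%:E) s.
Proof.
move=> mB; elim: n s => [|n ih] s /=; first by rewrite diracE.
rewrite (eq_setfun_integral _ (step_measureE s)).
by apply: eq_integral => x _; exact: ih.
Qed.

Lemma occE s B : measurable B -> occupancy P gamma mu p s B = occ s B.
Proof.
move=> mB; rewrite [RHS](mposfunE (posfun_occ_fun measurable_step hgamma s))//.
rewrite occ_funE//; [|exact: measurable_step|exact: nnmfun_indic].
by rewrite /occupancy; congr (_ * _)%E; apply: eq_eseriesr => n _; rewrite state_kernel_iterE.
Qed.

Variable rho : probability (borel S) R.

Lemma rint_occupancy_at u : bmf u ->
  rint (occupancy_at P gamma mu p rho) u = rint rho (fun s => rint (occ s) u).
Proof.
move=> hu; apply: rint_mix => //.
- exact: prob_fin.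
- by move=> s; apply: occ_measure_prob; exact: step_measure_prob.
- exact: measurable_occ_measure.
- by move=> B mB; apply: eq_integral => s _; exact: occE.
Qed.

Definition act_mean (h : borel S * borel A -> R) (s : S) : R :=
  rint mu (fun a => h (s, a) * p s a).

Definition state_op (u : borel S -> R) : borel S -> R :=
  act_mean (fun x => rint (P x) u).

Lemma bmf_act_mean h : bmf h -> bmf (act_mean h : borel S -> R).
Proof.
by move=> hh; case: hp => bp _ _; exact: (bmf_rint1 mu (bmfM hh bp)).
Qed.

Lemma bmf_state_op u : bmf u -> bmf (state_op u).
Proof. by move=> hu; apply: bmf_act_mean; exact: bmf_P. Qed.

Lemma rint_stepE s u : bmf u -> rint (step_measure s) u = state_op u s.
Proof. exact: rint_step. Qed.

(** The flow equation of the discounted occupancy measure: it converts a pointwise formula for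
    [W - gamma * state_op W] into one for the mean of [W] under [rho]. *)
Lemma occupancy_flow W : bmf W ->
  rint (occupancy_at P gamma mu p rho) (fun s => W s - gamma * state_op W s) =
  (1 - gamma) * rint rho W.
Proof.
move=> hW; rewrite rint_occupancy_at; last first.
  by apply: bmfB => //; apply: bmfZ; exact: bmf_state_op.
rewrite -(rintZ (prob_fin rho))//.
apply: eq_rint => s; rewrite -(rint_occ_flow step_measure_prob measurable_step hgamma _ hW).
by apply: eq_rint => x; rewrite rint_stepE.
Qed.

Lemma bellman_contraction W c : bmf W ->
  (forall s, `|W s - gamma * state_op W s| <= c) -> forall s, `|W s| <= c / (1 - gamma).
Proof.
move=> hW Wc; apply: (markov_contraction step_measure_prob hgamma hW) => s.
by rewrite rint_stepE.
Qed.

End mdp_kernel.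

(** * Trajectories and the value function *)

Section measurable_limn.
Context d (T : measurableType d) (R : realType).

(** [limn] returns [point] along divergent sequences, so the set of convergence must be measurable:
    it is where the upper limit [e] of [|u n - v|] vanishes, [v] being the finite part of the upper
    limit of [u]. *)
Lemma measurable_fun_limn (u : nat -> T -> R) : (forall n, measurable_fun setT (u n)) ->
  measurable_fun setT (fun w => limn (u ^~ w)).
Proof.
move=> mu; pose v w := fine (limn_esup (fun n => (u n w)%:E)).
have mv : measurable_fun setT v.
  apply: measurableT_comp => //; apply: measurable_fun_limn_esup => n.
  exact/measurable_EFinP.
pose e w := limn_esup (fun n => `|u n w - v w|%:E).
have me : measurable_fun setT e.
  apply: measurable_fun_limn_esup => n; apply/measurable_EFinP.
  by apply: measurableT_comp => //; exact: measurable_funB.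
have uv w : e w = 0%E <-> u ^~ w @ \oo --> v w.
  split=> [e0|uv].
    have : (fun n => `|u n w - v w|%:E) @ \oo --> 0%E.
      by apply: limn_esup_le_cvg => [|n]; [rewrite -/(e w) e0|rewrite lee_fin].
    move=> /fine_cvg /= h; apply/subr_cvg0; apply/norm_cvg0P; exact: h.
  rewrite /e; apply: (cvg_limn_einf_sup _).2; apply: cvg_EFin; first exact: nearW.
  by apply/norm_cvg0P; apply/subr_cvg0.
rewrite (_ : (fun w => limn _) = fun w => if e w == 0%E then v w else point).
  by apply: measurable_fun_ifT => //; apply: measurable_fun_eqe.
apply/funext => w; case: eqP => [/uv h|ne]; first exact: cvg_lim.
apply: dvgP => h; apply: ne; apply/uv; rewrite /v.
have hE : (fun n => (u n w)%:E) @ \oo --> (limn (u ^~ w))%:E.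
  by apply: cvg_EFin => //; exact: nearW.
by rewrite (cvg_limn_einf_sup hE).2.
Qed.
End measurable_limn.

Section pushforward.
Context d d' (T : measurableType d) (T' : measurableType d') (R : realType).
Variables (m : {measure set T -> \bar R}) (phi : T -> T').
Hypothesis mphi : measurable_fun setT phi.

Lemma posfun_push : posfun (fun f => \int[m]_x f (phi x))%E.
Proof.
apply: (posfun_comp (posfun_integral m) (fun x => posfun_dirac R (phi x))).
by move=> f [mf _]; exact: measurableT_comp.
Qed.

Definition meas_push : {measure set T' -> \bar R} := meas_posfun posfun_push.

Lemma meas_pushE B : measurable B -> meas_push B = m (phi @^-1` B).
Proof.
move=> mB; rewrite [LHS](mposfunE posfun_push)//.
transitivity (\int[m]_x (\1_(phi @^-1` B) x)%:E)%E; first exact: eq_integral.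
rewrite integral_indic ?setIT//.
by rewrite -[X in measurable X]setTI; exact: mphi.
Qed.

Lemma rint_push (h : T' -> R) : (m setT < +oo)%E -> bmf h ->
  rint meas_push h = rint m (fun x => h (phi x)).
Proof.
move=> fm hh; have [M M0 hM] := bmf_shift hh.
have hhM : bmf (fun x => h x + M) by apply: bmfD => //; exact: bmf_cst.
have hp := bmf_comp hh mphi.
have mT : meas_push setT = m setT by rewrite meas_pushE.
apply: (@addIr _ (M * fine (m setT))).
rewrite -{1}mT -[in LHS]rint_cst ?mT// -[in RHS]rint_cst// -!rintD ?mT//; try exact: bmf_cst.
apply: EFin_inj; rewrite -!rintE ?mT//; last exact: (bmf_comp hhM mphi).
by rewrite (integral_posfun posfun_push (bmf_nnmfun hhM hM)).
Qed.

End pushforward.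

Section trajectory_law.
Context {R : realType} {S A : ptopologicalType}.
Variables (P : R.-pker (borel S * borel A)%type ~> borel S) (r : S -> A -> R).
Variables (gamma tau : R) (mu : {finite_measure set (borel A) -> \bar R}).
Hypothesis hgamma : 0 <= gamma < 1.
Variables (p : S -> A -> R) (hp : good_density mu p).
Variables (s0 : S) (d : measure_display) (Om : measurableType d) (Pr : probability Om R).
Variables (st : nat -> Om -> borel S) (ac : nat -> Om -> borel A).
Hypothesis traj : trajectory P mu p s0 Pr st ac.

Let mst n : measurable_fun setT (st n). Proof. by case: traj. Qed.
Let mac n : measurable_fun setT (ac n). Proof. by case: traj. Qed.
Let fPr : (Pr setT < +oo)%E := prob_fin Pr.

Let mpair n : measurable_fun setT (fun w => (st n w, ac n w)).
Proof. exact: measurable_fun_pair. Qed.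

(** The clauses of [trajectory] speak of whole past cylinders; constraining the state at time [n]
    alone extracts the one-step laws. *)
Let cyl0 n B : [set w | (forall k, (k <= n)%N -> (if k == n then B else setT) (st k w)) /\
   (forall k : nat, (k < n)%N -> [set: borel A] (ac k w))] = st n @^-1` B.
Proof.
apply/seteqP; split => w /=; first by move=> [/(_ n (leqnn n))]; rewrite eqxx.
by move=> Bw; split => // k _; case: eqP => // ->.
Qed.

Lemma traj_rect n B C : measurable B -> measurable C ->
  Pr (st n @^-1` B `&` ac n @^-1` C) = (\int[Pr]_(w in st n @^-1` B) policy mu p (st n w) C)%E.
Proof.
move=> mB mC; case: traj => _ _ _ /(_ n (fun k => if k == n then B else setT) (fun=> setT)).
have mE (k : nat) : measurable (if k == n then B else setT) by case: ifP.
move=> /(_ mE (fun=> measurableT)) [+ _]; rewrite cyl0 => /(_ _ mC) <-.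
by congr (Pr _).
Qed.

Lemma traj_next n B : measurable B ->
  Pr (st n.+1 @^-1` B) = (\int[Pr]_w P (st n w, ac n w) B)%E.
Proof.
move=> mB; case: traj => _ _ _ /(_ n (fun=> setT) (fun=> setT)).
move=> /(_ (fun=> measurableT) (fun=> measurableT)) [_ +] => /(_ _ mB).
rewrite (_ : [set w | _] = setT); last by apply/seteqP; split.
by rewrite preimage_setT !setTI.
Qed.

(** By [traj_rect] the joint law of state and action agrees on rectangles with the mixture of
    policies over the law of the state. Rectangles form a pi-system generating the product
    sigma-algebra, so the two laws are equal. *)
Lemma traj_action n h : bmf h -> rint Pr (fun w => h (st n w, ac n w)) =
  rint Pr (fun w => act_mean mu p h (st n w)).
Proof.
move=> hh.
pose k w := meas_push (act_measure hp (st n w)) (measurable_pair1 (st n w)).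
have k1 w : k w setT = 1%E by rewrite meas_pushE// act_measure_prob.
have kE w B : measurable B -> (k w B = \int[mu]_a ((\1_B (st n w, a))%:E * (p (st n w) a)%:E))%E.
  move=> mB; rewrite [LHS](mposfunE (posfun_push _ _))//.
  by rewrite (integral_posfun (act_posfun hp (st n w)))//; split => [|a];
   [apply/measurable_EFinP; apply: measurableT_comp => //; exact: measurable_pair1
   |rewrite lee_fin].
have mk U : measurable U -> measurable_fun setT (k ^~ U).
  move=> mU; rewrite (_ : (fun w => k w U) = (fun w => \int[mu]_a ((\1_U (w, a))%:E * (p w a)%:E))%E \o st n); last first.
    by apply/funext => w; rewrite kE.
  apply: measurableT_comp (mst n).
  apply: (measurable_fun_fubini_tonelli_F (fun z => (\1_U z)%:E * (p z.1 z.2)%:E)%E).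
    apply: emeasurable_funM; first exact/measurable_EFinP.
    by apply/measurable_EFinP; case: hp => -[].
  by move=> z; rewrite mule_ge0// lee_fin (density_ge0 hp).
pose m1 := meas_push Pr (mpair n); pose m2 := meas_posfun (posfun_mix Pr mk).
have m2E B : measurable B -> m2 B = (\int[Pr]_w k w B)%E.
  move=> mB; rewrite [LHS](mposfunE (posfun_mix Pr mk))//.
  by apply: eq_integral => w _; rewrite integral_indic// setIT.
have m12 B : measurable B -> m1 B = m2 B.
  move=> mB; apply: (@measure_unique _ _ _ [set X `*` Y | X in measurable & Y in measurable]
    (fun=> setT)) => //.
  - exact: measurable_prod_measurableType.
  - move=> _ _ [X1 mX1 [Y1 mY1 <-]] [X2 mX2 [Y2 mY2 <-]].
    exists (X1 `&` X2); first exact: measurableI.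
    by exists (Y1 `&` Y2); [exact: measurableI|rewrite setXI].
  - by move=> _; exists setT => //; exists setT => //; rewrite setXTT.
  - by rewrite bigcup_const//; exists 0%N.
  - move=> _ [X mX [Y mY <-]]; rewrite /m1 meas_pushE; last exact: measurableX.
    rewrite m2E; last exact: measurableX.
    transitivity (Pr (st n @^-1` X `&` ac n @^-1` Y)); first by congr (Pr _).
    rewrite traj_rect// integral_mkcond; apply: eq_integral => w _.
    rewrite kE; last exact: measurableX.
    rewrite patchE; case: ifPn; rewrite ?(inE, notin_setE)/= => Xw.
      rewrite /policy integral_mkcond; apply: eq_integral => a _.
      have -> : \1_(X `*` Y) (st n w, a) = \1_Y a :> R by rewrite !indicE in_setX mem_set.
      rewrite patchE indicE; by case: ifPn; rewrite ?mul1e ?mul0e.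
    rewrite integral0_eq// => a _; rewrite indicE in_setX/= memNset//.
    by rewrite mul0e.
  - by move=> _; rewrite /m1 meas_pushE// preimage_setT.
rewrite -(rint_push (mpair n))// -/m1 (eq_setfun_rint _ m12).
rewrite (rint_mix (l := Pr) (k := k) (m := m2))//.
apply: eq_rint => w; rewrite rint_push//; last by rewrite act_measure_prob ltry.
rewrite -(eq_setfun_rint _ (act_measureE hp (st n w))) (rint_policy hp)//.
by case: (bmf_comp hh (measurable_pair1 (st n w))).
Qed.

Lemma traj_state n u : bmf u ->
  rint Pr (fun w => u (st n.+1 w)) = rint Pr (fun w => state_op P mu p u (st n w)).
Proof.
move=> hu; rewrite -(rint_push (mst n.+1))//.
rewrite (rint_mix (l := Pr) (k := fun w => P (st n w, ac n w)))//.
- exact: (traj_action n (bmf_P P hu)).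
- by move=> w; exact: P_prob.
- move=> U mU; apply: (measurableT_comp (measurable_kernel P U mU)); exact: mpair.
- by move=> B mB; rewrite meas_pushE//; exact: traj_next.
Qed.

Lemma traj_start u : bmf u -> rint Pr (fun w => u (st 0%N w)) = u s0.
Proof.
move=> hu; rewrite -(rint_push (mst 0%N))//.
have E B : measurable B -> meas_push Pr (mst 0%N) B = \d_(s0 : borel S) B.
  by move=> mB; rewrite meas_pushE//; case: traj => _ _ + _; exact.
rewrite (eq_setfun_rint _ E) /rint integral_dirac//; last by apply/measurable_EFinP; case: hu.
by rewrite diracT mul1e.
Qed.

End trajectory_law.

Section value_characterization.
Context {R : realType} {S A : ptopologicalType}.
Variables (P : R.-pker (borel S * borel A)%type ~> borel S) (r : S -> A -> R).
Variables (gamma tau : R) (mu : {finite_measure set (borel A) -> \bar R}).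
Hypothesis hgamma : 0 <= gamma < 1.
Hypothesis hr : bmf (fun x : borel S * borel A => r x.1 x.2).

Lemma bmf_ln_density p : good_density mu p ->
  bmf (fun x : borel S * borel A => ln (p x.1 x.2)).
Proof.
move=> [[mp [C pC]] [c c0 cp] _]; split; first exact: measurableT_comp.
exists (`|ln C| + `|ln c|) => x.
have px : 0 < p x.1 x.2 by exact: lt_le_trans (cp _ _).
have pC' : p x.1 x.2 <= C by exact: le_trans (ler_norm _) (pC x).
have h1 : ln (p x.1 x.2) <= ln C by rewrite ler_ln ?posrE// (lt_le_trans px).
have h2 : ln c <= ln (p x.1 x.2) by rewrite ler_ln ?posrE.
rewrite ler_norml; apply/andP; split.
  rewrite (le_trans _ h2)// opprD -lerBrDl opprK.
  by have := ler_norm (- ln c); have := normr_ge0 (ln C); rewrite normrN; lra.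
by rewrite (le_trans h1)// (le_trans (ler_norm _))// lerDl.
Qed.

Lemma bmf_reg_reward p : good_density mu p ->
  bmf (fun x : borel S * borel A => reg_reward r tau p x.1 x.2).
Proof. by move=> hp; apply: bmfB => //; apply: bmfZ; exact: bmf_ln_density. Qed.

Definition bellman p (W : borel S -> R) := forall s,
  W s = act_mean mu p (fun x => reg_reward r tau p x.1 x.2) s + gamma * state_op P mu p W s.

(** The solution is the mean one-step reward under the occupancy measure, rescaled by [1 - gamma];
    [rint_occ_step] is its Bellman equation. *)
Lemma bellman_exists p : good_density mu p -> exists2 W, bmf W & bellman p W.
Proof.
move=> hp; have [g0 g1] := andP hgamma.
pose g : borel S -> R := act_mean mu p (fun x => reg_reward r tau p x.1 x.2).
have bg : bmf g by apply: bmf_act_mean => //; exact: bmf_reg_reward.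
have bO : bmf (fun s => rint (occ P hp hgamma s) g).
  by apply: bmf_occ => //; exact: step_measure_prob.
exists (fun s => (1 - gamma)^-1 * rint (occ P hp hgamma s) g); first exact: bmfZ.
move=> s; rewrite [in LHS]rint_occ_step//; last exact: step_measure_prob.
rewrite rint_stepE// -/(g s).
have -> : state_op P mu p (fun s => (1 - gamma)^-1 * rint (occ P hp hgamma s) g) s =
    (1 - gamma)^-1 * state_op P mu p (fun s => rint (occ P hp hgamma s) g) s.
  rewrite -!(rint_stepE P hp)//; last exact: bmfZ.
  by rewrite rintZ// step_measure_prob ltry.
rewrite mulrDr mulrA mulVf ?mul1r; last by rewrite subr_eq0 eq_sym lt_eqF.
by rewrite mulrCA.
Qed.

Section trajectory_return.
Variables (p : S -> A -> R) (hp : good_density mu p) (W : borel S -> R).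
Hypotheses (hW : bmf W) (WE : bellman p W).
Variables (s0 : S) (d : measure_display) (Om : measurableType d) (Pr : probability Om R).
Variables (st : nat -> Om -> borel S) (ac : nat -> Om -> borel A).
Hypothesis traj : trajectory P mu p s0 Pr st ac.

Let fPr : (Pr setT < +oo)%E := prob_fin Pr.
Let mst n : measurable_fun setT (st n). Proof. by case: traj. Qed.
Let mac n : measurable_fun setT (ac n). Proof. by case: traj. Qed.

Let u w (n : nat) : R := gamma ^+ n * reg_reward r tau p (st n w) (ac n w).

Let b_rew n : bmf (fun w => reg_reward r tau p (st n w) (ac n w)).
Proof.
have mp : measurable_fun setT (fun w => (st n w, ac n w)) by exact: measurable_fun_pair.
exact: (bmf_comp (bmf_reg_reward hp) mp).
Qed.

Let bu n : bmf (fun w => u w n).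
Proof. exact: (bmfZ (gamma ^+ n) (b_rew n)). Qed.

Let bW n : bmf (fun w => W (st n w)). Proof. exact: bmf_comp. Qed.

Let b_series n : bmf (fun w => series (u w) n).
Proof.
elim: n => [|n ih]; first by under eq_fun do rewrite /series/= big_geq//; exact: bmf_cst.
under eq_fun do rewrite seriesSr.
exact: (bmfD ih (bu n)).
Qed.

Let mean_series n : rint Pr (fun w => series (u w) n) =
  W s0 - gamma ^+ n * rint Pr (fun w => W (st n w)).
Proof.
elim: n => [|n ih].
  under eq_fun do rewrite /series/= big_geq//.
  by rewrite rint_cst// mul0r expr0 mul1r (traj_start traj)// subrr.
under eq_fun do rewrite seriesSr.
rewrite (rintD fPr (b_series n) (bu n)) ih (rintZ fPr _ (b_rew n)).
rewrite (traj_action hp traj n (bmf_reg_reward hp)) (traj_state hp traj)//.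
have bM : bmf (fun w => act_mean mu p (fun x => reg_reward r tau p x.1 x.2) (st n w)).
  by apply: bmf_comp => //; apply: bmf_act_mean => //; exact: bmf_reg_reward.
have bS : bmf (fun w => state_op P mu p W (st n w)).
  by apply: bmf_comp => //; exact: bmf_state_op.
have -> : rint Pr (fun w => W (st n w)) =
    rint Pr (fun w => act_mean mu p (fun x => reg_reward r tau p x.1 x.2) (st n w)) +
    gamma * rint Pr (fun w => state_op P mu p W (st n w)).
  rewrite -rintZ// -rintD//; last exact: bmfZ.
  by apply: eq_rint => w; exact: WE.
rewrite exprSr; move: (rint _ _) (rint _ _) (gamma ^+ n) => x y z; ring.
Qed.

(** The partial returns are bounded by a geometric series, so bounded convergence carries
    [mean_series] to the limit, where the term with [gamma ^+ n] disappears. *)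
Lemma traj_return_bmf : bmf (discounted_return r gamma tau p st ac) /\
  rint Pr (discounted_return r gamma tau p st ac) = W s0.
Proof.
have [g0 g1] := andP hgamma.
have [_ [C hC]] := bmf_reg_reward hp.
have C0 : 0 <= C by rewrite (le_trans _ (hC point)).
have cg : cvgn (series (geometric C gamma)) by apply: is_cvg_geometric_series; rewrite ger0_norm.
have uC w n : `|u w n| <= geometric C gamma n.
  by rewrite normrM ger0_norm ?exprn_ge0//= mulrC ler_wpM2r ?exprn_ge0//; exact: hC (_, _).
have cu w : cvgn (series (u w)).
  apply: normed_cvg; apply: series_le_cvg (uC w) cg => n //=.
  by rewrite mulr_ge0// exprn_ge0.
have us w n : `|series (u w) n| <= C / (1 - gamma).
  apply: le_trans (ler_norm_sum _ _ _) _.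
  apply: (@le_trans _ _ (series (geometric C gamma) n)); first exact: ler_sum.
  rewrite -(cvg_lim _ (@cvg_geometric_series _ C gamma _))//; last by rewrite ger0_norm.
  apply: nondecreasing_cvgn_le => //; apply/nondecreasing_seqP => k.
  by rewrite seriesSr lerDl mulr_ge0// exprn_ge0.
have mD : measurable_fun setT (discounted_return r gamma tau p st ac).
  by apply: measurable_fun_limn => n; case: (b_series n).
split.
  split => //; exists (C / (1 - gamma)) => w.
  have cn : (fun n => `|series (u w) n|) @ \oo --> `|limn (series (u w))| by exact: cvg_norm.
  rewrite -(cvg_lim _ cn)//; apply: limr_le; first by apply/cvg_ex; eexists; exact: cn.
  exact: nearW.
have c1 : rint Pr (fun w => series (u w) n) @[n --> \oo] -->
    rint Pr (discounted_return r gamma tau p st ac).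
  by apply: (@cvg_rint _ _ _ Pr fPr _ _ (C / (1 - gamma))) => //; apply: aeW => w; exact: cu.
have c2 : rint Pr (fun w => series (u w) n) @[n --> \oo] --> W s0.
  rewrite (_ : (fun n => _) = fun n => W s0 - gamma ^+ n * rint Pr (fun w => W (st n w))); last exact/funext.
  rewrite -[X in _ --> X]subr0; apply: cvgB; first exact: cvg_cst.
  have [_ [M hM]] := hW.
  apply/norm_cvg0P; apply: (squeeze_cvgr (f := fun=> 0) (h := fun n => gamma ^+ n * M)).
  - apply: nearW => n; rewrite normr_ge0 normrM ger0_norm ?exprn_ge0//= ler_wpM2l ?exprn_ge0//.
    exact: (rint_pabs_le Pr (bW n) (fun w => hM (st n w))).
  - exact: cvg_cst.
  - rewrite -[X in _ --> X](mul0r M); apply: cvgMl.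
    by apply: cvg_expr; rewrite ger0_norm.
exact: (cvg_unique _ c1 c2).
Qed.

End trajectory_return.

Lemma trajectory_ext p q s0 d (Om : measurableType d) (Pr : probability Om R)
    (st : nat -> Om -> borel S) (ac : nat -> Om -> borel A) :
  (forall s B, measurable B -> policy mu p s B = policy mu q s B) ->
  trajectory P mu p s0 Pr st ac -> trajectory P mu q s0 Pr st ac.
Proof.
move=> pq [h1 h2 h3 h4]; split; [exact: h1|exact: h2|exact: h3|move=> n E F mE mF H H'].
have [h5 h6] := h4 n E F mE mF; split; [move=> B mB|exact: h6].
by rewrite (h5 B mB); apply: eq_integral => w _; exact: pq.
Qed.

(* The discounted return telescopes against [W] along every trajectory. *)
Lemma value_bellman p q W : good_density mu p ->
  measurable_fun setT (fun x : borel S * borel A => q x.1 x.2) ->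
  (forall s, \forall a \ae mu, q s a = p s a) ->
  (forall s0, exists d (Om : measurableType d) (Pr : probability Om R)
    (st : nat -> Om -> borel S) (ac : nat -> Om -> borel A),
    trajectory P mu p s0 Pr st ac) ->
  bmf W -> bellman p W -> value P r gamma tau mu q = W.
Proof.
move=> hp mq pq hex hW WE; apply/funext => s0.
have pqE s B : measurable B -> policy mu q s B = policy mu p s B.
  move=> mB; rewrite /policy; apply: ae_eq_integral => //.
  - apply: measurable_funTS; apply/measurable_EFinP.
    exact: (measurableT_comp mq (measurable_pair1 (s : borel S))).
  - by apply: measurable_funTS; apply/measurable_EFinP; case: (density_bmf hp s).
  - by apply: filterS (pq s) => a -> _.
have key d (Om : measurableType d) (Pr : probability Om R) st ac :
    trajectory P mu q s0 Pr st ac ->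
    ('E_Pr[discounted_return r gamma tau q st ac] = (W s0)%:E)%E.
  move=> tr; have trp := trajectory_ext pqE tr.
  have [[mD bD] DE] := traj_return_bmf hp hW WE trp.
  have [mst mac _ _] := trp.
  have mpair n : measurable_fun setT (fun w => (st n w, ac n w)) by exact: measurable_fun_pair.
  have -> : (W s0)%:E = (\int[Pr]_w (discounted_return r gamma tau p st ac w)%:E)%E.
    by rewrite (rintE (prob_fin Pr) (conj mD bD)) DE.
  rewrite expectation.unlock; apply: ae_eq_integral => //.
  - apply/measurable_EFinP; apply: measurable_fun_limn => n.
    apply: measurable_sum => k; apply: measurable_funM => //.
    apply: measurable_funB; first exact: (measurableT_comp (proj1 hr) (mpair k)).
    apply: measurable_funM => //; apply: measurableT_comp => //.
    exact: (measurableT_comp mq (mpair k)).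
  - exact/measurable_EFinP.
  (* For each state [q] and [p] differ only on a [mu]-null set of actions, and actions are drawn
     with a density with respect to [mu]; hence almost surely no pair of the trajectory lies in the
     exceptional set [N]. *)
  have : \forall w \ae Pr, forall n, q (st n w) (ac n w) = p (st n w) (ac n w).
    apply: ae_foralln => n.
    pose N := [set x : borel S * borel A | q x.1 x.2 != p x.1 x.2].
    have mN : measurable N.
      have mp : measurable_fun setT (fun x : borel S * borel A => p x.1 x.2) by case: hp => -[].
      have := measurable_fun_eqr mq mp measurableT (Y := [set false]) I.
      rewrite setTI; congr measurable; apply/seteqP; split => x /=.
        by move=> qp; apply/negbT.
      by move/negbTE.
    exists ((fun w => (st n w, ac n w)) @^-1` N); split.
    - by rewrite -[X in measurable X]setTI; exact: mpair.
    - have bN := bmf_indic R mN.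
      have h0 : rint Pr (fun w => \1_N (st n w, ac n w)) = 0.
        rewrite (traj_action hp trp n bN) (_ : (fun w => _) = fun=> 0) ?rint_pcst//.
        apply/funext => w; rewrite /act_mean.
        transitivity (rint mu (fun _ : borel A => 0 : R)); last by rewrite (rint_cst (fin_mu mu)) mul0r.
        apply: ae_eq_rint => //.
          by have [] := bmfM (bmf_comp bN (measurable_pair1 (st n w))) (density_bmf hp (st n w)).
        by apply: filterS (pq (st n w)) => a qa; rewrite indicE memNset ?mul0r// => /eqP; apply.
      have mpN : measurable ((fun w => (st n w, ac n w)) @^-1` N).
        by rewrite -[X in measurable X]setTI; exact: mpair.
      transitivity (\int[Pr]_w (\1_N (st n w, ac n w))%:E)%E.
        transitivity (\int[Pr]_w (\1_((fun w => (st n w, ac n w)) @^-1` N) w)%:E)%E.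
          by rewrite integral_indic// setIT.
        exact: eq_integral.
      by rewrite (rintE (prob_fin Pr) (bmf_comp bN (mpair n))) h0.
    - by move=> w /= /eqP.
  apply: filterS => w qp _ /=; congr EFin; rewrite /discounted_return.
  congr (limn (series _)); apply/funext => n; congr (_ * _).
  by rewrite /reg_reward qp.
(* [get] is meaningful because the set is a singleton: it is inhabited since a trajectory exists,
   and [key] fixes its only element. *)
rewrite /value; apply: get_unique => [|v].
  have [d [Om [Pr [st [ac tr]]]]] := hex s0.
  have trq : trajectory P mu q s0 Pr st ac.
    by apply: trajectory_ext tr => s B mB; rewrite pqE.
  by exists d, Om, Pr, st, ac; split => //; rewrite (key _ _ _ _ _ trq).
move=> [d [Om [Pr [st [ac [tr /esym E]]]]]].
by move: E; rewrite (key _ _ _ _ _ tr) => -[].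
Qed.

End value_characterization.

(** * The Ionescu-Tulcea theorem *)

Section path_space.
Context d (X : measurableType d).

Definition coord_sets : set (set (nat -> X)) :=
  [set C | exists k B, measurable B /\ C = [set w | B (w k)]].

Definition paths := g_sigma_algebraType coord_sets.

Lemma measurable_coord k : measurable_fun setT (fun w : paths => w k).
Proof.
by move=> _ B mB; rewrite setTI; apply: sub_sigma_algebra; exists k, B.
Qed.

Lemma measurable_paths d' (T : measurableType d') (g : T -> paths) :
  (forall k, measurable_fun setT (fun t => g t k)) -> measurable_fun setT g.
Proof.
move=> mg; apply: measurability; first by [].
by move=> _ [_ [k [B [mB ->]]] <-]; exact: mg.
Qed.

Definition upd (w : nat -> X) (k : nat) (y : X) : nat -> X :=
  fun i => if i == k then y else w i.

Lemma measurable_upd k : measurable_fun setT (fun z : paths * X => upd z.1 k z.2 : paths).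
Proof.
apply: measurable_paths => i; rewrite /upd; case: eqP => _.
  exact: measurable_snd.
exact: (measurableT_comp (measurable_coord i) measurable_fst).
Qed.

(** At time 0 there is no previous coordinate; [x0] is a placeholder, and the first kernel of the
    application below is constant. *)
Definition past (x0 : X) (k : nat) (w : nat -> X) : X := if k is j.+1 then w j else x0.

Lemma measurable_past x0 k : measurable_fun setT (past x0 k : paths -> X).
Proof. by case: k => [|k]; [exact: measurable_cst|exact: measurable_coord]. Qed.

Definition agree n (w w' : nat -> X) := forall k, (k < n)%N -> w k = w' k.

(** Dependence on finitely many coordinates is stated extensionally; measurability always refers to
    the full path sigma-algebra, so that no filtration has to be introduced. *)
Definition level_fun {T : Type} n (f : (nat -> X) -> T) :=
  forall w w', agree n w w' -> f w = f w'.

Lemma level_fun_le T n m (f : (nat -> X) -> T) : (n <= m)%N -> level_fun n f -> level_fun m f.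
Proof. by move=> nm hf w w' ww'; apply: hf => k kn; apply: ww'; exact: leq_trans nm. Qed.

Definition cylinder (C : set (nat -> X)) :=
  measurable (C : set paths) /\ exists n, level_fun n C.

Lemma cylinder0 : cylinder set0.
Proof. by split; [exact: measurable0|exists 0%N]. Qed.

Lemma cylinderU C D : cylinder C -> cylinder D -> cylinder (C `|` D).
Proof.
move=> [mC [n hC]] [mD [m hD]]; split; first exact: measurableU.
exists (maxn n m) => w w' ww'; rewrite /setU/=.
by rewrite (level_fun_le (leq_maxl n m) hC ww') (level_fun_le (leq_maxr n m) hD ww').
Qed.

Lemma cylinderD C D : cylinder C -> cylinder D -> cylinder (C `\` D).
Proof.
move=> [mC [n hC]] [mD [m hD]]; split; first exact: measurableD.
exists (maxn n m) => w w' ww'; rewrite /setD/=.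
by rewrite (level_fun_le (leq_maxl n m) hC ww') (level_fun_le (leq_maxr n m) hD ww').
Qed.

(** A copy of the path space whose distinguished sets are the cylinders; they form a ring, from
    which the content is extended to a measure. *)
Definition cylpath : Type := nat -> X.

HB.instance Definition _ := Pointed.on cylpath.

Definition cyl_display : measure_display. Proof. by constructor. Qed.

HB.instance Definition _ := @isRingOfSets.Build cyl_display cylpath
  cylinder cylinder0 cylinderU cylinderD.

End path_space.

Section ionescu_tulcea.
Context d (X : measurableType d) (R : realType).
Variables (K : nat -> R.-pker X ~> X) (x0 : X).
Local Open Scope ereal_scope.
Notation paths := (paths X).

Definition past_kernel k (w : paths) : {measure set X -> \bar R} := K k (past x0 k w).

Section past_kernel_kernel.
Variable k : nat.

Let measurable_past_kernel U : measurable U -> measurable_fun setT (past_kernel k ^~ U).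
Proof. by move=> mU; exact: (measurableT_comp (measurable_kernel (K k) U mU) (measurable_past x0 k)). Qed.

HB.instance Definition _ := isKernel.Build _ _ _ _ _ (past_kernel k) measurable_past_kernel.

Let past_kernel_prob w : past_kernel k w setT = 1.
Proof. exact: prob_kernel. Qed.

HB.instance Definition _ := Kernel_isProbability.Build _ _ _ _ _ (past_kernel k) past_kernel_prob.

End past_kernel_kernel.

Definition resample k (f : paths -> \bar R) (w : paths) : \bar R :=
  \int[past_kernel k w]_y f (upd w k y).

Lemma past_kernel_prob k w : past_kernel k w setT = 1.
Proof. exact: prob_kernel. Qed.

Lemma measurable_upd1 k (w : paths) : measurable_fun setT (fun y => upd w k y : paths).
Proof. exact: (measurableT_comp (measurable_upd k) (measurable_pair1 w)). Qed.

Lemma posfun_resample k w : posfun (fun f => resample k f w).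
Proof. exact: (posfun_push _ (measurable_upd1 k w)). Qed.

Lemma measurable_resample k f : nnmfun f -> measurable_fun setT (resample k f).
Proof.
move=> [mf f0].
apply: (@measurable_fun_integral_finite_kernel _ _ paths X R
  (fun z => f (upd z.1 k z.2)) (past_kernel k)) => [z|]; first exact: f0.
exact: (measurableT_comp mf (measurable_upd k)).
Qed.

Lemma nnmfun_resample k f : nnmfun f -> nnmfun (resample k f).
Proof.
move=> hf; split; first exact: measurable_resample.
by move=> w; case: (posfun_resample k w) => + _ _ _ _; exact.
Qed.

(** For a function of level [k + n] this is the conditional expectation given the first [k]
    coordinates. *)
Fixpoint resamples k n f : paths -> \bar R :=
  if n is n'.+1 then resample k (resamples k.+1 n' f) else f.

Lemma nnmfun_resamples k n f : nnmfun f -> nnmfun (resamples k n f).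
Proof. by move=> hf; elim: n k => [//|n ih] k /=; exact: nnmfun_resample. Qed.

Lemma posfun_resamples k n w : posfun (fun f => resamples k n f w).
Proof.
elim: n k w => [|n ih] k w /=; first exact: posfun_dirac.
apply: (posfun_comp (posfun_resample k w) (ih k.+1)) => f hf.
by case: (nnmfun_resamples k.+1 n hf).
Qed.

Lemma resample_level k n f : (n <= k)%N -> level_fun n f -> resample k f = f.
Proof.
move=> nk hf; apply/funext => w; rewrite /resample.
under eq_integral => y _.
  rewrite (hf _ w); last first.
    by move=> i ik; rewrite /upd ifN//; apply: contraTneq ik => ->; rewrite -leqNgt.
  over.
rewrite /=; transitivity (\int[past_kernel k w]_y (cst (f w) y)) => //.
by rewrite integral_cst// past_kernel_prob mule1.
Qed.

Lemma resamples_level k n m f : (m <= k)%N -> level_fun m f -> resamples k n f = f.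
Proof.
move=> mk hf; elim: n k mk => [//|n ih] k mk /=.
by rewrite ih ?(leq_trans mk)// (resample_level mk).
Qed.

Lemma resamplesD k n m f : resamples k (n + m) f = resamples k n (resamples (k + n) m f).
Proof.
elim: n k => [|n ih] k /=; first by rewrite addn0.
by rewrite ih addSnnS.
Qed.

(** Redrawing coordinates beyond the level of [f] changes nothing, so the horizon is immaterial. The
    truncated subtraction covers [n < k], where nothing is left to redraw. *)
Lemma resamples_stable k n m f : (n <= m)%N -> level_fun n f ->
  resamples k (m - k) f = resamples k (n - k) f.
Proof.
move=> nm hf; have [kn|nk] := leqP k n.
  have -> : (m - k = (n - k) + (m - n))%N by rewrite addnC addnBA// subnK.
  have h : (n <= k + (n - k))%N by rewrite subnKC.
  by rewrite resamplesD (resamples_level _ h hf).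
by rewrite !(@resamples_level _ _ n)// ltnW.
Qed.

Let w0 : paths := fun=> x0.

Definition path_mean n f := resamples 0 n f w0.

Definition ind (C : set paths) (w : paths) : \bar R := (\1_C w)%:E.

Lemma level_ind n C : level_fun n C -> level_fun n (ind C).
Proof. move=> hC w w' /hC E; rewrite /ind !indicE.
by have -> : (w \in (C : set paths)) = (w' \in (C : set paths)) by apply/idP/idP; rewrite !inE /= E.
Qed.

Lemma path_mean_stable n m f : (n <= m)%N -> level_fun n f -> path_mean m f = path_mean n f.
Proof. by move=> nm hf; rewrite /path_mean; have := @resamples_stable 0 n m f nm hf; rewrite !subn0 => ->. Qed.

Definition level (C : set (nat -> X)) : nat := xget 0%N [set n | level_fun n C].

Lemma levelP C : cylinder C -> level_fun (level C) C.
Proof. by move=> [_ hC]; exact: (xgetPex 0%N hC). Qed.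

Definition cyl_content (C : set (cylpath X)) : \bar R := path_mean (level C) (ind C).

Lemma cyl_contentE n C : cylinder C -> level_fun n C -> cyl_content C = path_mean n (ind C).
Proof.
move=> cC hn; have hl := levelP cC.
rewrite /cyl_content -(@path_mean_stable _ (maxn n (level C)) _ (leq_maxr _ _) (level_ind hl)).
by rewrite (@path_mean_stable _ _ _ (leq_maxl _ _) (level_ind hn)).
Qed.

Lemma nnmfun_ind C : cylinder C -> nnmfun (ind C).
Proof. by move=> [mC _]; exact: nnmfun_indic. Qed.

(* Along a decreasing sequence of cylinders whose content stays away from 0,
   the coordinates of a common point are chosen one after the other. *)
Lemma cyl_content_cvg0 (C : nat -> set (nat -> X)) : (forall j, cylinder (C j)) ->
  (forall j, C j.+1 `<=` C j) -> \bigcap_j C j = set0 ->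
  cyl_content (C j) @[j --> \oo] --> 0.
Proof.
move=> cC ndC C0; pose N j := level (C j).
(* [G k j w] is the conditional content of [C j] given the first [k] coordinates of [w]; it
   decreases in [j], and [g k] below is its limit. *)
pose G k j := resamples k (N j - k) (ind (C j)).
have hN j : level_fun (N j) (ind (C j)) := level_ind (levelP (cC j)).
have nnC j : nnmfun (ind (C j)) := nnmfun_ind (cC j).
have nnG k j : nnmfun (G k j) := nnmfun_resamples _ _ (nnC j).
have GS k j w : G k j w = \int[past_kernel k w]_y G k.+1 j (upd w k y).
  rewrite /G -(@resamples_stable k _ (maxn (N j) k.+1) _ (leq_maxl _ _) (hN j)).
  rewrite -(@resamples_stable k.+1 _ (maxn (N j) k.+1) _ (leq_maxl _ _) (hN j)).
  by rewrite -(subnSK (leq_maxr (N j) k.+1)).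
have ndG k j w : G k j.+1 w <= G k j w.
  pose M := maxn (N j) (N j.+1).
  rewrite /G -(@resamples_stable k _ M _ (leq_maxl _ _) (hN j)).
  rewrite -(@resamples_stable k _ M _ (leq_maxr _ _) (hN j.+1)).
  case: (posfun_resamples k (M - k) w) => _ _ _ + _; apply => // x.
  rewrite lee_fin /ind !indicE ler_nat; case: (boolP (x \in C j.+1)) => // /set_mem /ndC xC.
  by rewrite mem_set.
have niG k w : nonincreasing_seq (G k ^~ w).
  by apply/nonincreasing_seqP => j.
have cG k w : cvgn (G k ^~ w) by exact: ereal_nonincreasing_is_cvgn.
pose g k w := limn (G k ^~ w).
have g_ge0 k w : 0 <= g k w.
  by apply: lime_ge => //; apply: nearW => j; case: (nnG k j).
have Gle1 k j w : G k j w <= 1.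
  case: (posfun_resamples k (N j - k) w) => _ _ _ Fle _.
  have n1 : nnmfun (fun _ : paths => 1 : \bar R) by exact: (@nnmfun_cst _ paths R 1 ler01).
  apply: le_trans (Fle _ _ (nnC j) n1 _) _.
    by move=> x; rewrite lee_fin indicE; case: (_ \in _).
  by rewrite (@resamples_level _ _ 0%N).
(* If every choice of coordinate [k] led to a zero limit, dominated convergence would make the
   average [g k w] zero as well. *)
have step k w : 0 < g k w -> exists y, 0 < g k.+1 (upd w k y).
  move=> gk; apply: contrapT => /forallNP ny.
  have g0 y : g k.+1 (upd w k y) = 0.
    by apply/eqP; rewrite eq_le g_ge0 andbT leNgt; apply/negP; exact: ny.
  have : G k ^~ w @ \oo --> \int[past_kernel k w]_y 0.
    rewrite (_ : G k ^~ w = fun j => \int[past_kernel k w]_y G k.+1 j (upd w k y)); last first.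
      by apply/funext => j; exact: GS.
    apply: (dominated_cvg measurableT (g := fun=> 1)) => //.
    - by move=> j; apply: measurableT_comp (measurable_upd1 k w); case: (nnG k.+1 j).
    - by move=> y _; rewrite -(g0 y); exact: cG.
    - by apply: (bmf_integrable _ (bmf_cst X 1%R)); rewrite past_kernel_prob ltry.
    - move=> j y _; rewrite gee0_abs//; exact: (proj2 (nnG _ _)).
  move=> /cvg_lim; rewrite integral0 => /(_ (@ereal_hausdorff _)) E.
  by move: gk; rewrite /g E ltxx.
have [g00|g00] := eqVneq (g 0%N w0) 0.
  have := cG 0%N w0; rewrite -/(g 0%N w0) g00.
  by rewrite (_ : G 0%N ^~ w0 = fun j => cyl_content (C j))//; apply/funext => j; rewrite /G subn0.
have g0pos : 0 < g 0%N w0 by rewrite lt_neqAle eq_sym g00 g_ge0.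
have ch k w : exists y, 0 < g k w -> 0 < g k.+1 (upd w k y).
  have [gk|gk] := pselect (0 < g k w); last by exists x0.
  by have [y gy] := step k w gk; exists y.
pose pick k w := sval (cid (ch k w)).
have pickP k w : 0 < g k w -> 0 < g k.+1 (upd w k (pick k w)) by exact: (svalP (cid (ch k w))).
pose W := fix W k := if k is j.+1 then upd (W j) j (pick j (W j)) else w0.
have Wpos k : 0 < g k (W k) by elim: k => //= k ih; exact: pickP.
pose w : nat -> X := fun k => W k.+1 k.
have wW k i : (i < k)%N -> w i = W k i.
  elim: k => // k ih; rewrite ltnS leq_eqVlt => /predU1P[->//|ik].
  by rewrite ih//= /upd ltn_eqF.
suff : (\bigcap_j C j) w by rewrite C0.
move=> j _; have hl := levelP (cC j).
rewrite (hl w (W (N j))); last by move=> i iN; exact: wW.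
(* At the level of [C j] nothing is redrawn any more, so [G] is the indicator of [C j] and its
   positivity is membership. *)
have : 0 < G (N j) j (W (N j)).
  apply: lt_le_trans (Wpos (N j)) _.
  apply: lime_le; first exact: cG.
  by near=> i; apply: niG; near: i; exact: nbhs_infty_ge.
rewrite /G subnn/= /ind indicE lte_fin ltr0n lt0b => /set_mem; exact.
Unshelve. all: by end_near. Qed.

Lemma cyl_content_ge0 C : cylinder C -> 0 <= cyl_content C.
Proof.
move=> cC; rewrite /cyl_content /path_mean.
case: (posfun_resamples 0 (level C) w0) => + _ _ _ _; apply; exact: nnmfun_ind.
Qed.

Lemma cyl_content_set0 : cyl_content set0 = 0.
Proof.
rewrite (cyl_contentE (n := 0) (cylinder0 X))//.
by rewrite /path_mean /= /ind indic0.
Qed.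

Lemma cyl_content_setT : cyl_content setT = 1.
Proof.
rewrite (cyl_contentE (n := 0))//; first by rewrite /path_mean /= /ind indicT.
by split; [exact: measurableT|exists 0%N].
Qed.

Lemma cyl_contentU C D : cylinder C -> cylinder D -> C `&` D = set0 ->
  cyl_content (C `|` D) = cyl_content C + cyl_content D.
Proof.
move=> cC cD CD; pose n := maxn (level C) (level D).
have lC : level_fun n C := level_fun_le (leq_maxl _ _) (levelP cC).
have lD : level_fun n D := level_fun_le (leq_maxr _ _) (levelP cD).
have lU : level_fun n (C `|` D) by move=> w w' ww'; rewrite /setU/= (lC _ _ ww') (lD _ _ ww').
rewrite (cyl_contentE (cylinderU cC cD) lU) (cyl_contentE cC lC) (cyl_contentE cD lD).
case: (posfun_resamples 0 n w0) => _ FD _ _ _.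
rewrite /path_mean -(FD _ _ (nnmfun_ind cC) (nnmfun_ind cD)).
congr (resamples _ _ _ _); apply/funext => w; rewrite /ind -EFinD; congr EFin.
rewrite !indicE in_setU; have [wC|wC] := boolP (w \in (C : set paths)); last by rewrite add0r.
rewrite /= memNset ?addr0// => wD; have : (C `&` D) w by split => //; exact: set_mem.
by rewrite CD.
Qed.

Lemma cyl_content_le1 C : cylinder C -> cyl_content C <= 1.
Proof.
move=> cC; have cT : cylinder (@setT (nat -> X)) by split; [exact: measurableT|exists 0%N].
rewrite -cyl_content_setT -(setUv C) setUC -setTD cyl_contentU//.
- by rewrite leeDr// cyl_content_ge0//; exact: cylinderD.
- exact: cylinderD.
- by rewrite setTD setICl.
Qed.

Definition cyl_measure (C : set (cylpath X)) : \bar R :=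
  if `[< cylinder C >] then cyl_content C else 0.

Lemma cyl_measureE C : cylinder C -> cyl_measure C = cyl_content C.
Proof. by move=> cC; rewrite /cyl_measure asboolT. Qed.

Let cyl_measure0 : cyl_measure set0 = 0.
Proof. by rewrite cyl_measureE ?cyl_content_set0//; exact: cylinder0. Qed.

Let cyl_measure_ge0 C : 0 <= cyl_measure C.
Proof. by rewrite /cyl_measure; case: asboolP => // cC; exact: cyl_content_ge0. Qed.

Let cyl_measure_sigma_additive : semi_sigma_additive cyl_measure.
Proof.
move=> F cF tF cUF.
pose D j := \big[setU/set0]_(i < j) F i.
have cD j : cylinder (D j).
  by rewrite /D; elim/big_ind: _ => [|C C'|i _]; [exact: cylinder0|exact: cylinderU|exact: cF].
have cC j : cylinder ((\bigcup_n F n) `\` D j) by exact: cylinderD.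
have DU j : D j `<=` \bigcup_n F n by move=> w; rewrite /D -bigcup_mkord => -[i _ Fi]; exists i.
have sumE j : \sum_(0 <= i < j) cyl_measure (F i) = cyl_content (D j).
  elim: j => [|j ih]; first by rewrite big_geq// /D big_ord0 cyl_content_set0.
  rewrite big_nat_recr//= ih /D big_ord_recr /= -/(D j) cyl_contentU//.
  - by rewrite cyl_measureE//; exact: cF.
  - exact: cF.
  apply/seteqP; split => // w []; rewrite /D -bigcup_mkord => -[i /= ij Fi] Fj.
  by move/trivIsetP : tF => /(_ i j I I); rewrite neq_ltn ij => /(_ isT)/seteqP[/(_ w (conj Fi Fj))].
have fC C : cylinder C -> cyl_content C \is a fin_num.
  move=> hC; rewrite ge0_fin_numE ?cyl_content_ge0//.
  by apply: le_lt_trans (cyl_content_le1 hC) _; rewrite ltry.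
rewrite cyl_measureE//.
(* Countable additivity is reduced to continuity at the empty set: a partial sum is the total
   content minus that of the remainder. *)
rewrite (_ : (fun n => _) = fun j => cyl_content (\bigcup_n F n) -
    cyl_content ((\bigcup_n F n) `\` D j)); last first.
  apply/funext => j; rewrite sumE.
  rewrite -[in X in X - _](setDUK (DU j)) cyl_contentU//; last by rewrite setDIK.
  by rewrite addeK// fC.
rewrite -[X in _ --> X]sube0; apply: cvgeB.
- by rewrite fin_num_adde_defl.
- exact: cvg_cst.
- apply: cyl_content_cvg0 => // [j|].
    by apply: setDS; rewrite /D big_ord_recr /=; exact: subsetUl.
  apply/seteqP; split => // w h; have [[n _ Fn] _] := h 0%N I.
  have [_] := h n.+1 I; apply; rewrite /D big_ord_recr /=; by right.
Qed.

HB.instance Definition _ := isMeasure.Build _ _ _ cyl_measure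
  cyl_measure0 cyl_measure_ge0 cyl_measure_sigma_additive.

Definition path_space := g_sigma_algebraType (@cylinder _ X).

Lemma path_measure_setT : measure_extension cyl_measure setT = 1.
Proof.
have cT : cylinder (@setT (nat -> X)) by split; [exact: measurableT|exists 0%N].
rewrite /measure_extension measurable_mu_extE//.
by rewrite [LHS]cyl_measureE// cyl_content_setT.
Qed.

Definition path_prob : probability path_space R := mkprob path_measure_setT.

Lemma path_probE C : cylinder C -> path_prob C = cyl_content C.
Proof.
move=> cC; rewrite -(cyl_measureE cC).
exact: (measurable_mu_extE cyl_measure cC).
Qed.

Lemma cylinder_measurable C : cylinder C -> measurable (C : set path_space).
Proof. exact: sub_sigma_algebra. Qed.

Lemma measurable_path_id : measurable_fun setT (fun w : path_space => w : paths).
Proof.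
apply: measurable_paths => k _ B mB; rewrite setTI; apply: cylinder_measurable.
split; first by rewrite -[X in measurable X]setTI; exact: measurable_coord.
by exists k.+1 => w w' /(_ k (leqnn _)); rewrite /preimage/= => ->.
Qed.

(** Freezing the coordinates from [n] on makes the preimage of every measurable set a cylinder,
    where [path_prob] is known; this carries the formula for contents over to integrals of functions
    of level [n]. *)
Definition truncate_path n (w : nat -> X) : nat -> X := fun i => if (i < n)%N then w i else x0.

Lemma measurable_truncate_path n :
  measurable_fun setT (fun w : paths => truncate_path n w : paths).
Proof.
apply: measurable_paths => i; have [iN|iN] := boolP (i < n)%N.
  rewrite (_ : (fun _ => _) = fun w : paths => w i); first exact: measurable_coord.
  by apply/funext => w; rewrite /truncate_path iN.
rewrite (_ : (fun _ => _) = fun _ : paths => x0); first exact: measurable_cst.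
by apply/funext => w; rewrite /truncate_path (negbTE iN).
Qed.

Lemma truncate_pathE T n (f : paths -> T) w : level_fun n f -> f (truncate_path n w) = f w.
Proof. by move=> hf; apply: hf => i iN; rewrite /truncate_path iN. Qed.

Lemma integral_path_prob n (f : paths -> \bar R) : nnmfun f -> level_fun n f ->
  \int[path_prob]_w f w = path_mean n f.
Proof.
move=> hf lf; have mt' := measurable_truncate_path n.
have mt : measurable_fun setT (fun w : path_space => truncate_path n w : paths).
  exact: (measurableT_comp mt' measurable_path_id).
transitivity (\int[path_prob]_w f (truncate_path n w)).
  by apply: eq_integral => w _; rewrite truncate_pathE.
rewrite -(integral_posfun (posfun_push path_prob mt) hf).
have tE (g : paths -> \bar R) w : level_fun n (fun w => g (truncate_path n w)).
  move=> v v' vv'; congr g; apply/funext => i.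
  by rewrite /truncate_path; case: ifP => // /vv'.
have hF : posfun (fun g : paths -> \bar R => path_mean n (fun w => g (truncate_path n w))).
  have [F0 FD FZ Fle Flim] := posfun_resamples 0 n w0.
  have nt (g : paths -> \bar R) : nnmfun g -> nnmfun (fun w : paths => g (truncate_path n w)).
    by move=> [mg g0]; split => [|w]; [exact: (measurableT_comp mg mt')|exact: g0].
  rewrite /path_mean; split => [g hg|g g' hg hg'|c g c0 hg|g g' hg hg' gg'|h hh ndh].
  - exact: F0 (nt _ hg).
  - exact: FD (nt _ hg) (nt _ hg').
  - exact: FZ c0 (nt _ hg).
  - exact: Fle (nt _ hg) (nt _ hg') (fun w => gg' _).
  - exact: (Flim (fun n w => h n _) (fun n => nt _ (hh n)) (fun w => ndh _)).
rewrite (posfun_setfun_integral hF _ hf); last first.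
  move=> B mB.
  have lB : level_fun n (truncate_path n @^-1` B).
    move=> v v' vv'; rewrite /preimage/=; congr B; apply/funext => i.
    by rewrite /truncate_path; case: ifP => // /vv'.
  have cB : cylinder (truncate_path n @^-1` B).
    by split; [rewrite -[X in measurable X]setTI; exact: mt'|exists n].
  rewrite [LHS](meas_pushE path_prob mt)//.
  transitivity (cyl_content (truncate_path n @^-1` B)); first exact: path_probE.
  by rewrite (cyl_contentE cB lB).
by rewrite /path_mean; congr (resamples _ _ _ _); apply/funext => w; rewrite truncate_pathE.
Qed.

(** The Markov property on cylinders: of the [n + 1] redraws only the last one touches coordinate
    [n], and it leaves the indicator of [C] unchanged. *)
Lemma path_markov n (C : set (nat -> X)) (g : X -> \bar R) : measurable (C : set paths) ->
  level_fun n C -> nnmfun g ->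
  \int[path_prob]_(w in C) g ((w : nat -> X) n) =
  \int[path_prob]_(w in C) \int[past_kernel n w]_y g y.
Proof.
move=> mC lC hg; have [mg g0] := hg.
have lI := level_ind lC.
have lI1 : level_fun n.+1 (ind C) := level_fun_le (leqnSn n) lI.
pose f1 (w : paths) := ind C w * g (w n).
pose f2 (w : paths) := ind C w * \int[past_kernel n w]_y g y.
have nI : nnmfun (ind C) by exact: nnmfun_indic.
have h1 : nnmfun f1.
  apply: nnmfunM => //; split => // ; exact: (measurableT_comp mg (measurable_coord n)).
have h2 : nnmfun f2.
  apply: nnmfunM => //; split => [|w]; last exact: integral_ge0.
  by apply: measurable_fun_integral_kernel => // U mU; exact: measurable_kernel.
have l1 : level_fun n.+1 f1.
  by move=> w w' ww'; rewrite /f1 (lI1 _ _ ww') ww'.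
have l2 : level_fun n f2.
  move=> w w' ww'; rewrite /f2 (lI _ _ ww') /past_kernel /past.
  by case: n {lC lI lI1 f1 f2 h1 h2 l1} ww' => // n ->.
have restr (h : paths -> \bar R) : (fun w => h w) \_ C = fun w => ind C w * h w.
  by apply/funext => w; rewrite patchE /ind indicE; case: ifPn; rewrite ?mul1e ?mul0e.
rewrite integral_mkcond [RHS]integral_mkcond restr restr.
rewrite (integral_path_prob h1 l1) (integral_path_prob h2 l2) /path_mean.
rewrite -addn1 resamplesD add0n /=; congr (resamples _ _ _ _).
apply/funext => w; rewrite /resample /f1 /f2 -ge0_integralZl//.
  apply: eq_integral => y _; rewrite /upd eqxx; congr (_ * _); apply: lI => i iN.
  by rewrite ltn_eqF.
by rewrite lee_fin.
Qed.

End ionescu_tulcea.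

(** * The chain of state-action pairs *)

Section trajectory_existence.
Context {R : realType} {S A : ptopologicalType}.
Variables (mu : {finite_measure set (borel A) -> \bar R}).
Variables (p : S -> A -> R) (hp : good_density mu p).
Local Open Scope ereal_scope.
Notation X := (borel S * borel A)%type.

Definition act_fun (f : X -> \bar R) (s : borel S) : \bar R :=
  \int[mu]_a (f (s, a) * (p s a)%:E).

Lemma posfun_act_fun s : posfun (fun f => act_fun f s).
Proof.
have -> : (fun f => act_fun f s) = fun f : X -> \bar R =>
  (fun h => \int[mu]_a (h a * (p s a)%:E)) (fun a => (f (s, a))) by [].
have [F0 FD FZ Fle Flim] := act_posfun hp s.
have nt (g : X -> \bar R) : nnmfun g -> nnmfun (fun a => g (s, a)).
  by move=> [mg g0]; split => [|a //]; exact: (measurableT_comp mg (measurable_pair1 s)).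
split => [g hg|g g' hg hg'|c g c0 hg|g g' hg hg' gg'|h hh ndh].
- exact: F0 (nt _ hg).
- exact: FD (nt _ hg) (nt _ hg').
- exact: FZ c0 (nt _ hg).
- exact: Fle (nt _ hg) (nt _ hg') (fun w => gg' _).
- exact: (Flim (fun n a => h n _) (fun n => nt _ (hh n)) (fun a => ndh _)).
Qed.

Lemma measurable_act_fun f : nnmfun f -> measurable_fun setT (act_fun f).
Proof.
move=> [mf f0].
apply: (measurable_fun_fubini_tonelli_F (fun z => f z * (p z.1 z.2)%:E)).
  apply: emeasurable_funM => //.
  by apply/measurable_EFinP; case: hp => -[].
by move=> z; rewrite mule_ge0// lee_fin (density_ge0 hp).
Qed.

Lemma nnmfun_act_fun f : nnmfun f -> nnmfun (act_fun f).
Proof.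
move=> hf; split; first exact: measurable_act_fun.
by move=> s; case: (posfun_act_fun s) => + _ _ _ _; exact.
Qed.

Lemma act_fun_fst (g : borel S -> \bar R) s : nnmfun g -> act_fun (fun x => g x.1) s = g s.
Proof.
move=> [mg g0]; rewrite /act_fun /= ge0_integralZl//.
- rewrite rintE//; [|exact: fin_mu|exact: (density_bmf hp)].
  by case: hp => _ _ ->; rewrite mule1.
- by apply/measurable_EFinP; case: (density_bmf hp s).
- by move=> a _; rewrite lee_fin (density_ge0 hp).
Qed.

Section state_action_kernel.
Variable Q : R.-pker X ~> borel S.

Lemma posfun_state_action x : posfun (fun f => \int[Q x]_s act_fun f s).
Proof.
apply: (posfun_comp (posfun_integral (Q x)) posfun_act_fun).
exact: measurable_act_fun.
Qed.

(** The law of a state drawn from [Q x] together with an action drawn from the policy at that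
    state. *)
Definition state_action x : {measure set X -> \bar R} := meas_posfun (posfun_state_action x).

Lemma integral_state_action x f : nnmfun f ->
  \int[state_action x]_y f y = \int[Q x]_s act_fun f s.
Proof. exact: integral_posfun. Qed.

Let measurable_state_action U : measurable U -> measurable_fun setT (state_action ^~ U).
Proof.
move=> mU; rewrite (_ : (fun x => state_action x U) =
    fun x => \int[Q x]_s act_fun (fun z => (\1_U z)%:E) s); last first.
  by apply/funext => x; rewrite [LHS](mposfunE (posfun_state_action x)).
have [m1 p1] := nnmfun_act_fun (nnmfun_indic R mU).
by apply: measurable_fun_integral_kernel => // V mV; exact: measurable_kernel.
Qed.

HB.instance Definition _ := isKernel.Build _ _ _ _ _ state_action measurable_state_action.

Let state_action_prob x : state_action x setT = 1.
Proof.
rewrite [LHS](mposfunE (posfun_state_action x))//.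
under eq_integral => s _.
  rewrite (_ : (fun x => _) = fun x : X => cst 1 x.1); last first.
    by apply/funext => z; rewrite indicT.
  rewrite act_fun_fst; last exact: (@nnmfun_cst _ _ R 1 ler01).
  over.
by rewrite integral_cst// mul1e prob_kernel.
Qed.

HB.instance Definition _ := Kernel_isProbability.Build _ _ _ _ _ state_action state_action_prob.

End state_action_kernel.

Variable (P : R.-pker X ~> borel S) (s0 : S).

Definition start_kernel : R.-pker X ~> borel S :=
  kdirac (measurable_cst (s0 : borel S) : measurable_fun [set: X] _).

Definition traj_kernel (n : nat) : R.-pker X ~> X :=
  if n is _.+1 then state_action P else state_action start_kernel.

Let x0 : X := (s0 : borel S, (point : A) : borel A).

Notation Pr := (path_prob traj_kernel x0).

Lemma trajectory_exists : exists d (Om : measurableType d) (Pr : probability Om R)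
    (st : nat -> Om -> borel S) (ac : nat -> Om -> borel A),
  trajectory P mu p s0 Pr st ac.
Proof.
pose st n (w : path_space X) : borel S := ((w : nat -> X) n).1.
pose ac n (w : path_space X) : borel A := ((w : nat -> X) n).2.
pose Qn n : R.-pker X ~> borel S := if n is _.+1 then P else start_kernel.
have KE n w f : nnmfun f -> \int[past_kernel traj_kernel x0 n w]_y f y =
    \int[Qn n (past x0 n w)]_s act_fun f s.
  by move=> hf; rewrite /past_kernel; case: n => [|n]; exact: integral_state_action.
have mst' n : measurable_fun setT (fun w : paths X => (w n).1).
  exact: (measurableT_comp measurable_fst (measurable_coord n)).
have mac' n : measurable_fun setT (fun w : paths X => (w n).2).
  exact: (measurableT_comp measurable_snd (measurable_coord n)).
have mst n : measurable_fun setT (st n) := measurableT_comp (mst' n) (@measurable_path_id _ X).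
have mac n : measurable_fun setT (ac n) := measurableT_comp (mac' n) (@measurable_path_id _ X).
have PrI (C : set (path_space X)) (g : X -> \bar R) n (G : set (path_space X)) :
    measurable C -> measurable G ->
    (forall w, g ((w : nat -> X) n) = (\1_G w)%:E) ->
    Pr (C `&` G) = \int[Pr]_(w in C) g ((w : nat -> X) n).
  move=> mC mG gG; transitivity (\int[Pr]_(w in C) (\1_G w)%:E).
    by rewrite setIC (integral_indic Pr mC mG).
  by apply: eq_integral => w _; rewrite gG.
exists _, (path_space X), Pr, st, ac; split => //.
- move=> B mB.
  have nB : nnmfun (fun x : X => (\1_B x.1)%:E : \bar R).
    have [mi i0] := nnmfun_indic R mB.
    by split => // ; exact: (measurableT_comp mi measurable_fst).
  rewrite -[X in Pr X]setTI (PrI setT (fun x => (\1_B x.1)%:E) 0%N)//; last first.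
    by rewrite -[X in measurable X]setTI; exact: mst.
  transitivity (\int[Pr]_w \int[past_kernel traj_kernel x0 0 w]_y (\1_B y.1)%:E).
    exact: (@path_markov _ _ _ traj_kernel x0 0%N setT (fun x : X => (\1_B x.1)%:E)
      measurableT (fun _ _ _ => erefl) nB).
  rewrite (_ : (fun w => _) = cst (\d_(s0 : borel S) B)).
    have m1 : (Pr : {measure set (path_space X) -> \bar R}) setT = 1 by exact: probability_setT.
    by rewrite integral_cst// m1 mule1.
  apply/funext => w; rewrite KE// /Qn.
  transitivity (\int[start_kernel (past x0 0 w)]_s (\1_B s)%:E).
    by apply: eq_integral => s _; exact: (act_fun_fst s (nnmfun_indic R mB)).
  by rewrite integral_indic// setIT.
- move=> n E F mE mF H H'.
  (* [H] constrains one state more than actions, so it is not a cylinder of pairs: it is the pair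
     cylinder [C] before time [n] cut by a condition on the state at time [n]. [H'] is the pair
     cylinder of level [n + 1]. *)
  pose C : set (nat -> X) := [set w | forall k, (k < n)%N -> E k (w k).1 /\ F k (w k).2].
  have mC m : measurable ([set w | forall k, (k < m)%N -> E k (w k).1 /\ F k (w k).2] : set (paths X)).
    rewrite (_ : [set w | _] = \bigcap_(k < m)
      ((fun w : paths X => (w k).1) @^-1` E k `&` (fun w : paths X => (w k).2) @^-1` F k))//.
    apply: fin_bigcap_measurable => [|k _]; first exact: finite_II.
    by apply: measurableI; rewrite -[X in measurable X]setTI; [exact: mst'|exact: mac'].
  have lC m : level_fun m [set w : nat -> X | forall k, (k < m)%N -> E k (w k).1 /\ F k (w k).2].
    move=> w w' ww'; apply/propext; split => h k km; first by rewrite -ww'//; exact: h.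
    by rewrite ww'//; exact: h.
  have cC m : cylinder [set w : nat -> X | forall k, (k < m)%N -> E k (w k).1 /\ F k (w k).2].
    by split => //; exists m.
  have HE : H = C `&` st n @^-1` E n.
    apply/seteqP; split => w /=.
      by move=> [h1 h2]; split; [move=> k kn; split; [exact/h1/ltnW|exact: h2]|exact: h1].
    move=> [h1 h2]; split => k; last by move=> /h1[].
    by rewrite leq_eqVlt => /predU1P[->//|/h1[]].
  have H'E : H' = [set w : nat -> X | forall k, (k < n.+1)%N -> E k (w k).1 /\ F k (w k).2].
    rewrite /H' HE; apply/seteqP; split => w /=.
      move=> [[h1 h2] h3] k; rewrite ltnS leq_eqVlt => /predU1P[->//|]; exact: h1.
    move=> h; split; last by case: (h n (ltnSn n)).
    by split; [move=> k kn; apply: h; exact: ltnW|case: (h n (ltnSn n))].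
  have mE' : measurable (st n @^-1` E n) by rewrite -[X in measurable X]setTI; exact: mst.
  split => B mB.
    (* The condition on the state at time [n] moves into the integrands. Both sides become instances
       of [path_markov] over [C], and they agree once the action is integrated out at a fixed
       state. *)
    pose g1 (x : X) : \bar R := (\1_(E n) x.1)%:E * (\1_B x.2)%:E.
    pose g2 (x : X) : \bar R := (\1_(E n) x.1)%:E * policy mu p x.1 B.
    have [mi i0] := nnmfun_indic R (mE n).
    have [mi' i0'] := nnmfun_indic R mB.
    have nE : nnmfun (fun x : X => (\1_(E n) x.1)%:E : \bar R).
      by split => // ; exact: (measurableT_comp mi measurable_fst).
    have nB : nnmfun (fun x : X => (\1_B x.2)%:E : \bar R).
      by split => // ; exact: (measurableT_comp mi' measurable_snd).
    have polE s : policy mu p s B = act_fun (fun x : X => (\1_B x.2)%:E) s.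
      rewrite /policy integral_mkcond; apply: eq_integral => a _.
      by rewrite patchE indicE/=; case: ifPn; rewrite ?mul1e ?mul0e.
    have [mp' p0'] := nnmfun_act_fun nB.
    have np : nnmfun (fun s : borel S => policy mu p s B).
      by split => [|s]; [under eq_fun do rewrite polE|rewrite polE].
    have n1 : nnmfun g1 by exact: nnmfunM.
    have n2' : nnmfun (fun s : borel S => (\1_(E n) s)%:E * policy mu p s B).
      exact: (nnmfunM (nnmfun_indic R (mE n)) np).
    have n2 : nnmfun g2.
      case: n2' => m2 p2; split => [|x]; last exact: p2.
      exact: (measurableT_comp m2 measurable_fst).
    have mB' : measurable (ac n @^-1` B) by rewrite -[X in measurable X]setTI; exact: mac.
    rewrite HE -setIA (PrI C g1 n); last 3 first.
    - exact: (cylinder_measurable (cC n)).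
    - exact: measurableI.
    - move=> w; rewrite /g1 !indicE in_setI -EFinM -natrM mulnb; congr (_%:R%:E).
    rewrite integral_mkcondr.
    transitivity (\int[Pr]_(w in C) g2 ((w : nat -> X) n)); last first.
      apply: eq_integral => w _; rewrite patchE /g2 indicE.
      rewrite (_ : (w \in st n @^-1` E n) = (((w : nat -> X) n).1 \in E n))//.
      by case: ifPn; rewrite ?mul1e ?mul0e.
    rewrite (path_markov _ _ (mC n) (lC n) n1) (path_markov _ _ (mC n) (lC n) n2).
    apply: eq_integral => w _; rewrite (KE n w g1 n1) (KE n w g2 n2); apply: eq_integral => s _.
    rewrite (act_fun_fst s n2') polE /act_fun -ge0_integralZl//.
    + by apply: eq_integral => a _; rewrite /g1 muleA.
    + apply: emeasurable_funM; first exact: (measurableT_comp (proj1 nB) (measurable_pair1 s)).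
      by apply/measurable_EFinP; case: (density_bmf hp s).
    + by move=> a _; rewrite mule_ge0// lee_fin// (density_ge0 hp).
  have [mi i0] := nnmfun_indic R mB.
  have nB : nnmfun (fun x : X => (\1_B x.1)%:E : \bar R).
    by split => // ; exact: (measurableT_comp mi measurable_fst).
  rewrite H'E (PrI _ (fun x => (\1_B x.1)%:E) n.+1)//.
  + rewrite (path_markov _ _ (mC n.+1) (lC n.+1) nB).
    apply: eq_integral => w _; rewrite KE//=.
    transitivity (\int[P ((w : nat -> X) n)]_s (\1_B s)%:E).
      by apply: eq_integral => s _; exact: (act_fun_fst s (nnmfun_indic R mB)).
    by rewrite integral_indic// setIT; congr (P _ _); rewrite /st /ac -surjective_pairing.
  + exact: (cylinder_measurable (cC n.+1)).
  + by rewrite -[X in measurable X]setTI; exact: mst.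
Qed.

End trajectory_existence.

(** * Performance differences *)

Section tilting_estimates.
Context {R : realType}.
Implicit Types x y e n m : R.

(** From [1 - x <= expR (- x)] one gets [expR x * (1 - x) <= 1], that is
    [(expR x - 1 - x) * (1 - x) <= x ^+ 2], where [1 - x] is at least one half. *)
Lemma expR_quadratic x : `|x| <= 2^-1 -> 0 <= expR x - 1 - x <= 2 * x ^+ 2.
Proof.
move=> xh; have xlt : x <= 2^-1 by exact: le_trans (ler_norm _) xh.
have x1 : 0 < 1 - x by lra.
have lo := expR_ge1Dx x; have lo' := expR_ge1Dx (- x).
have e0 := expR_gt0 x; have e0' := expR_gt0 (- x).
have eN : expR x * expR (- x) = 1 by rewrite -expRD subrr expR0.
apply/andP; split; first by lra.
have up : expR x * (1 - x) <= 1 by have := ler_wpM2l (ltW e0) lo'; rewrite eN.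
have : (expR x - 1 - x) * (1 - x) <= x ^+ 2 by rewrite !mulrBl expr2; lra.
have : 0 <= expR x - 1 - x by lra.
set z := expR x - 1 - x => z0 h.
have : z * 2^-1 <= x ^+ 2 by apply: le_trans h; rewrite ler_wpM2l//; lra.
lra.
Qed.

Lemma ln_le_sub1 x : 0 < x -> ln x <= x - 1.
Proof.
by move=> x0; have := @le_ln1Dx R (x - 1); rewrite (addrC 1) subrK; apply; lra.
Qed.

(* x is the exponent, n the normalization and y the mean of the exponent. *)
Lemma tilt_estimates x y n e : `|x| <= e -> `|y| <= e -> e <= 4^-1 ->
  0 <= n - 1 - y <= 2 * e ^+ 2 ->
  [/\ 2^-1 <= n, `|expR x / n - 1 - (x - y)| <= 16 * e ^+ 2,
      `|expR x / n - 1| <= 6 * e & `|x - ln n| <= 5 * e].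
Proof.
move=> xe ye e4 /andP[n1 n2].
have e0 : 0 <= e by exact: le_trans (normr_ge0 x) xe.
have ee : e ^+ 2 <= 4^-1 * e by rewrite expr2 ler_wpM2r.
have [x1 x2] : - e <= x /\ x <= e by move: xe; rewrite ler_norml => /andP.
have [y1 y2] : - e <= y /\ y <= e by move: ye; rewrite ler_norml => /andP.
have xx : x ^+ 2 <= e ^+ 2 by rewrite -[x ^+ 2]real_normK ?num_real// ler_sqr ?nnegrE.
have /andP[q1 q2] : 0 <= expR x - 1 - x <= 2 * x ^+ 2.
  by apply: expR_quadratic; apply: le_trans xe _; lra.
have n_lo : 2^-1 <= n by lra.
have n0 : 0 < n by lra.
have ndiff : `|n - 1| <= 2 * e by rewrite ler_norml; apply/andP; split; lra.
have xy : `|x - y| <= 2 * e by rewrite ler_norml; apply/andP; split; lra.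
have h2 : `|expR x / n - 1 - (x - y)| <= 16 * e ^+ 2.
  have -> : expR x / n - 1 - (x - y) =
      ((expR x - 1 - x) - (n - 1 - y) - (x - y) * (n - 1)) / n.
    by field; rewrite gt_eqF.
  rewrite normrM (ger0_norm (_ : 0 <= n^-1)) ?invr_ge0 ?(ltW n0)//.
  rewrite ler_pdivrMr//; apply: (@le_trans _ _ (8 * e ^+ 2)); last first.
    have := sqr_ge0 e; set E := e ^+ 2 => E0.
    have : 16 * E * 2^-1 <= 16 * E * n by rewrite ler_wpM2l// mulr_ge0.
    lra.
  have hp : `|(x - y) * (n - 1)| <= 4 * e ^+ 2.
    rewrite normrM; apply: le_trans (ler_pM _ _ xy ndiff) _ => //.
    by rewrite le_eqVlt; apply/orP; left; apply/eqP; ring.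
  have [hp1 hp2] : - (4 * e ^+ 2) <= (x - y) * (n - 1) /\ (x - y) * (n - 1) <= 4 * e ^+ 2.
    by move: hp; rewrite ler_norml => /andP.
  by rewrite ler_norml; apply/andP; split; lra.
split => //.
  rewrite -[_ - 1](subrK (x - y)) (le_trans (ler_normD _ _))//.
  by apply: (@le_trans _ _ (16 * e ^+ 2 + 2 * e)); [exact: lerD|lra].
have ln1 : ln n <= 2 * e.
  by apply: le_trans (ln_le_sub1 n0) _; lra.
have ln2 : - (4 * e) <= ln n.
  have ni : 0 < n^-1 by rewrite invr_gt0.
  have h := ln_le_sub1 ni; rewrite lnV ?posrE// in h.
  suff : n^-1 - 1 <= 4 * e by lra.
  rewrite -[X in _ - X](mulfV (lt0r_neq0 n0)) -[X in X - _]mul1r -mulrBl ler_pdivrMr//.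
  have : 4 * e * 2^-1 <= 4 * e * n by rewrite ler_wpM2l// mulr_ge0.
  lra.
by rewrite ler_norml; apply/andP; split; lra.
Qed.

End tilting_estimates.

Section performance_difference.
Context {R : realType} {S A : ptopologicalType}.
Variables (P : R.-pker (borel S * borel A)%type ~> borel S) (r : S -> A -> R).
Variables (gamma tau : R) (mu : {finite_measure set (borel A) -> \bar R}).
Hypothesis hgamma : 0 <= gamma < 1.
Hypothesis htau : 0 <= tau.
Hypothesis hr : bmf (fun x : borel S * borel A => r x.1 x.2).
Variable rho : probability (borel S) R.

Let g0 : 0 <= gamma. Proof. by case/andP: hgamma. Qed.
Let g1 : gamma < 1. Proof. by case/andP: hgamma. Qed.
Let fmu : (mu setT < +oo)%E := fin_mu mu.

(* Q - tau ln p, for a candidate value function W. *)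
Definition soft_q (p : S -> A -> R) (W : borel S -> R) (x : borel S * borel A) : R :=
  reg_reward r tau p x.1 x.2 + gamma * rint (P x) W.

Lemma bmf_soft_q p W : good_density mu p -> bmf W -> bmf (soft_q p W).
Proof.
by move=> hp hW; apply: bmfD; [exact: (bmf_reg_reward tau hr hp)|apply: bmfZ; exact: bmf_P].
Qed.

Lemma bmf_act (h : borel S * borel A -> R) s : bmf h -> bmf (fun a => h (s, a)).
Proof. by move=> hh; exact: bmf_pair1. Qed.

Section two_policies.
Variables (p q : S -> A -> R) (hp : good_density mu p) (hq : good_density mu q).
Variables (Wp Wq : borel S -> R).
Hypotheses (hWp : bmf Wp) (hWq : bmf Wq).
Hypotheses (EWp : bellman P r gamma tau mu p Wp) (EWq : bellman P r gamma tau mu q Wq).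

Lemma bellman_soft_q W u (hu : good_density mu u) : bmf W ->
  bellman P r gamma tau mu u W -> forall s, W s = rint mu (fun a => soft_q u W (s, a) * u s a).
Proof.
move=> hW EW s; rewrite EW /state_op /act_mean.
have bu := density_bmf hu s.
have b1 : bmf (fun a : borel A => reg_reward r tau u s a).
  exact: (bmf_act s (bmf_reg_reward tau hr hu)).
have b2 : bmf (fun a : borel A => rint (P (s, a)) W) := bmf_act s (bmf_P P hW).
rewrite -rintZ//; last exact: bmfM.
rewrite -rintD//; [|exact: bmfM|apply: bmfZ; exact: bmfM].
by apply: eq_rint => a; rewrite /soft_q /=; ring.
Qed.

Definition kl_cost s : R := rint mu (fun a => p s a * (ln (p s a) - ln (q s a))).

(** In the Bellman equation of [p] the regularization [ln p] is replaced by [ln q]; the price of the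
    exchange, averaged under [p], is the relative entropy. It enters with a favourable sign. *)
Lemma performance_local s :
  (Wq s - Wp s) - gamma * state_op P mu p (fun s => Wq s - Wp s) s =
  rint mu (fun a => soft_q q Wq (s, a) * (q s a - p s a)) + tau * kl_cost s.
Proof.
have bp := density_bmf hp s; have bq := density_bmf hq s.
have bBp := bmf_act s (bmf_soft_q hp hWp); have bBq := bmf_act s (bmf_soft_q hq hWq).
have blp : bmf (fun a : borel A => ln (p s a)) := bmf_act s (bmf_ln_density hp).
have blq : bmf (fun a : borel A => ln (q s a)) := bmf_act s (bmf_ln_density hq).
have bW : bmf (fun s => Wq s - Wp s) by exact: bmfB.
have bP : bmf (fun a : borel A => rint (P (s, a)) (fun s => Wq s - Wp s)).
  exact: (bmf_act s (bmf_P P bW)).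
rewrite (bellman_soft_q hq hWq EWq) (bellman_soft_q hp hWp EWp) /state_op /act_mean /kl_cost.
rewrite -rintB//; [|exact: bmfM..].
rewrite -rintZ//; last exact: bmfM.
rewrite -rintB//; [|by apply: bmfB; exact: bmfM|by apply: bmfZ; exact: bmfM].
rewrite -rintZ//; last by apply: bmfM => //; exact: bmfB.
rewrite -rintD//; last 2 first.
- by apply: bmfM => //; exact: bmfB.
- by apply: bmfZ; apply: bmfM => //; exact: bmfB.
apply: eq_rint => a; rewrite /soft_q /reg_reward rintB//; last by rewrite P_prob ltry.
rewrite /=; ring.
Qed.

Lemma kl_cost_ge0 s : 0 <= kl_cost s.
Proof.
have bp := density_bmf hp s; have bq := density_bmf hq s.
have blp : bmf (fun a : borel A => ln (p s a)) := bmf_act s (bmf_ln_density hp).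
have blq : bmf (fun a : borel A => ln (q s a)) := bmf_act s (bmf_ln_density hq).
have -> : 0 = rint mu (fun a => p s a - q s a).
  by rewrite rintB//; case: hp => _ _ ->; case: hq => _ _ ->; rewrite subrr.
apply: le_rint => //; [exact: bmfB|by apply: bmfM => //; exact: bmfB|move=> a].
have p0 := density_gt0 hp s a; have q0 := density_gt0 hq s a.
have qp : 0 < q s a / p s a by rewrite divr_gt0.
have h := ln_le_sub1 qp; rewrite lnM ?posrE ?invr_gt0// lnV ?posrE// in h.
have : p s a * (ln (q s a) - ln (p s a)) <= p s a * (q s a / p s a - 1) by rewrite ler_wpM2l// ltW.
have -> : p s a * (q s a / p s a - 1) = q s a - p s a by field; rewrite gt_eqF.
rewrite !mulrBr; lra.
Qed.

End two_policies.

Definition occ_prob_measure p (hp : good_density mu p) : {measure set (borel S) -> \bar R} :=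
  meas_posfun (posfun_mix rho (measurable_occ_measure (measurable_step P hp) hgamma)).

Lemma occ_probE p (hp : good_density mu p) B : measurable B ->
  occupancy_at P gamma mu p rho B = occ_prob_measure hp B.
Proof.
move=> mB; rewrite [RHS](mposfunE (posfun_mix rho _))// /occupancy_at.
by apply: eq_integral => s _; rewrite integral_indic// setIT; exact: occE.
Qed.

Lemma occ_prob_setT p (hp : good_density mu p) : occ_prob_measure hp setT = 1%E.
Proof.
have m1 : (rho : {measure set (borel S) -> \bar R}) setT = 1%E by exact: probability_setT.
rewrite -occ_probE// /occupancy_at.
transitivity (\int[rho]_s (cst 1%E s))%E.
  apply: eq_integral => s _; rewrite (occE P hp hgamma)//.
  by apply: occ_measure_prob; exact: step_measure_prob.
by rewrite integral_cst// m1 mule1.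
Qed.

Definition occ_prob p (hp : good_density mu p) : probability (borel S) R :=
  mkprob (occ_prob_setT hp).

Lemma rint_occ_prob p (hp : good_density mu p) u :
  rint (occupancy_at P gamma mu p rho) u = rint (occ_prob hp) u.
Proof. exact: eq_setfun_rint (occ_probE hp). Qed.

Lemma bmf_fiber (h : borel S * borel A -> R) : bmf h ->
  bmf (fun s : borel S => rint mu (fun a => h (s, a))).
Proof. exact: bmf_rint1. Qed.

(** [performance_local] is integrated against the occupancy measure of [p] and the entropy is
    dropped. The action values are those of the new policy [q]; for tilts they are compared with
    those of [p] by [tilt_soft_q_close]. *)
Lemma performance_lower p q (hp : good_density mu p) (hq : good_density mu q) Wp Wq :
  bmf Wp -> bmf Wq -> bellman P r gamma tau mu p Wp -> bellman P r gamma tau mu q Wq ->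
  (1 - gamma)^-1 * rint (occ_prob hp)
    (fun s => rint mu (fun a => soft_q q Wq (s, a) * (q s a - p s a))) <=
  rint rho Wq - rint rho Wp.
Proof.
move=> hWp hWq EWp EWq.
have bW : bmf (fun s => Wq s - Wp s) by exact: bmfB.
have [bp _ _] := hp; have [bq _ _] := hq.
have bu : bmf (fun s => rint mu (fun a => soft_q q Wq (s, a) * (q s a - p s a))).
  apply: (bmf_fiber (h := fun x => soft_q q Wq x * (q x.1 x.2 - p x.1 x.2))).
  by apply: bmfM; [exact: bmf_soft_q|exact: bmfB].
have bk : bmf (kl_cost p q : borel S -> R).
  apply: (bmf_fiber (h := fun x => p x.1 x.2 * (ln (p x.1 x.2) - ln (q x.1 x.2)))).
  by apply: bmfM => //; exact: (bmfB (bmf_ln_density hp) (bmf_ln_density hq)).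
rewrite ler_pdivrMl ?subr_gt0// -rintB//; last exact: prob_fin.
rewrite -(occupancy_flow P hp hgamma rho bW) rint_occ_prob.
apply: le_rint => //; first exact: prob_fin.
  by apply: bmfB => //; apply: bmfZ; exact: bmf_state_op.
move=> s; rewrite (performance_local hp hq hWp hWq EWp EWq) lerDl mulr_ge0//.
exact: kl_cost_ge0.
Qed.

End performance_difference.

Lemma measurable_funV_pos d (T : measurableType d) (R : realType) (f : T -> R) :
  measurable_fun setT f -> (forall x, 0 < f x) -> measurable_fun setT (fun x => (f x)^-1).
Proof.
move=> mf f0; rewrite (_ : (fun x => _) = fun x => expR (- ln (f x))); last first.
  by apply/funext => x; rewrite -lnV ?posrE// lnK// posrE invr_gt0.
by apply: measurableT_comp => //; apply: measurableT_comp => //; exact: measurableT_comp.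
Qed.

(** * Exponential tilts of a policy *)

Section tilted_policy.
Context {R : realType} {S A : ptopologicalType}.
Variables (P : R.-pker (borel S * borel A)%type ~> borel S) (r : S -> A -> R).
Variables (gamma tau : R) (mu : {finite_measure set (borel A) -> \bar R}).
Hypothesis hgamma : 0 <= gamma < 1.
Hypothesis htau : 0 <= tau.
Hypothesis hr : bmf (fun x : borel S * borel A => r x.1 x.2).
Variable rho : probability (borel S) R.
Variables (p : S -> A -> R) (hp : good_density mu p).
Variables (D : borel S * borel A -> R) (hD : bmf D) (K : R).
Hypothesis DK : forall x, `|D x| <= K.

Let g0 : 0 <= gamma. Proof. by case/andP: hgamma. Qed.
Let g1 : gamma < 1. Proof. by case/andP: hgamma. Qed.
Let fmu : (mu setT < +oo)%E := fin_mu mu.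
Let K0 : 0 <= K. Proof. exact: le_trans (normr_ge0 _) (DK point). Qed.
Let p1 s : rint mu (fun a => p s a) = 1. Proof. by case: hp. Qed.
Let bp s : bmf (fun a : borel A => p s a) := density_bmf hp s.
Let pp : bmf (fun x : borel S * borel A => p x.1 x.2). Proof. by case: hp. Qed.

Definition tilt_mass e s : R := rint mu (fun a => p s a * expR (e * D (s, a))).
(** The motion of a softmax policy along a mixture of parameter laws, with [D] the difference of the
    logits; see [softmax_mix]. *)
Definition tilt e (s : S) (a : A) : R := p s a * (expR (e * D (s, a)) / tilt_mass e s).
Definition tilt_mean (s : S) : R := rint mu (fun a => D (s, a) * p s a).

Let bDs s : bmf (fun a => D (s, a)) := bmf_act s hD.

Let bexp e : bmf (fun x : borel S * borel A => p x.1 x.2 * expR (e * D x)).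
Proof. by apply: bmfM => //; apply: bmf_expR; exact: bmfZ. Qed.

Lemma rint_density_le s (h : borel A -> R) M : bmf h -> (forall a, `|h a| <= M * p s a) ->
  `|rint mu h| <= M.
Proof.
move=> hh hM; have bM : bmf (fun a : borel A => M * p s a) by exact: bmfZ.
have E : rint mu (fun a => M * p s a) = M by rewrite rintZ// p1 mulr1.
rewrite -[X in _ <= X]E ler_norml; apply/andP; split; last first.
  by apply: le_rint => // a; apply: le_trans (ler_norm _) (hM a).
rewrite lerNl E -[X in _ <= X]E -mulN1r -rintZ//; apply: le_rint => //; first exact: bmfZ.
by move=> a; rewrite mulN1r (le_trans _ (hM a))// -normrN ler_norm.
Qed.

Section small.
Variable e : R.
Hypotheses (e0 : 0 <= e) (eK : e * K <= 4^-1).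

Lemma tilt_mass_bounds s : 0 <= tilt_mass e s - 1 - e * tilt_mean s <= 2 * (e * K) ^+ 2.
Proof.
have -> : tilt_mass e s - 1 - e * tilt_mean s =
    rint mu (fun a => (expR (e * D (s, a)) - 1 - e * D (s, a)) * p s a).
  rewrite /tilt_mass /tilt_mean -{1}(p1 s) -rintZ//; last exact: bmfM.
  have b1 : bmf (fun a : borel A => p s a * expR (e * D (s, a))) := bmf_act s (bexp e).
  rewrite -rintB// -rintB//; last 2 first.
  - exact: bmfB.
  - by apply: bmfZ; exact: bmfM.
  by apply: eq_rint => a; ring.
have small a : `|e * D (s, a)| <= e * K by rewrite normrM ger0_norm// ler_wpM2l.
have bb : bmf (fun a => (expR (e * D (s, a)) - 1 - e * D (s, a)) * p s a).
  apply: bmfM => //; apply: bmfB; last exact: bmfZ.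
  by apply: bmfB; [apply: bmf_expR; exact: bmfZ|exact: bmf_cst].
have q a : 0 <= expR (e * D (s, a)) - 1 - e * D (s, a) <= 2 * (e * K) ^+ 2.
  have /andP[-> h] : 0 <= expR (e * D (s, a)) - 1 - e * D (s, a) <= 2 * (e * D (s, a)) ^+ 2.
    by apply: expR_quadratic; apply: le_trans (small a) _; apply: le_trans eK _; lra.
  rewrite (le_trans h)// ler_wpM2l// -[leLHS]real_normK ?num_real// ler_sqr ?nnegrE//.
  exact: mulr_ge0.
apply/andP; split.
  rewrite -(mul0r (fine (mu setT))) -rint_cst//; apply: le_rint => //; first exact: bmf_cst.
  by move=> a; rewrite mulr_ge0 ?(density_ge0 hp)//; case/andP: (q a).
apply: le_trans (ler_norm _) _; apply: (rint_density_le (s := s) bb) => a.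
rewrite normrM (ger0_norm (density_ge0 hp s a)) ler_wpM2r ?(density_ge0 hp)//.
by case/andP: (q a) => h1 h2; rewrite ger0_norm.
Qed.

Lemma tilt_estimate s a :
  [/\ 2^-1 <= tilt_mass e s,
   `|tilt e s a - p s a - e * (D (s, a) - tilt_mean s) * p s a| <= 16 * (e * K) ^+ 2 * p s a,
   `|tilt e s a - p s a| <= 6 * (e * K) * p s a
   & `|ln (tilt e s a) - ln (p s a)| <= 5 * (e * K)].
Proof.
have p0 := density_gt0 hp s a.
have small b : `|e * D (s, b)| <= e * K by rewrite normrM ger0_norm// ler_wpM2l.
have ms : `|e * tilt_mean s| <= e * K.
  rewrite normrM ger0_norm// ler_wpM2l//; apply: (rint_density_le (s := s)) => [|b].
    exact: bmfM.
  by rewrite normrM (ger0_norm (density_ge0 hp s b)) ler_wpM2r ?(density_ge0 hp).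
have [n2 h1 h2 h3] := tilt_estimates (small a) ms eK (tilt_mass_bounds s).
split => //.
- rewrite /tilt (_ : _ - _ - _ = (expR (e * D (s, a)) / tilt_mass e s - 1 -
    (e * D (s, a) - e * tilt_mean s)) * p s a); last by ring.
  by rewrite normrM (gtr0_norm p0) ler_wpM2r// ltW.
- rewrite /tilt (_ : _ - _ = (expR (e * D (s, a)) / tilt_mass e s - 1) * p s a); last by ring.
  by rewrite normrM (gtr0_norm p0) ler_wpM2r// ltW.
- have n0 : 0 < tilt_mass e s by lra.
  rewrite /tilt lnM ?posrE ?divr_gt0 ?expR_gt0// lnM ?posrE ?invr_gt0 ?expR_gt0// expRK lnV ?posrE//.
  by rewrite addrC addKr.
Qed.

Lemma good_tilt : good_density mu (tilt e).
Proof.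
have [_ [c c0 hc] _] := hp.
have hn s : 2^-1 <= tilt_mass e s by case: (tilt_estimate s point).
have hn2 s : tilt_mass e s <= 2.
  have /andP[_ h] := tilt_mass_bounds s.
  have : e * tilt_mean s <= 4^-1.
    apply: le_trans eK; rewrite ler_wpM2l//; apply: le_trans (ler_norm _) _.
    apply: (rint_density_le (s := s)) => [|b]; first exact: bmfM.
    by rewrite normrM (ger0_norm (density_ge0 hp s b)) ler_wpM2r ?(density_ge0 hp).
  have : (e * K) ^+ 2 <= 4^-1 * 4^-1.
    by rewrite expr2; apply: ler_pM => //; exact: mulr_ge0.
  lra.
have bn : bmf (fun x : borel S * borel A => (tilt_mass e x.1)^-1).
  have [mn _] := bmf_fiber mu (bexp e).
  split; last first.
    exists 2 => x; have := hn x.1 => h; rewrite ger0_norm ?invr_ge0; last by lra.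
    by rewrite -[2]invrK lef_pV2 ?posrE//; lra.
  apply: measurable_funV_pos; first exact: (measurableT_comp mn measurable_fst).
  by move=> x; have := hn x.1; rewrite /=; apply: lt_le_trans; rewrite invr_gt0.
split.
- rewrite (_ : (fun _ => _) = fun x : borel S * borel A =>
    (p x.1 x.2 * expR (e * D x)) * (tilt_mass e x.1)^-1); first exact: bmfM.
  by apply/funext => -[s a]; rewrite /tilt mulrA.
(* One half bounds the exponential from below, its exponent being at least [- 4^-1]; the other
   bounds the inverse of the normalization, which is at most 2. *)
- exists (c * (2^-1 * 2^-1)); first by rewrite !mulr_gt0.
  move=> s a; rewrite /tilt; apply: ler_pM => //; first exact: ltW.
  apply: ler_pM => //.
    apply: le_trans (expR_ge1Dx _).
    have : `|e * D (s, a)| <= 4^-1 by apply: le_trans eK; rewrite normrM ger0_norm// ler_wpM2l.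
    by rewrite ler_norml => /andP[]; lra.
  by rewrite lef_pV2 ?posrE//; have := hn s; lra.
- move=> s; rewrite (_ : (fun a => _) = fun a : borel A =>
    (tilt_mass e s)^-1 * (p s a * expR (e * D (s, a)))); last first.
    by apply/funext => a; rewrite /tilt; ring.
  rewrite rintZ//; last exact: (bmf_act s (bexp e)).
  by rewrite mulVf// gt_eqF//; have := hn s; apply: lt_le_trans; rewrite invr_gt0.
Qed.

Variables (Wp Wq : borel S -> R) (M : R).
Hypotheses (hWp : bmf Wp) (hWq : bmf Wq).
Hypotheses (EWp : bellman P r gamma tau mu p Wp) (EWq : bellman P r gamma tau mu (tilt e) Wq).
Hypothesis BM : forall x, `|soft_q P r gamma tau p Wp x| <= M.

Let M0 : 0 <= M. Proof. exact: le_trans (normr_ge0 _) (BM point). Qed.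
Let eK0 : 0 <= e * K. Proof. exact: mulr_ge0. Qed.
(** [6] and [5] are the constants of [tilt_estimate] for the density and for its logarithm; the
    division by [1 - gamma] comes from [bellman_contraction]. *)
Let L : R := (6 * M + 5 * tau) / (1 - gamma).
Let L0 : 0 <= L.
Proof. by rewrite /L divr_ge0 ?subr_ge0 ?(ltW g1)// addr_ge0// mulr_ge0. Qed.

(** [performance_local] is used with the tilted policy as the base one, so that the action values
    that occur are those of [p], which [M] bounds. *)
Lemma tilt_value_close s : `|Wp s - Wq s| <= L * (e * K).
Proof.
have hq := good_tilt; have bW : bmf (fun s => Wp s - Wq s) by exact: bmfB.
rewrite (_ : L * (e * K) = ((6 * M + 5 * tau) * (e * K)) / (1 - gamma)); last by rewrite /L mulrAC.
apply: (@bellman_contraction _ _ _ P gamma mu _ hq hgamma (fun s => Wp s - Wq s) _ bW _ s) => {}s.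
rewrite (performance_local hr hq hp hWq hWp EWq EWp).
have bB := bmf_act s (bmf_soft_q P gamma tau hr hp hWp); have bq := density_bmf hq s.
have blp : bmf (fun a : borel A => ln (p s a)) := bmf_act s (bmf_ln_density hp).
have blq : bmf (fun a : borel A => ln (tilt e s a)) := bmf_act s (bmf_ln_density hq).
apply: le_trans (ler_normD _ _) _; rewrite mulrDl; apply: lerD.
  apply: (rint_density_le (s := s)) => [|a]; first by apply: bmfM => //; exact: bmfB.
  have [_ _ h _] := tilt_estimate s a.
  rewrite normrM distrC (_ : 6 * M * (e * K) * p s a = M * (6 * (e * K) * p s a)); last by ring.
  by apply: ler_pM.
rewrite normrM (ger0_norm htau) (_ : 5 * tau * (e * K) = tau * (5 * (e * K))); last by ring.
rewrite ler_wpM2l//.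
have q1 : rint mu (fun a => 5 * (e * K) * tilt e s a) = 5 * (e * K).
  by rewrite rintZ//; case: hq => _ _ ->; rewrite mulr1.
have b1 : bmf (fun a : borel A => tilt e s a * (ln (tilt e s a) - ln (p s a))) by apply: bmfM => //; exact: bmfB.
rewrite ger0_norm ?(kl_cost_ge0 hq hp)// -[leRHS]q1; apply: le_rint => //; first exact: bmfZ.
move=> a; rewrite mulrC ler_wpM2r ?(density_ge0 hq)//.
by have [_ _ _ h] := tilt_estimate s a; apply: le_trans (ler_norm _) h.
Qed.

Lemma tilt_soft_q_close x :
  `|soft_q P r gamma tau (tilt e) Wq x - soft_q P r gamma tau p Wp x| <= (5 * tau + L) * (e * K).
Proof.
have bW : bmf (fun s => Wq s - Wp s) by exact: bmfB.
have -> : soft_q P r gamma tau (tilt e) Wq x - soft_q P r gamma tau p Wp x =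
    - (tau * (ln (tilt e x.1 x.2) - ln (p x.1 x.2))) + gamma * rint (P x) (fun s => Wq s - Wp s).
  by rewrite /soft_q /reg_reward rintB ?P_prob ?ltry//; ring.
apply: le_trans (ler_normD _ _) _; rewrite mulrDl normrN; apply: lerD.
  have [_ _ _ h] := tilt_estimate x.1 x.2.
  rewrite normrM (ger0_norm htau) (_ : 5 * tau * (e * K) = tau * (5 * (e * K))); last by ring.
  exact: ler_wpM2l.
rewrite normrM (ger0_norm g0) -[leRHS]mul1r; apply: ler_pM => //; first exact: ltW.
have fP : (P x setT < +oo)%E by rewrite P_prob ltry.
have := rint_abs_le fP bW (M := L * (e * K)); rewrite P_prob mulr1; apply => s.
by rewrite distrC; exact: tilt_value_close.
Qed.

Lemma tilt_performance :
  (1 - gamma)^-1 * (e * rint (occ_prob P hgamma rho hp)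
    (fun s => rint mu (fun a => soft_q P r gamma tau p Wp (s, a) *
       (D (s, a) - tilt_mean s) * p s a)) -
    (16 * M + 6 * (5 * tau + L)) * (e * K) ^+ 2) <=
  rint rho Wq - rint rho Wp.
Proof.
have hq := good_tilt.
apply: le_trans (performance_lower hgamma htau hr rho hp hq hWp hWq EWp EWq).
rewrite ler_wpM2l ?invr_ge0 ?subr_ge0 ?(ltW g1)//.
have bB := bmf_soft_q P gamma tau hr hp hWp; have bB' := bmf_soft_q P gamma tau hr hq hWq.
have [qq _ _] := hq.
have bm : bmf (fun x : borel S * borel A => tilt_mean x.1).
  by apply: bmf_comp measurable_fst; exact: (bmf_fiber mu (bmfM hD pp)).
have b1 : bmf (fun x => soft_q P r gamma tau p Wp x * (D x - tilt_mean x.1) * p x.1 x.2).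
  by apply: bmfM => //; apply: bmfM => //; exact: bmfB.
have b2 : bmf (fun x => soft_q P r gamma tau (tilt e) Wq x * (tilt e x.1 x.2 - p x.1 x.2)).
  by apply: bmfM => //; exact: bmfB.
have bf1 := bmf_fiber mu b1; have bf2 := bmf_fiber mu b2.
set C := 16 * M + _; pose o := occ_prob P hgamma rho hp.
rewrite -(rintZ (prob_fin o))// -[C * _](rint_pcst o) -(rintB (prob_fin o)); last 2 first.
- exact: bmfZ.
- exact: bmf_cst.
apply: le_rint => //.
- exact: prob_fin.
- by apply: bmfB; [exact: bmfZ|exact: bmf_cst].
move=> s; have b1s := bmf_act s b1; have b2s := bmf_act s b2.
have EC : rint mu (fun a => C * (e * K) ^+ 2 * p s a) = C * (e * K) ^+ 2.
  by rewrite rintZ// p1 mulr1.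
rewrite -EC -rintZ// -rintB//; [|exact: bmfZ..].
apply: le_rint => //; first by apply: bmfB; exact: bmfZ.
move=> a /=; have [_ h1 h2 _] := tilt_estimate s a; have h3 := tilt_soft_q_close (s, a).
have := BM (s, a); have p0 := density_ge0 hp s a.
set B' := soft_q _ _ _ _ (tilt e) _ _ in h3 *; set B := soft_q _ _ _ _ p _ _ in h3 *.
set q := tilt e s a in h1 h2 *; set x := p s a in h1 h2 p0 *; set z := D (s, a) - _ in h1 *.
move=> hB.
(* The first-order term plus two errors of order [(e * K) ^+ 2]: the second-order remainder of the
   tilt, weighted by the old action values, and the product of the changes of action value and
   density. *)
have -> : B' * (q - x) = e * (B * z * x) + (B * (q - x - e * z * x) + (B' - B) * (q - x)) by ring.
rewrite lerD2l lerNl opprD; apply: le_trans (ler_norm _) _.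
apply: le_trans (ler_normD _ _) _; rewrite !normrN.
have -> : C * (e * K) ^+ 2 * x =
    M * (16 * (e * K) ^+ 2 * x) + (5 * tau + L) * (e * K) * (6 * (e * K) * x).
  by rewrite /C; ring.
by apply: lerD; rewrite normrM; apply: ler_pM.
Qed.

End small.
End tilted_policy.

(** * Mixtures of parameter laws *)

Section mixture.
Context d (T : measurableType d) (R : realType).
Local Open Scope ereal_scope.

Lemma posfunZ (c : R) (F : (T -> \bar R) -> \bar R) : (0 <= c)%R -> posfun F ->
  posfun (fun f => c%:E * F f).
Proof.
move=> c0 [F0 FD FZ Fle Flim].
split => [f hf|f g hf hg|k f k0 hf|f g hf hg fg|h hh ndh].
- by rewrite mule_ge0// F0.
- by rewrite FD// ge0_muleDr//; exact: F0.
- by rewrite FZ// muleCA.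
- by rewrite lee_wpmul2l// Fle.
- rewrite Flim// limeMl//; apply: ereal_nondecreasing_is_cvgn => a b ab.
  by apply: Fle => // y; exact: ndh.
Qed.

Lemma posfunD (F G : (T -> \bar R) -> \bar R) : posfun F -> posfun G ->
  posfun (fun f => F f + G f).
Proof.
move=> [F0 FD FZ Fle Flim] [G0 GD GZ Gle Glim].
split => [f hf|f g hf hg|k f k0 hf|f g hf hg fg|h hh ndh].
- by rewrite adde_ge0 ?F0 ?G0.
- by rewrite FD// GD// addeACA.
- by rewrite FZ// GZ// ge0_muleDr// ?F0// G0.
- by rewrite leeD// ?Fle// Gle.
- have cF : cvgn (fun n => F (h n)).
    by apply: ereal_nondecreasing_is_cvgn => a b ab; apply: Fle => // y; exact: ndh.
  have cG : cvgn (fun n => G (h n)).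
    by apply: ereal_nondecreasing_is_cvgn => a b ab; apply: Gle => // y; exact: ndh.
  rewrite Flim// Glim// -limeD//; apply: ge0_adde_def; rewrite inE.
    by apply: lime_ge => //; apply: nearW => n; exact: F0.
  by apply: lime_ge => //; apply: nearW => n; exact: G0.
Qed.

Variables (e : R) (nu nu' : probability T R).
Hypothesis he : (0 <= e <= 1)%R.

Let e0 : (0 <= e)%R. Proof. by case/andP: he. Qed.
Let e1 : (0 <= 1 - e)%R. Proof. by rewrite subr_ge0; case/andP: he. Qed.

Definition mix_posfun := posfunD (posfunZ e1 (posfun_integral nu)) (posfunZ e0 (posfun_integral nu')).

Lemma mix_setT : meas_posfun mix_posfun setT = 1.
Proof.
have n1 : (nu : {measure set T -> \bar R}) setT = 1 by exact: probability_setT.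
have n1' : (nu' : {measure set T -> \bar R}) setT = 1 by exact: probability_setT.
rewrite [LHS](mposfunE mix_posfun)// !integral_indic// setIT n1 n1' !mule1.
by rewrite -EFinD subrK.
Qed.

Definition mix_prob : probability T R := mkprob mix_setT.

Lemma integral_mix_prob f : nnmfun f ->
  \int[mix_prob]_x f x = (1 - e)%:E * \int[nu]_x f x + e%:E * \int[nu']_x f x.
Proof. by move=> hf; rewrite -(integral_posfun mix_posfun hf). Qed.

Lemma mix_probE B : measurable B -> mix_prob B = (1 - e)%:E * nu B + e%:E * nu' B.
Proof.
by move=> mB; rewrite [LHS](mposfunE mix_posfun)// !integral_indic// setIT.
Qed.

Lemma rint_mix_prob (h : T -> R) : bmf h ->
  rint mix_prob h = ((1 - e) * rint nu h + e * rint nu' h)%R.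
Proof.
move=> hh; have [M M0 hM] := bmf_shift hh.
have hhM : bmf (fun x => h x + M)%R by apply: bmfD => //; exact: bmf_cst.
have E (m : probability T R) : rint m (fun x => h x + M)%R = (rint m h + M)%R.
  by rewrite (rintD (prob_fin m) hh (bmf_cst _ _)) rint_pcst.
have := integral_mix_prob (bmf_nnmfun hhM hM).
rewrite (rintE (prob_fin mix_prob) hhM) (rintE (prob_fin nu) hhM) (rintE (prob_fin nu') hhM) !E.
rewrite -!EFinM -EFinD => -[] H; apply: (@addIr _ M); rewrite H; ring.
Qed.

End mixture.

(** * Softmax policies of bounded features *)

Section mean_field_softmax.
Context {R : realType} {S A : ptopologicalType} {d : nat}.
Variables (P : R.-pker (borel S * borel A)%type ~> borel S) (r : S -> A -> R).
Variables (gamma tau : R) (mu : {finite_measure set (borel A) -> \bar R}).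
Hypothesis hgamma : 0 <= gamma < 1.
Hypothesis htau : 0 <= tau.
Hypothesis hr : bmf (fun x : borel S * borel A => r x.1 x.2).
Hypothesis mu_gt0 : (0 < mu setT)%E.
Variable rho : probability (borel S) R.
Notation Theta := (borel 'rV[R]_d).
Notation F3 f := (fun x : Theta * (borel S * borel A) => f x.1 x.2.1 x.2.2).

Let fmu : (mu setT < +oo)%E := fin_mu mu.

Section bounded.
Variables (f : 'rV[R]_d -> S -> A -> R) (K : R).
Hypotheses (bf : bmf (F3 f)) (fK : forall t s a, `|f t s a| <= K).

Lemma bmf_logits nu : bmf (fun x : borel S * borel A => logits f nu x.1 x.2).
Proof. exact: (bmf_rint2 nu bf). Qed.

Lemma bmf_theta s a : bmf (fun t : Theta => f t s a).
Proof. exact: (bmf_pair2 (s : borel S, a : borel A) bf). Qed.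

Lemma logits_le nu s a : `|logits f nu s a| <= K.
Proof. by apply: rint_pabs_le => // ; exact: bmf_theta. Qed.

Definition partition_fun nu s : R := rint mu (fun a : borel A => expR (logits f nu s a)).

Lemma bmf_exp_logits nu : bmf (fun x : borel S * borel A => expR (logits f nu x.1 x.2)).
Proof. by apply: bmf_expR; exact: bmf_logits. Qed.

Lemma bmf_partition nu : bmf (partition_fun nu : borel S -> R).
Proof. exact: (bmf_fiber mu (bmf_exp_logits nu)). Qed.

Let mumass : 0 < fine (mu setT).
Proof. by rewrite fine_gt0// mu_gt0. Qed.

Lemma partition_ge nu s : expR (- K) * fine (mu setT) <= partition_fun nu s.
Proof.
rewrite -rint_cst//; apply: le_rint => //; first exact: bmf_cst.
  exact: (bmf_act s (bmf_exp_logits nu)).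
by move=> a; rewrite ler_expR; have := logits_le nu s a; rewrite ler_norml => /andP[].
Qed.

Lemma partition_gt0 nu s : 0 < partition_fun nu s.
Proof. by apply: lt_le_trans (partition_ge nu s); rewrite mulr_gt0// expR_gt0. Qed.

Lemma bmf_partitionV nu : bmf (fun s : borel S => (partition_fun nu s)^-1).
Proof.
split; first by apply: measurable_funV_pos => [|s]; [case: (bmf_partition nu)|exact: partition_gt0].
exists (expR (- K) * fine (mu setT))^-1 => s.
rewrite ger0_norm ?invr_ge0 ?(ltW (partition_gt0 _ _))//.
by rewrite lef_pV2 ?posrE ?mulr_gt0 ?expR_gt0 ?partition_gt0// partition_ge.
Qed.

Lemma good_softmax nu : good_density mu (softmax mu f nu).
Proof.
split.
- apply: (bmfM (bmf_exp_logits nu)).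
  exact: (bmf_comp (bmf_partitionV nu) measurable_fst).
- have [_ [N hN]] := bmf_partition nu.
  have N0 : 0 < N by apply: lt_le_trans (partition_gt0 nu point) _; exact: le_trans (ler_norm _) (hN _).
  exists (expR (- K) * N^-1); first by rewrite mulr_gt0 ?expR_gt0 ?invr_gt0.
  move=> s a; apply: ler_pM; rewrite ?expR_ge0 ?invr_ge0 ?(ltW N0)//.
    by rewrite ler_expR; have := logits_le nu s a; rewrite ler_norml => /andP[].
  by rewrite lef_pV2 ?posrE ?partition_gt0//; apply: le_trans (ler_norm _) (hN s).
- move=> s; rewrite /softmax -/(partition_fun nu s).
  under eq_fun do rewrite mulrC.
  rewrite rintZ//; last exact: (bmf_act s (bmf_exp_logits nu)).
  by rewrite -/(partition_fun nu s) mulVf// gt_eqF// partition_gt0.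
Qed.

(** Logits are affine in the parameter law, and the partition function of [nu] cancels against the
    normalization of the tilt. *)
Lemma softmax_mix nu nu' e (he : 0 <= e <= 1) s a : softmax mu f (mix_prob nu nu' he) s a =
  tilt mu (softmax mu f nu) (fun x => logits f nu' x.1 x.2 - logits f nu x.1 x.2) e s a.
Proof.
have lE b : logits f (mix_prob nu nu' he) s b =
    logits f nu s b + e * (logits f nu' s b - logits f nu s b).
  by rewrite /logits (rint_mix_prob nu nu' he (bmf_theta s b)); ring.
have Z0 := partition_gt0 nu s.
have tE b : softmax mu f nu s b * expR (e * (logits f nu' s b - logits f nu s b)) =
    (partition_fun nu s)^-1 * expR (logits f (mix_prob nu nu' he) s b).
  by rewrite lE expRD /softmax -/(partition_fun nu s); ring.
rewrite /tilt /tilt_mass /= mulrA tE; under eq_rint do rewrite tE.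
rewrite rintZ//; last exact: (bmf_act s (bmf_exp_logits _)).
by rewrite invfM invrK mulrACA mulVf ?mul1r// gt_eqF.
Qed.

Section derivative.
Variables (nu : probability Theta R) (W : borel S -> R).
Let p := softmax mu f nu.
Let hp : good_density mu p := good_softmax nu.
Hypotheses (hW : bmf W) (EW : bellman P r gamma tau mu p W).
Let B := soft_q P r gamma tau p W.
Let o := occ_prob P hgamma rho hp.

Let bB : bmf B. Proof. exact: (bmf_soft_q P gamma tau hr hp hW). Qed.
Let bp : bmf (fun x : borel S * borel A => p x.1 x.2). Proof. by case: hp. Qed.

(* The linear functional derivative in terms of the candidate value function W. *)
Definition lin_deriv (t : 'rV[R]_d) : R := (1 - gamma)^-1 *
  rint o (fun s => rint mu (fun a => B (s, a) *
    (f t s a - rint mu (fun b : borel A => f t s b * p s b)) * p s a)).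

Let G (y : Theta * (borel S * borel A)) : R := B y.2 *
  (f y.1 y.2.1 y.2.2 - rint mu (fun b : borel A => f y.1 y.2.1 b * p y.2.1 b)) * p y.2.1 y.2.2.

Let b_mean : bmf (fun y : Theta * borel S => rint mu (fun b : borel A => f y.1 y.2 b * p y.2 b)).
Proof.
have m1 : measurable_fun setT (fun z : (Theta * borel S) * borel A => (z.1.1, (z.1.2, z.2))).
  apply: measurable_fun_pair; first exact: (measurableT_comp measurable_fst measurable_fst).
  apply: measurable_fun_pair; last exact: measurable_snd.
  exact: (measurableT_comp measurable_snd measurable_fst).
have m2 : measurable_fun setT (fun z : (Theta * borel S) * borel A => (z.1.2, z.2)).
  apply: measurable_fun_pair; last exact: measurable_snd.
  exact: (measurableT_comp measurable_snd measurable_fst).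
exact: (bmf_rint1 mu (bmfM (bmf_comp bf m1) (bmf_comp bp m2))).
Qed.

Let bG : bmf G.
Proof.
have m1 : measurable_fun setT (fun y : Theta * (borel S * borel A) => (y.1, y.2.1)).
  apply: measurable_fun_pair; first exact: measurable_fst.
  exact: (measurableT_comp measurable_fst measurable_snd).
exact: (bmfM (bmfM (bmf_comp bB measurable_snd) (bmfB bf (bmf_comp b_mean m1)))
  (bmf_comp bp measurable_snd)).
Qed.

Let bGs : bmf (fun z : (Theta * borel S) * borel A => G (z.1.1, (z.1.2, z.2))).
Proof.
apply: bmf_comp bG _.
apply: measurable_fun_pair; first exact: (measurableT_comp measurable_fst measurable_fst).
apply: measurable_fun_pair; last exact: measurable_snd.
exact: (measurableT_comp measurable_snd measurable_fst).
Qed.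

Let bGi : bmf (fun z : Theta * borel S => rint mu (fun a => G (z.1, (z.2, a)))).
Proof. exact: (bmf_rint1 mu bGs). Qed.

(** The features enter linearly, so Fubini moves the average over parameters inside and replaces
    them by logits. *)
Lemma rint_lin_deriv (m : probability Theta R) : rint m lin_deriv = (1 - gamma)^-1 *
  rint o (fun s => rint mu (fun a => B (s, a) *
    (logits f m s a - rint mu (fun b : borel A => logits f m s b * p s b)) * p s a)).
Proof.
rewrite /lin_deriv (rintZ (prob_fin m)); last exact: (bmf_rint1 o bGi).
congr (_ * _); rewrite (rint_fubini m o bGi); apply: eq_rint => s /=.
have bGs2 : bmf (fun z : Theta * borel A => G (z.1, (s, z.2))).
  apply: bmf_comp bG _; apply: measurable_fun_pair; first exact: measurable_fst.
  apply: measurable_fun_pair; [exact: measurable_cst|exact: measurable_snd].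
rewrite (rint_fubini m mu bGs2); apply: eq_rint => a /=; rewrite /G /=.
have bt : bmf (fun t : Theta => f t s a) := bmf_theta s a.
have bm : bmf (fun t : Theta => rint mu (fun b : borel A => f t s b * p s b)) :=
  bmf_pair2 (s : borel S) b_mean.
rewrite (_ : (fun t => _) = fun t : Theta =>
  (B (s, a) * p s a) * (f t s a - rint mu (fun b : borel A => f t s b * p s b))); last first.
  by apply/funext => t; ring.
rewrite (rintZ (prob_fin m) _ (bmfB bt bm)) (rintB (prob_fin m) bt bm).
have bfp : bmf (fun z : Theta * borel A => f z.1 s z.2 * p s z.2).
  apply: bmfM; last exact: (bmf_comp (density_bmf hp s) measurable_snd).
  apply: (bmf_comp bf (g := fun z : Theta * borel A => (z.1, (s : borel S, z.2)))).
  apply: measurable_fun_pair; first exact: measurable_fst.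
  apply: measurable_fun_pair; [exact: measurable_cst|exact: measurable_snd].
rewrite (rint_fubini m mu bfp) /= [RHS]mulrAC; congr (_ * (_ - _)).
apply: eq_rint => b; rewrite -[RHS]mulrC -(rintZ (prob_fin m) _ (bmf_theta s b)).
by apply: eq_rint => t; rewrite mulrC.
Qed.

(** The right-hand side is the first-order term of [tilt_performance] for [D] the difference of
    logits. *)
Lemma lin_deriv_diff (m m' : probability Theta R) :
  rint m' lin_deriv - rint m lin_deriv = (1 - gamma)^-1 *
  rint o (fun s => rint mu (fun a => B (s, a) *
    ((logits f m' s a - logits f m s a) -
     tilt_mean mu p (fun x => logits f m' x.1 x.2 - logits f m x.1 x.2) s) * p s a)).
Proof.
rewrite !rint_lin_deriv -mulrBr; congr (_ * _).
have bl (k : probability Theta R) : bmf (fun x : borel S * borel A => B x *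
    (logits f k x.1 x.2 - rint mu (fun b : borel A => logits f k x.1 b * p x.1 b)) * p x.1 x.2).
  apply: bmfM => //; apply: bmfM => //; apply: bmfB; first exact: bmf_logits.
  exact: (bmf_comp (bmf_fiber mu (bmfM (bmf_logits k) bp)) measurable_fst).
have bi (k : probability Theta R) := bmf_fiber mu (bl k).
rewrite -(rintB (prob_fin o) (bi m') (bi m)); apply: eq_rint => s /=.
rewrite -(rintB fmu (bmf_act s (bl m')) (bmf_act s (bl m))); apply: eq_rint => a /=.
rewrite /tilt_mean.
have bx (k : probability Theta R) : bmf (fun b : borel A => logits f k s b * p s b).
  exact: (bmf_act s (bmfM (bmf_logits k) bp)).
under [in RHS]eq_rint do rewrite mulrBl.
rewrite (rintB fmu (bx m') (bx m)); ring.
Qed.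

Lemma value_mix_lower (nu' : probability Theta R) : exists2 C : R, 0 <= C &
  exists2 e1 : R, 0 < e1 <= 1 & forall (e : R) (he : 0 <= e <= 1) Wq, e <= e1 -> bmf Wq ->
    bellman P r gamma tau mu (softmax mu f (mix_prob nu nu' he)) Wq ->
    e * (rint nu' lin_deriv - rint nu lin_deriv) - C * e ^+ 2 <= rint rho Wq - rint rho W.
Proof.
pose D (x : borel S * borel A) := logits f nu' x.1 x.2 - logits f nu x.1 x.2.
have bD : bmf D by apply: bmfB; exact: bmf_logits.
have K0 : 0 <= K by exact: le_trans (normr_ge0 _) (fK point point point).
have DK x : `|D x| <= 2 * K.
  rewrite /D (le_trans (ler_normB _ _))// mulr_natl mulr2n.
  by apply: lerD; exact: logits_le.
have [_ [M hM]] := bB; have M0 : 0 <= M by exact: le_trans (normr_ge0 _) (hM point).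
have [g0 g1] := andP hgamma.
set L := (6 * M + 5 * tau) / (1 - gamma).
have L0 : 0 <= L by rewrite divr_ge0 ?subr_ge0 ?(ltW g1)// addr_ge0// mulr_ge0.
exists ((1 - gamma)^-1 * ((16 * M + 6 * (5 * tau + L)) * (2 * K) ^+ 2)).
  by rewrite mulr_ge0 ?invr_ge0 ?subr_ge0 ?(ltW g1)// mulr_ge0 ?sqr_ge0// addr_ge0 ?mulr_ge0// addr_ge0// mulr_ge0.
(* The logits differ by at most [2 * K], and the tilt estimates ask for [e * (2 * K) <= 4^-1]. The
   summand 1 covers [K = 0] and keeps the threshold below 1. *)
exists (4 * (2 * K + 1))^-1.
  rewrite invr_gt0 mulr_gt0//=; last by lra.
  by rewrite invf_le1; lra.
move=> e he Wq ee1 bWq EWq; have [e0 _] := andP he.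
have eK : e * (2 * K) <= 4^-1.
  apply: (@le_trans _ _ ((4 * (2 * K + 1))^-1 * (2 * K))).
    by rewrite ler_wpM2r// mulr_ge0.
  have K1 : 0 < 2 * K + 1 by lra.
  by rewrite mulrC ler_pdivrMr ?mulr_gt0// mulrA mulVf// mul1r; lra.
have pE : softmax mu f (mix_prob nu nu' he) = tilt mu p D e.
  by apply/funext => s; apply/funext => a; exact: softmax_mix.
rewrite pE in EWq.
have := tilt_performance hgamma htau hr rho hp bD DK e0 eK hW bWq EW EWq hM.
apply: le_trans; rewrite lin_deriv_diff -/p -/B -/o -/L mulrBr.
rewrite le_eqVlt; apply/orP; left; apply/eqP; rewrite /tilt_mean /D /=; ring.
Qed.

End derivative.

End bounded.

End mean_field_softmax.

(** For unbounded [h] the positive and negative parts are treated separately by Tonelli, and their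
    difference is measurable whatever the integrability. *)
Lemma measurable_rint2 d d' (X : measurableType d) (Y : measurableType d') (R : realType)
    (m : {finite_measure set X -> \bar R}) (h : X * Y -> R) :
  measurable_fun setT h -> measurable_fun setT (fun y => rint m (fun x => h (x, y))).
Proof.
move=> mh; have mE : measurable_fun setT (fun z => (h z)%:E) by exact/measurable_EFinP.
apply: measurableT_comp => //.
rewrite (_ : (fun y => _) = fun y =>
  (fubini_G m (fun z => (h z)%:E)^\+ y - fubini_G m (fun z => (h z)%:E)^\- y)%E); last first.
  apply/funext => y; rewrite [LHS]integralE /fubini_G; congr (_ - _)%E; apply: eq_integral => x _;
    by rewrite ?funeposE ?funenegE.
apply: emeasurable_funB; apply: measurable_fun_fubini_tonelli_G => //.
  exact: measurable_funepos.
exact: measurable_funeneg.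
Qed.

Lemma ae_imp d (T : measurableType d) (R : realType)
    (m : {measure set T -> \bar R}) (Q Q' : T -> Prop) :
  (forall a, Q a -> Q' a) -> (\forall a \ae m, Q a) -> \forall a \ae m, Q' a.
Proof. by move=> QQ' h; apply: filterS h. Qed.

Lemma ae_imp2 d (T : measurableType d) (R : realType)
    (m : {measure set T -> \bar R}) (Q1 Q2 Q' : T -> Prop) :
  (forall a, Q1 a -> Q2 a -> Q' a) ->
  (\forall a \ae m, Q1 a) -> (\forall a \ae m, Q2 a) -> \forall a \ae m, Q' a.
Proof. by move=> QQ h1 h2; apply: filterS2 h1 h2. Qed.

Section occupancy_ext.
Context {R : realType} {S A : ptopologicalType}.
Variables (P : R.-pker (borel S * borel A)%type ~> borel S) (gamma : R).
Variables (mu : {finite_measure set (borel A) -> \bar R}) (rho : probability (borel S) R).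
Variables p q : S -> A -> R.
Hypothesis pq : forall s B, measurable B -> policy mu p s B = policy mu q s B.

Lemma occupancy_at_ext : occupancy_at P gamma mu p rho = occupancy_at P gamma mu q rho.
Proof.
have sk s : state_kernel P mu p s = state_kernel P mu q s.
  by apply/funext => B; exact: eq_setfun_integral (pq s).
have ski n s B : state_kernel_iter P mu p n s B = state_kernel_iter P mu q n s B.
  elim: n s B => [|n ih] s B; simpl; first reflexivity.
  have E : (fun x => state_kernel_iter P mu p n x B) = (fun x => state_kernel_iter P mu q n x B).
    by apply/funext => x; exact: ih.
  exact: (congr2 (fun m h => (\int[m]_x h x)%E) (sk s) E).
have sE : state_kernel_iter P mu p = state_kernel_iter P mu q.
  by apply/funext => n; apply/funext => s; apply/funext => B; exact: ski.
have oE : occupancy P gamma mu p = occupancy P gamma mu q by rewrite /occupancy sE.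
by rewrite /occupancy_at oE.
Qed.

End occupancy_ext.

(** * Features known only for almost every action *)

Section softmax_transfer.
Context {R : realType} {S A : ptopologicalType} {d : nat}.
Variables (P : R.-pker (borel S * borel A)%type ~> borel S) (r : S -> A -> R).
Variables (gamma tau : R) (mu : {finite_measure set (borel A) -> \bar R}).
Hypothesis hgamma : 0 <= gamma < 1.
Hypothesis htau : 0 <= tau.
Hypothesis hr : bmf (fun x : borel S * borel A => r x.1 x.2).
Hypothesis mu_gt0 : (0 < mu setT)%E.
Variable rho : probability (borel S) R.
Notation Theta := (borel 'rV[R]_d).
Notation F3 f := (fun x : Theta * (borel S * borel A) => f x.1 x.2.1 x.2.2).
Variables (f g : 'rV[R]_d -> S -> A -> R) (K : R).
Hypotheses (mf : measurable_fun setT (F3 f)) (bg : bmf (F3 g)).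
Hypothesis gK : forall t s a, `|g t s a| <= K.
Hypothesis fg : forall s, \forall a \ae mu, forall t, f t s a = g t s a.

Let fmu : (mu setT < +oo)%E := fin_mu mu.

Lemma measurable_logits nu : measurable_fun setT (fun x : borel S * borel A => logits f nu x.1 x.2).
Proof. exact: (measurable_rint2 nu mf). Qed.

Lemma ae_logits nu s : \forall a \ae mu, logits f nu s a = logits g nu s a.
Proof.
by apply: ae_imp (fg s) => a E; rewrite /logits; apply: eq_rint => t; exact: E.
Qed.

Lemma partition_transfer nu s :
  rint mu (fun a' : borel A => expR (logits f nu s a')) = partition_fun mu g nu s.
Proof.
apply: ae_eq_rint => //.
- apply: measurableT_comp => //.
  exact: (measurableT_comp (measurable_logits nu) (measurable_pair1 (s : borel S))).
- by case: (bmf_act s (bmf_exp_logits bg nu)).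
- by apply: ae_imp (ae_logits nu s) => a ->.
Qed.

Lemma measurable_softmax nu :
  measurable_fun setT (fun x : borel S * borel A => softmax mu f nu x.1 x.2).
Proof.
rewrite /softmax; under eq_fun do rewrite partition_transfer.
apply: measurable_funM; first by apply: measurableT_comp => //; exact: measurable_logits.
have [m1 _] := bmf_partitionV mu_gt0 bg gK nu.
exact: (measurableT_comp m1 measurable_fst).
Qed.

Lemma ae_softmax nu s : \forall a \ae mu, softmax mu f nu s a = softmax mu g nu s a.
Proof.
by apply: ae_imp (ae_logits nu s) => a E; rewrite /softmax partition_transfer E.
Qed.

Lemma value_softmax nu W : bmf W -> bellman P r gamma tau mu (softmax mu g nu) W ->
  value P r gamma tau mu (softmax mu f nu) = W.
Proof.
move=> hW EW; have hp := good_softmax mu_gt0 bg gK nu.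
apply: (value_bellman hgamma hr hp (measurable_softmax nu) (ae_softmax nu) _ hW EW) => s0.
exact: (trajectory_exists hp P s0).
Qed.

Lemma policy_transfer nu s B : measurable B ->
  policy mu (softmax mu f nu) s B = policy mu (softmax mu g nu) s B.
Proof.
move=> mB; rewrite /policy; apply: ae_eq_integral => //.
- apply: measurable_funTS; apply/measurable_EFinP.
  exact: (measurableT_comp (measurable_softmax nu) (measurable_pair1 (s : borel S))).
- apply: measurable_funTS; apply/measurable_EFinP.
  by case: (density_bmf (good_softmax mu_gt0 bg gK nu) s).
- by apply: ae_imp (ae_softmax nu s) => a -> _.
Qed.

(** The features occur in [dJ] directly, in the policy, in the logarithm and in the action values;
    all are seen through integrals over actions at a fixed state, where [f] may be exchanged for
    [g]. *)
Lemma dJ_lin_deriv nu W (hW : bmf W) (EW : bellman P r gamma tau mu (softmax mu g nu) W) t :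
  dJ P r gamma tau mu f rho nu t = lin_deriv P r tau hgamma mu_gt0 rho bg gK nu W t.
Proof.
have hp := good_softmax mu_gt0 bg gK nu.
rewrite /dJ /lin_deriv (occupancy_at_ext P gamma rho (policy_transfer nu)); congr (_ * _).
rewrite (rint_occ_prob P hgamma rho (good_softmax mu_gt0 bg gK nu)).
apply: eq_rint => s.
have mta : measurable_fun setT (fun a : borel A => (t : Theta, (s : borel S, a))).
  apply: measurable_fun_pair; [exact: measurable_cst|exact: measurable_pair1].
have ft : measurable_fun setT (fun a : borel A => f t s a).
  exact: (measurableT_comp mf mta).
have gt : bmf (fun a : borel A => g t s a).
  exact: (bmf_comp bg mta).
have mean : rint (policy mu (softmax mu f nu) s) (fun a' : borel A => f t s a') =
    rint mu (fun b : borel A => g t s b * softmax mu g nu s b).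
  rewrite (eq_setfun_rint _ (policy_transfer nu s)) (rint_policy hp)//.
  have bps := density_bmf hp s.
  apply: ae_eq_rint => //.
  - by apply: measurable_funM => //; case: bps.
  - by case: (bmfM gt bps).
  - by apply: ae_imp (fg s) => a ->.
have msm := measurableT_comp (measurable_softmax nu) (measurable_pair1 (s : borel S)).
have mP : measurable_fun setT (fun a : borel A => rint (P (s, a)) W).
  by case: (bmf_act s (bmf_P P hW)).
have mr : measurable_fun setT (fun a : borel A => r s a) by case: (bmf_act s hr).
set F := rint mu (fun b => g t s b * softmax mu g nu s b) in mean *.
transitivity (rint (policy mu (softmax mu g nu) s) (fun a : borel A =>
   (qvalue P r gamma tau mu (softmax mu f nu) s a - tau * ln (softmax mu f nu s a)) *
   (f t s a - F))).
  by rewrite -mean; exact: (eq_setfun_rint _ (policy_transfer nu s)).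
have mG : measurable_fun setT (fun a : borel A =>
   (qvalue P r gamma tau mu (softmax mu f nu) s a - tau * ln (softmax mu f nu s a)) *
   (f t s a - F)).
  rewrite /qvalue (value_softmax hW EW).
  apply: measurable_funM; last exact: measurable_funB.
  apply: measurable_funB; first by apply: measurable_funD => //; exact: measurable_funM.
  by apply: measurable_funM => //; exact: measurableT_comp.
rewrite (rint_policy hp)//.
have [bps _] := density_bmf hp s.
apply: ae_eq_rint.
- exact: measurable_funM.
- apply: measurable_funM => //; apply: measurable_funM.
    by case: (bmf_act s (bmf_soft_q P gamma tau hr hp hW)).
  by apply: measurable_funB => //; case: gt.
- apply: (ae_imp2 _ (fg s) (ae_softmax nu s)) => a -> ->.
  rewrite /qvalue (value_softmax hW EW) /soft_q /reg_reward /=; ring.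
Qed.

Lemma value_at_mix (nu nu' : probability Theta R) : exists2 C : R, 0 <= C &
  exists2 e1 : R, 0 < e1 <= 1 & forall (e : R) (he : 0 <= e <= 1), e <= e1 ->
    e * (rint nu' (dJ P r gamma tau mu f rho nu) - rint nu (dJ P r gamma tau mu f rho nu)) - C * e ^+ 2 <=
    value_at P r gamma tau mu (softmax mu f (mix_prob nu nu' he)) rho -
    value_at P r gamma tau mu (softmax mu f nu) rho.
Proof.
have [W hW EW] := bellman_exists P tau hgamma hr (good_softmax mu_gt0 bg gK nu).
have [C C0 [e1 he1 h]] := value_mix_lower hgamma htau hr mu_gt0 rho bg gK hW EW nu'.
exists C => //; exists e1 => // e he ee1.
have [Wq hWq EWq] := bellman_exists P tau hgamma hr (good_softmax mu_gt0 bg gK (mix_prob nu nu' he)).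
have v1 := value_softmax hW EW; have v2 := value_softmax hWq EWq.
have a1 : value_at P r gamma tau mu (softmax mu f nu) rho = rint rho W by rewrite /value_at v1.
have a2 : value_at P r gamma tau mu (softmax mu f (mix_prob nu nu' he)) rho = rint rho Wq.
  by rewrite /value_at v2.
have := h e he Wq ee1 hWq EWq; rewrite -a1 -a2.
have -> : dJ P r gamma tau mu f rho nu = lin_deriv P r tau hgamma mu_gt0 rho bg gK nu W.
  by apply/funext => t; exact: dJ_lin_deriv.
by [].
Qed.

(** Centring the action values instead of the features gives the same covariance. The derivative
    becomes an average of [g t] with a weight free of [t], and so inherits the regularity of [g] in
    [t]. *)
Definition dJ_weight nu W (x : borel S * borel A) : R :=
  (soft_q P r gamma tau (softmax mu g nu) W x -
   rint mu (fun a => soft_q P r gamma tau (softmax mu g nu) W (x.1, a) * softmax mu g nu x.1 a)) *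
  softmax mu g nu x.1 x.2.

Lemma dJ_weightE nu : exists2 w : borel S * borel A -> R, bmf w &
  exists o : probability (borel S) R, forall t, dJ P r gamma tau mu f rho nu t =
    (1 - gamma)^-1 * rint o (fun s => rint mu (fun a => w (s, a) * g t s a)).
Proof.
have [W hW EW] := bellman_exists P tau hgamma hr (good_softmax mu_gt0 bg gK nu).
have hp := good_softmax mu_gt0 bg gK nu; have [bp _ _] := hp.
have bB := bmf_soft_q P gamma tau hr hp hW.
have bm : bmf (fun x : borel S * borel A =>
    rint mu (fun a => soft_q P r gamma tau (softmax mu g nu) W (x.1, a) * softmax mu g nu x.1 a)).
  exact: (bmf_comp (bmf_fiber mu (bmfM bB bp)) measurable_fst).
exists (dJ_weight nu W); first by apply: bmfM => //; exact: bmfB.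
exists (occ_prob P hgamma rho (good_softmax mu_gt0 bg gK nu)) => t.
rewrite (dJ_lin_deriv hW EW) /lin_deriv; congr (_ * _); apply: eq_rint => s.
have gt : bmf (fun a : borel A => g t s a).
  have mta : measurable_fun setT (fun a : borel A => (t : Theta, (s : borel S, a))).
    apply: measurable_fun_pair; [exact: measurable_cst|exact: measurable_pair1].
  exact: (bmf_comp bg mta).
have bBs := bmf_act s bB; have bps := density_bmf hp s.
rewrite /dJ_weight /=; set B := soft_q _ _ _ _ _ _ in bBs *; set q := softmax mu g nu in bps *.
set F := rint mu (fun b => g t s b * q s b); set m := rint mu (fun a => B (s, a) * q s a).
transitivity (rint mu (fun a => B (s, a) * g t s a * q s a) - F * m).
  rewrite /m -rintZ//; last exact: bmfM.
  rewrite -rintB//; last 2 first.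
  - by apply: bmfM => //; exact: bmfM.
  - by apply: bmfZ; exact: bmfM.
  by apply: eq_rint => a; ring.
rewrite mulrC /F -rintZ//; last exact: bmfM.
rewrite -rintB//; last 2 first.
- by apply: bmfM => //; exact: bmfM.
- by apply: bmfZ; exact: bmfM.
by apply: eq_rint => a; ring.
Qed.

End softmax_transfer.

(** * The Goldowsky-Tonelli theorem *)

Section goldowsky_tonelli.
Context {R : realType}.
Implicit Types (f h : R -> R) (a b c x y : R).

(** Let [s] be the supremum of the points where [h] is at least [h a]. The local condition on the
    left of [s] puts [s] among them, and the one on its right allows going further unless [s = b].
    Continuity plays no part, so the jumps of a measure are allowed. *)
Lemma locally_increasing_le h a b : a <= b ->
  (forall x, a <= x <= b -> exists2 delta, 0 < delta &
     forall y, a <= y <= b -> `|y - x| < delta -> 0 <= (h y - h x) * (y - x)) ->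
  h a <= h b.
Proof.
move=> ab loc; pose E := [set x | a <= x <= b /\ h a <= h x].
have Ea : E a by split; rewrite ?lexx.
have uE : ubound E b by move=> x [/andP[]].
have sE : has_sup E by split; [exists a|exists b].
have as_ : a <= sup E by exact: sup_upper_bound.
have sb : sup E <= b by apply: sup_le_ub => //; exists a.
have [|delta d0 Hd] := loc (sup E); first by rewrite as_.
have [x0 [/andP[ax0 x0b] hx0] sx0] := sup_adherent d0 sE.
have x0s : x0 <= sup E by apply: sup_upper_bound => //; split => //; rewrite ax0.
have hs : h a <= h (sup E).
  move: x0s; rewrite le_eqVlt => /predU1P[<-//|x0s].
  have := Hd x0; rewrite ax0 x0b ltr_norml => /(_ isT); nra.
move: sb; rewrite le_eqVlt => /predU1P[<-//|sb].
pose y := Num.min b (sup E + delta / 2).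
have sy : sup E < y by rewrite lt_min sb/=; lra.
have yb : y <= b by rewrite ge_min lexx.
have yd : y <= sup E + delta / 2 by rewrite ge_min lexx orbT.
have hy : h (sup E) <= h y.
  have := Hd y; rewrite (le_trans as_ (ltW sy)) yb ltr_norml => /(_ isT); nra.
have : y <= sup E.
  by apply: sup_upper_bound => //; split; [rewrite yb (le_trans as_ (ltW sy))|exact: le_trans hy].
by rewrite leNgt sy.
Qed.

Lemma derivable_slope_ge f x c : derivable f x 1 -> c < 'D_1 f x ->
  exists2 delta, 0 < delta &
    forall y, `|y - x| < delta -> 0 <= (f y - f x - c * (y - x)) * (y - x).
Proof.
move=> df cf.
have : \forall t \near (0 : R)^', c < t^-1 *: (f (t *: 1 + x) - f x).
  exact: (cvgr_gt _ df).
case=> delta /= d0 Hd; exists delta => // y yx.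
have [->|xy] := eqVneq y x; first by rewrite !subrr !mulr0.
have yx0 : y - x != 0 by rewrite subr_eq0.
have := Hd (y - x); rewrite /= sub0r normrN => /(_ yx yx0).
rewrite /GRing.scale /= mulr1 subrK => /ltW cq.
rewrite (_ : (_ - _) * _ = ((y - x)^-1 * (f y - f x) - c) * (y - x) ^+ 2); last by field.
by rewrite mulr_ge0 ?subr_ge0// sqr_ge0.
Qed.

Let leb : {measure set (measurableTypeR R) -> \bar R} := @lebesgue_measure R.

Lemma null_cover (N : set R) (e : R) : leb.-negligible N -> 0 < e ->
  exists G : nat -> set R, [/\ forall n, open (G n), forall n, N `<=` G n &
    (\sum_(0 <= n <oo) leb (G n) <= e%:E)%E].
Proof.
move=> /negligible_outer_measure N0 e0.
have e2 n : 0 < e / (2 ^ n.+1)%:R by rewrite divr_gt0// ltr0n expn_gt0.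
have /choice[G hG] n := outer_measure_open_le N (e2 n).
exists G; split=> [n|n|]; try by have [] := hG n.
apply: le_trans (epsilon_trick0 predT (ltW e0)).
by apply: lee_nneseries => // n _; have [_ _] := hG n; rewrite N0 add0e.
Qed.

Let mG (G : nat -> set R) (oG : forall n, open (G n)) n : measurable (G n : set (measurableTypeR R)) :=
  open_measurable (oG n).

(* [m] is the sum of the restrictions of Lebesgue measure to open sets shrinking to [N]:
   its density is infinite on [N], yet its mass is small. *)
Lemma null_weight (N : set R) (e : R) : leb.-negligible N -> 0 < e ->
  exists m : {measure set (measurableTypeR R) -> \bar R}, (m setT <= e%:E)%E /\
    forall x, N x -> forall k : nat, exists2 delta, 0 < delta & forall y z,
      y <= z -> ball x delta y -> ball x delta z -> ((k%:R * (z - y))%:E <= m `]y, z]%classic)%E.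
Proof.
move=> N0 e0; have [G [oG NG Ge]] := null_cover N0 e0.
pose m := mseries (fun n => mrestr leb (mG oG n)) 0%N.
exists m; split.
  by apply: le_trans Ge; apply: lee_nneseries => // n _; rewrite /= /mrestr setTI.
move=> x Nx k.
have [delta d0 Hd] : exists2 delta, 0 < delta & ball x delta `<=` \bigcap_(n < k) G n.
  elim: k => [|k [delta d0 Hd]]; first by exists 1 => // t _ n.
  have := open_nbhs_nbhs (conj (oG k) (NG k x Nx)); rewrite -nbhs_ballE => -[delta' /= d'0 Hd'].
  exists (Num.min delta delta'); first by rewrite lt_min d0.
  move=> t xt n /=; rewrite ltnS leq_eqVlt => /predU1P[->|nk].
    by apply: Hd'; apply: le_ball xt; rewrite ge_min lexx orbT.
  by apply: Hd => //; apply: le_ball xt; rewrite ge_min lexx.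
exists delta => // y z yz xy xz.
have sub n : (n < k)%N -> `]y, z] `<=` G n.
  move=> nk t /=; rewrite in_itv/= => /andP[yt tz]; apply: Hd => //.
  move: xy xz; rewrite /ball/= !ltr_distl; lra.
(* The interval lies in each of the first [k] sets [G n], so each of the first [k] terms contributes
   [z - y]. *)
rewrite /m /= /mseries (nneseries_split 0 k)//; apply: le_trans (leeDl _ _); last first.
  exact: nneseries_ge0.
rewrite add0n big_nat (eq_bigr (fun=> (z - y)%:E)) => [|n /andP[_ nk]].
  by rewrite -big_nat sumEFin sumr_const_nat subn0 mulr_natl.
transitivity (leb (`]y, z]%classic `&` G n)); first by [].
rewrite setIidl; last exact: sub.
transitivity (lebesgue_measure `]y, z]%classic); first by [].
by rewrite lebesgue_measure_itv/= lte_fin; case: ltgtP yz => // -> _; rewrite subrr.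
Qed.

(* Goldowsky-Tonelli: the derivative is not assumed integrable, so the fundamental
   theorem of calculus does not apply. *)
Lemma ae_derive_ge0_homo f : (forall x, derivable f x 1) ->
  (\forall x \ae leb, 0 <= 'D_1 f x) -> {homo f : a b / a <= b}.
Proof.
move=> df f0 a b ab; apply/ler_addgt0Pl => eps eps0.
(* The perturbation of [f] will cost [e * (b - a)] through a slope and at most [e] through a
   measure, together [eps]. *)
pose e := eps / (b - a + 1).
have ba : 0 < b - a + 1 by lra.
have e0 : 0 < e by rewrite divr_gt0.
have [m [me mN]] := null_weight f0 e0.
have fin B : measurable B -> m B \is a fin_num.
  move=> mB; rewrite ge0_fin_numE//; apply: le_lt_trans (ltry e); apply: le_trans me.
  by apply: le_measure; rewrite ?inE.
(* The slope [e] gives room for the local estimate where the derivative is nonnegative; on the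
   exceptional null set the mass of [m] outgrows any negative derivative. *)
pose h x := f x + e * x + fine (m `]a, x]%classic).
have h_inc x y : a <= x -> x <= y -> h y - h x = f y - f x + e * (y - x) + fine (m `]x, y]%classic).
  move=> ax xy; rewrite /h.
  have -> : fine (m `]a, y]%classic) = fine (m `]a, x]%classic) + fine (m `]x, y]%classic).
    rewrite -fineD ?fin//; congr fine; rewrite -measureU//.
      by rewrite -itv_bndbnd_setU ?bnd_simp.
    apply/seteqP; split => // t /=; rewrite !in_itv/=; lra.
  ring.
have : h a <= h b.
  apply: locally_increasing_le => // x /andP[ax xb].
  have [fx0|Nx] := pselect (0 <= 'D_1 f x).
    have [|delta d0 Hd] := @derivable_slope_ge f x (- e) (df x); first lra.
    exists delta => // y /andP[ay yb] xy; have := Hd y xy.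
    have [yx|yx] := leP x y.
      rewrite h_inc//; have : 0 <= fine (m `]x, y]%classic) by rewrite fine_ge0.
      nra.
    rewrite -(opprB (h x)) h_inc//; last exact: ltW.
    have : 0 <= fine (m `]y, x]%classic) by rewrite fine_ge0.
    nra.
  (* Increments of [f] near [x] have slope at least ['D_1 f x - 1], while [m] has density at least
     [k + 1] there, which exceeds the absolute value of that slope. *)
  pose k := Num.Def.truncn `|'D_1 f x - 1|; have kD : `|'D_1 f x - 1| < k.+1%:R by exact: truncnS_gt.
  have [delta d0 Hd] := mN x Nx k.+1.
  have [|delta' d'0 Hd'] := @derivable_slope_ge f x ('D_1 f x - 1) (df x); first lra.
  exists (Num.min delta delta'); first by rewrite lt_min d0.
  move=> y /andP[ay yb]; rewrite lt_min => /andP[xy /Hd'{Hd'}].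
  have bxy : ball x delta y by rewrite /ball/= distrC.
  have bxx := ballxx x d0; move: kD; rewrite ltr_norml => /andP[kD _].
  have [yx|yx] := leP x y.
    rewrite h_inc//; have kv : k.+1%:R * (y - x) <= fine (m `]x, y]%classic).
      by rewrite -lee_fin fineK ?fin//; exact: Hd.
    have : 0 <= (fine (m `]x, y]%classic) + ('D_1 f x - 1) * (y - x)) * (y - x).
      by rewrite mulr_ge0 ?subr_ge0//; nra.
    have := mulr_ge0 (ltW e0) (sqr_ge0 (y - x)); nra.
  rewrite -(opprB (h x)) h_inc//; last exact: ltW.
  have kv : k.+1%:R * (x - y) <= fine (m `]y, x]%classic).
    by rewrite -lee_fin fineK ?fin//; apply: Hd => //; exact: ltW.
  have : 0 <= (fine (m `]y, x]%classic) + ('D_1 f x - 1) * (x - y)) * (x - y).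
    by rewrite mulr_ge0 ?subr_ge0// ?ltW//; nra.
  have := mulr_ge0 (ltW e0) (sqr_ge0 (x - y)); nra.
rewrite -subr_ge0 h_inc//.
have : fine (m `]a, b]%classic) <= e.
  by rewrite -lee_fin fineK ?fin//; apply: le_trans me; apply: le_measure; rewrite ?inE.
have : e * (b - a + 1) = eps by rewrite /e; field; lra.
nra.
Qed.

(** Monotonicity is applied to [M * t - f t] and [M * t + f t], whose derivatives are nonnegative
    almost everywhere. *)
Lemma ae_derive_lipschitz f M : (forall x, derivable f x 1) ->
  (\forall x \ae leb, `|'D_1 f x| <= M) -> forall a b, `|f b - f a| <= M * `|b - a|.
Proof.
move=> df fM.
have dM x : derivable (fun t => M * t) x 1 by apply: derivableM.
have DM x : 'D_1 (fun t : R => M * t) x = M.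
  by rewrite deriveM// derive_cst derive_id scaler0 addr0 /GRing.scale/= mulr1.
have up : {homo (fun t => M * t - f t) : a b / a <= b}.
  apply: ae_derive_ge0_homo => [x|]; first exact: derivableB.
  apply: ae_imp fM => x fx; rewrite deriveB// DM; move: fx; rewrite ler_norml; lra.
have dn : {homo (fun t => M * t + f t) : a b / a <= b}.
  apply: ae_derive_ge0_homo => [x|]; first exact: derivableD.
  apply: ae_imp fM => x fx; rewrite deriveD// DM; move: fx; rewrite ler_norml; lra.
have H a b : a <= b -> `|f b - f a| <= M * (b - a).
  move=> ab; have := up _ _ ab; have := dn _ _ ab; rewrite ler_norml; lra.
move=> a b; have [le_ab|/ltW le_ba] := leP a b.
  by rewrite (ger0_norm (_ : 0 <= b - a)) ?subr_ge0//; exact: H.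
by rewrite distrC [`|b - a|]distrC (ger0_norm (_ : 0 <= a - b)) ?subr_ge0//; exact: H.
Qed.

End goldowsky_tonelli.

(** * Lebesgue measure on row vectors *)

Lemma integral_meas_push d d' (T : measurableType d) (T' : measurableType d') (R : realType)
    (m : {measure set T -> \bar R}) (phi : T -> T') (mphi : measurable_fun setT phi)
    (h : T' -> \bar R) : measurable_fun setT h -> (forall y, 0 <= h y)%E ->
  (\int[meas_push m mphi]_y h y = \int[m]_x h (phi x))%E.
Proof.
move=> mh h0; rewrite -[RHS](integral_posfun (posfun_push m mphi)); last by split.
by apply: eq_measure_integral.
Qed.

Section lebesgue_rV_theory.
Context {R : realType}.
Local Notation leb := (@lebesgue_measure R).
Local Notation lam n := (@lebesgue_rV R n).

Lemma continuous_borel_measurable (T : ptopologicalType) (g : T -> R) :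
  continuous g -> measurable_fun [set: g_sigma_algebraType (@open T)] g.
Proof.
move=> cg; apply: (measurability _ (RGenOpens.measurableE R)).
move=> _ [_ [a [b ->] <-]]; rewrite setTI; apply: sub_sigma_algebra.
by apply: open_comp; [move=> v _; exact: cg|exact: interval_open].
Qed.

Lemma borel_open_measurable (T : ptopologicalType) (O : set T) :
  open O -> measurable (O : set (g_sigma_algebraType (@open T))).
Proof. by move=> oO; exact: sub_sigma_algebra. Qed.

Lemma measurable_shift1 (y : R) : measurable_fun setT (fun t : measurableTypeR R => t + y : measurableTypeR R).
Proof. exact: measurable_funD. Qed.

Lemma lebesgue_shift (y : R) (B : set (measurableTypeR R)) : measurable B ->
  leb ((fun t => t + y) @^-1` B) = leb B.
Proof.
move=> mB; symmetry.
transitivity (meas_push leb (measurable_shift1 y) B); last by rewrite meas_pushE.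
apply: lebesgue_measure_unique => // _ [[a b] _ <-] /=.
rewrite meas_pushE//.
have -> : (fun t => t + y) @^-1` `]a, b]%classic = `]a - y, b - y]%classic.
  by apply/seteqP; split => t /=; rewrite !in_itv/= => /andP[? ?]; apply/andP; split; lra.
have itvE (c d : R) : leb `]c, d]%classic = if c < d then (d - c)%:E else 0%E.
  by rewrite lebesgue_measure_itv/= lte_fin.
apply: (etrans (itvE a b)); apply: (etrans _ (esym (itvE (a - y) (b - y)))).
by rewrite ltrD2r; case: ltP => // _; congr (_%:E); ring.
Qed.

Lemma measurable_shift n (y : 'rV[R]_n) :
  measurable_fun setT (fun x : borel 'rV[R]_n => (x : 'rV[R]_n) + y : borel 'rV[R]_n).
Proof.
apply: measurable_fun_rV => i; under eq_fun do rewrite mxE.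
by apply: measurable_funD => //; exact: borel_measurable_coord.
Qed.

(** Sections along coordinate [ord0], the one added by [consv], are shifted by the one-dimensional
    statement, and the other coordinates by induction. *)
Lemma lebesgue_rV_shift n (y : 'rV[R]_n) (B : set (borel 'rV[R]_n)) : measurable B ->
  lam n ((fun x => x + y) @^-1` B) = lam n B.
Proof.
elim: n y B => [|n ih] y B mB.
  have -> // : (fun x => x + y) @^-1` B = B.
  by apply/seteqP; split => x /=; rewrite (thinmx0 (x + y)) (thinmx0 x).
pose y' : 'rV[R]_n := \row_j y 0 (lift ord0 j); pose t0 := y 0 ord0.
have mC : measurable (@consv R n @^-1` B).
  by rewrite -[X in measurable X]setTI; exact: measurable_consv.
pose h (x : borel 'rV[R]_n) := leb (xsection (@consv R n @^-1` B) x).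
have mh : measurable_fun setT h by exact: (measurable_fun_xsection leb mC).
transitivity (\int[lam n]_x h ((x : 'rV[R]_n) + y')%R)%E.
  rewrite /= /lebesgue_succ /pushforward /product_measure1/=.
  apply: eq_integral => x _ /=; rewrite /h.
  rewrite -[RHS](lebesgue_shift t0); last exact: measurable_xsection.
  congr (leb _); apply/seteqP; split => t; rewrite /xsection/= !inE/=;
  rewrite (_ : consv (x, t) + y = consv ((x : 'rV[R]_n) + y', t + t0))//;
  by apply/rowP => i; rewrite !mxE/=; case: unliftP => [j ->|->]; rewrite ?mxE.
transitivity (\int[meas_push (lam n) (measurable_shift y')]_x h x)%E.
  by rewrite integral_meas_push.
rewrite /= /lebesgue_succ /pushforward /product_measure1/=.
apply: eq_measure_integral => C mC' _; rewrite meas_pushE//; exact: ih.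
Qed.

Lemma integral_lebesgue_shift n (y : 'rV[R]_n) (h : borel 'rV[R]_n -> \bar R) :
  measurable_fun setT h -> (forall x, 0 <= h x)%E ->
  (\int[lam n]_x h ((x : 'rV[R]_n) + y)%R = \int[lam n]_x h x)%E.
Proof.
move=> mh h0; transitivity (\int[meas_push (lam n) (measurable_shift y)]_x h x)%E.
  by rewrite integral_meas_push.
by apply: eq_measure_integral => C mC _; rewrite meas_pushE//; exact: lebesgue_rV_shift.
Qed.

Lemma lebesgue_rV_ball n (x : 'rV[R]_n) (e : R) : 0 < e ->
  lam n (ball x e) = ((2 * e) ^+ n)%:E.
Proof.
move=> e0; elim: n x => [|n ih] x.
  by rewrite /= diracE mem_set//; split => // i [].
have -> : lam n.+1 (ball x e) =
    (lam n \x leb)%E (ball (\row_j x 0 (lift ord0 j) : 'rV[R]_n) e `*` ball (x 0 ord0) e).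
  rewrite /= /lebesgue_succ /pushforward; congr ((_ \x _)%E _).
  apply/seteqP; split => -[v t] /=.
    move=> [_ b]; split; first split => // i j.
      by have := b 0 (lift ord0 j); rewrite !mxE liftK ord1.
    by have := b 0 ord0; rewrite !mxE unlift_none.
  move=> [[_ b] bt]; split => // i j; rewrite ord1 !mxE.
  by case: unliftP => [k ->|->//]; have := b 0 k; rewrite !mxE.
rewrite product_measure1E ?ih//=; last first.
- exact: measurable_ball.
- by apply: borel_open_measurable; exact: ball_open.
by rewrite lebesgue_measure_ball; [rewrite -EFinM exprSr mulr_natl|exact: ltW].
Qed.

Lemma lebesgue_rV_open_gt0 n (O : set 'rV[R]_n) : open O -> O !=set0 -> (0 < lam n O)%E.
Proof.
move=> oO [x Ox]; have := open_nbhs_nbhs (conj oO Ox).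
rewrite -nbhs_ballE => -[e /= e0 He].
apply: (@lt_le_trans _ _ (lam n (ball x e))).
  by rewrite lebesgue_rV_ball// lte_fin exprn_gt0// mulr_gt0.
apply: le_measure; rewrite ?inE//; apply: borel_open_measurable => //; exact: ball_open.
Qed.

(* A copy of [lebesgue_rV n] that carries the sigma-finite structure. *)
Definition lebV n : set (borel 'rV[R]_n) -> \bar R := lam n.
Arguments lebV n : clear implicits.
HB.instance Definition _ n := Measure.on (lebV n).

Lemma lebV_sigma_finite n : sigma_finite setT (lebV n).
Proof.
exists (fun k => ball (0 : 'rV[R]_n) k.+1%:R) => [|k].
  apply/esym; rewrite -subTset => x _; exists (Num.Def.truncn `|x|) => //.
  rewrite -ball_normE/= sub0r normrN; exact: truncnS_gt.
split; first by apply: borel_open_measurable; exact: ball_open.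
by rewrite /lebV lebesgue_rV_ball// ltry.
Qed.

HB.instance Definition _ n := Measure_isSigmaFinite.Build _ _ _ (lebV n) (lebV_sigma_finite n).

(** Nonempty open sets have positive measure, hence are not contained in a null set. *)
Lemma ae_dense n (Q : 'rV[R]_n -> Prop) :
  (\forall x \ae lam n, Q x) -> dense [set x | Q x].
Proof.
move=> [N [mN N0 NQ]] O [x Ox] oO; apply: contrapT => nQ.
have : (0 < lam n O)%E by apply: lebesgue_rV_open_gt0 => //; exists x.
rewrite ltNge => /negP; apply; rewrite -N0; apply: le_measure; rewrite ?inE//.
  exact: borel_open_measurable.
by move=> y Oy; apply: NQ => /= Qy; apply: nQ; exists y.
Qed.

(* Translation invariance and Tonelli. *)
Lemma ae_line n (v : 'rV[R]_n) (Q : 'rV[R]_n -> Prop) :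
  (\forall x \ae lam n, Q x) ->
  \forall x \ae lam n, \forall t \ae leb, Q (x + t *: v).
Proof.
move=> [N [mN N0 NQ]].
pose T (z : borel 'rV[R]_n * measurableTypeR R) : borel 'rV[R]_n := (z.1 : 'rV[R]_n) + z.2 *: v.
have mT : measurable_fun setT T.
  apply: measurable_fun_rV => i; under eq_fun do rewrite !mxE.
  apply: measurable_funD; last by apply: measurable_funM => //; exact: measurable_snd.
  exact: (measurableT_comp (@borel_measurable_coord R n i) measurable_fst).
have mB : measurable (T @^-1` N) by rewrite -[X in measurable X]setTI; exact: mT.
have sec : (\int[lebV n]_x (leb (xsection (T @^-1` N) x)) = 0)%E.
  have := @indic_fubini_tonelli _ _ _ _ R (lebV n) leb _ mB.
  under eq_integral do rewrite indic_fubini_tonelli_FE//=.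
  move=> ->; under eq_integral do rewrite indic_fubini_tonelli_GE//=.
  apply: integral0_eq => t _; rewrite /lebV -[RHS]N0 -(lebesgue_rV_shift (t *: v) mN).
  by congr (lam n _); apply/seteqP; split => x; rewrite /ysection/= inE.
have ms : measurable_fun setT (fun x => leb (xsection (T @^-1` N) x)).
  exact: (measurable_fun_xsection leb mB).
have : \forall x \ae lebV n, leb (xsection (T @^-1` N) x) = 0%E.
  have := ae_eq_integral_abs (lebV n) measurableT ms.
  under eq_integral do rewrite gee0_abs//.
  by move=> [/(_ sec) H _]; apply: ae_imp H => x; exact.
apply: ae_imp => x hx; exists (xsection (T @^-1` N) x); split => //.
  exact: measurable_xsection.
by move=> t /= nQ; rewrite /xsection/= inE; exact: NQ.
Qed.

End lebesgue_rV_theory.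

(** * The class A1 *)

Section lipschitz_lines.
Context {R : realType} {n : nat}.
Implicit Types (F : 'rV[R]_n -> R) (x y v : 'rV[R]_n).
Local Notation lam := (@lebesgue_rV R n).

Lemma abs_coord_le_enorm x i : `|x 0 i| <= enorm x.
Proof.
rewrite /enorm /dotv -sqrtr_sqr ler_wsqrtr// (bigD1 i)//= expr2 lerDl sumr_ge0// => j _.
by rewrite -expr2 sqr_ge0.
Qed.

Lemma dense_closed_le F (M : R) : continuous F -> dense [set x | F x <= M] -> forall x, F x <= M.
Proof.
move=> cF dF x; rewrite leNgt; apply/negP => Mx.
have oO : open (F @^-1` [set t | M < t]) by apply: open_comp => // *; exact: cF.
have [|y [/= My]] := dF _ _ oO; first by exists x.
by rewrite leNgt My.
Qed.

Lemma coord_le_norm x i : `|x 0 i| <= `|x|.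
Proof.
rewrite [leRHS]mx_normrE.
exact: (le_bigmax _ (fun ij : 'I_1 * 'I_n => `|x ij.1 ij.2|) (0, i)).
Qed.

Let line_quotient F v x (t z : R) :
  ((fun t : R => F (x + t *: v)) \o shift t) (z *: 1) = (F \o shift (x + t *: v)) (z *: v).
Proof. by rewrite /= (mulr1 z : z *: 1 = z) scalerDl addrCA. Qed.

Lemma line_derivable F v x t : derivable F (x + t *: v) v ->
  derivable (fun t : R => F (x + t *: v)) t 1.
Proof.
rewrite /derivable => h.
by under eq_fun do rewrite line_quotient.
Qed.

Lemma line_deriveE F v x t : 'D_1 (fun t : R => F (x + t *: v)) t = 'D_v F (x + t *: v).
Proof. by rewrite /derive; under eq_fun do rewrite line_quotient. Qed.

Lemma continuous_shift v : continuous (fun x => x + v).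
Proof. move=> x; apply: (@cvgD _ _ _ (nbhs x) _ id (cst v) x v); [exact: cvg_id|exact: cvg_cst]. Qed.

(** The derivative bound may fail on whole lines, but for almost every base point it holds almost
    everywhere on its line. There [ae_derive_lipschitz] applies; such base points are dense, and
    continuity of [F] gives the others. *)
Lemma line_lipschitz F i (M : R) : (forall x, differentiable F x) ->
  (\forall x \ae lam, `|partial i F x| <= M) ->
  forall x t, `|F (x + t *: delta_mx 0 i) - F x| <= M * `|t|.
Proof.
move=> dF FM x t; set v := delta_mx 0 i.
have cF : continuous F by move=> y; exact: differentiable_continuous.
have cS : continuous (fun y => F (y + t *: v)).
  by move=> y; apply: (@continuous_comp _ _ _ (fun y => y + t *: v) F); [exact: continuous_shift|exact: cF].
have : dense [set y | `|F (y + t *: v) - F y| <= M * `|t|].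
  apply: ae_dense; apply: ae_imp (ae_line v FM) => y hy.
  have dl u : derivable (fun t : R => F (y + t *: v)) u 1.
    by apply: line_derivable; apply: diff_derivable.
  have hl : \forall u \ae lebesgue_measure, `|'D_1 (fun t : R => F (y + t *: v)) u| <= M.
    by apply: ae_imp hy => u hu; rewrite line_deriveE.
  by have := ae_derive_lipschitz dl hl 0 t; rewrite scale0r addr0 subr0.
move=> /dense_closed_le; apply => y.
apply: (@continuous_comp _ _ _ (fun y => F (y + t *: v) - F y) (fun z => `|z|)).
  by apply: continuousB; [exact: cS|exact: cF].
exact: norm_continuous.
Qed.

(** One passes from [x] to [y] changing one coordinate at a time: [z k] already has the first [k]
    coordinates of [y]. *)
Lemma line_lipschitz_total F (M : R) : 0 <= M ->
  (forall i x t, `|F (x + t *: delta_mx 0 i) - F x| <= M * `|t|) ->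
  forall x y, `|F y - F x| <= n%:R * M * `|y - x|.
Proof.
move=> M0 FM x y.
pose z k : 'rV[R]_n := \row_i (if (i < k)%N then y 0 i else x 0 i).
have step k : (k <= n)%N -> `|F (z k) - F x| <= k%:R * M * `|y - x|.
  elim: k => [_|k ih kn].
    by rewrite !mul0r (_ : z 0 = x) ?subrr ?normr0//; apply/rowP => i; rewrite mxE.
  have := ih (ltnW kn); pose i := Ordinal kn.
  have zk : z k.+1 = z k + (y 0 i - x 0 i) *: delta_mx 0 i.
    apply/rowP => j; rewrite !mxE eqxx/= ltnS leq_eqVlt.
    have [->|ji] := eqVneq j i; first by rewrite /= eqxx ltnn mulr1; ring.
    have -> /= : (j == k :> nat) = false by apply/negbTE; apply: contra ji => /eqP jk; apply/eqP/val_inj.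
    by rewrite mulr0 addr0.
  have := FM i (z k) (y 0 i - x 0 i); rewrite -zk.
  have : `|y 0 i - x 0 i| <= `|y - x|.
    by have := coord_le_norm (y - x) i; rewrite !mxE.
  move=> /(ler_wpM2l M0) h1 h2 h3.
  rewrite -(subrKA (F (z k))); apply: (le_trans (ler_normD _ _)).
  rewrite -natr1; lra.
by have := step n (leqnn n); rewrite (_ : z n = y)//; apply/rowP => i; rewrite mxE ltn_ord.
Qed.

End lipschitz_lines.

Section class_A1.
Context {R : realType} {S A : ptopologicalType} {n : nat}.
Variables (mu : {finite_measure set (borel A) -> \bar R}).
Variable f : 'rV[R]_n -> S -> A -> R.
Local Notation lam := (@lebesgue_rV R n).

(** In the parameter the norm only gives bounds almost everywhere. Continuity upgrades the one on
    [f]; the gradient need not be continuous, so its bound becomes a Lipschitz condition along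
    coordinate lines instead. *)
Lemma classA1_regular : classA1 mu f -> exists2 M : R, 0 <= M & forall s, \forall a \ae mu,
  [/\ forall t, differentiable (fun t => f t s a) t, forall t, `|f t s a| <= M
    & forall i t h, `|f (t + h *: delta_mx 0 i) s a - f t s a| <= M * `|h| ].
Proof.
move=> [_ df fN].
have [M M0 fM] : exists2 M : R, 0 <= M & (normA1 mu f <= M%:E)%E.
  case: normA1 fN => [r _|//|_]; last by exists 0; rewrite ?leNye.
  by exists `|r| => //; rewrite lee_fin ler_norm.
exists M => // s.
move: fM; rewrite /normA1 ge_max => /andP[b0 b1].
have b0' := ess_sup_ge mu (fun a => ereal_sup [set ess_sup lam (fun t => (`|f t s a|)%:E) | s in setT]).
have b1' := ess_sup_ge mu (fun a => ereal_sup [set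
  ess_sup lam (fun t => (enorm (grad (fun x => f x s a) t))%:E) | s in setT]).
have hb : \forall a \ae mu, (\forall t \ae lam, `|f t s a| <= M) /\
    (\forall t \ae lam, enorm (grad (fun x => f x s a) t) <= M).
  apply: (ae_imp2 _ b0' b1') => a ha0 ha1; split.
    have : \forall t \ae lam, ((`|f t s a|)%:E <= M%:E)%E.
      apply/ess_supP; apply: le_trans (le_trans ha0 b0); apply: ereal_sup_ubound; by exists s.
    by apply: ae_imp => t; rewrite lee_fin.
  have : \forall t \ae lam, ((enorm (grad (fun x => f x s a) t))%:E <= M%:E)%E.
    apply/ess_supP; apply: le_trans (le_trans ha1 b1); apply: ereal_sup_ubound; by exists s.
  by apply: ae_imp => t; rewrite lee_fin.
apply: (ae_imp2 _ (df s) hb) => a da [h0 h1]; split => //.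
  apply: (@dense_closed_le _ _ (fun t => `|f t s a|)); last exact: ae_dense.
  move=> t; apply: (@continuous_comp _ _ _ (fun t => f t s a) (fun z => `|z|)).
    exact: differentiable_continuous.
  exact: norm_continuous.
move=> i; apply: line_lipschitz => //; apply: ae_imp h1 => t; apply: le_trans.
by have := abs_coord_le_enorm (grad (fun x => f x s a) t) i; rewrite mxE.
Qed.

End class_A1.

Section clamp.
Context {R : realType}.
Definition clamp (M z : R) : R := Num.max (- M) (Num.min M z).

Lemma clamp_abs_le M z : 0 <= M -> `|clamp M z| <= M.
Proof.
move=> M0; rewrite /clamp ler_norml le_max lexx /= ge_max ge_min lexx /=.
by rewrite andbT ge0_cp.
Qed.

Lemma clamp_id M z : `|z| <= M -> clamp M z = z.
Proof. by rewrite ler_norml /clamp => /andP[h1 h2]; rewrite min_r// max_r. Qed.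

Lemma bmf_clamp d (T : measurableType d) (M : R) (h : T -> R) : 0 <= M ->
  measurable_fun setT h -> bmf (fun x => clamp M (h x)).
Proof.
move=> M0 mh; split; last by exists M => x; exact: clamp_abs_le.
by apply: measurable_maxr => //; exact: measurable_minr.
Qed.

End clamp.

(** * Regularity of averaged features *)

Section weighted_average.
Context {R : realType} {S A : ptopologicalType} {n : nat}.
Variables (mu : {finite_measure set (borel A) -> \bar R}) (o : probability (borel S) R).
Variables (w : borel S * borel A -> R) (g : 'rV[R]_n -> S -> A -> R) (M : R).
Hypothesis M0 : 0 <= M.
Hypothesis bw : bmf w.
Hypothesis bg : bmf (fun x : borel 'rV[R]_n * (borel S * borel A) => g x.1 x.2.1 x.2.2).
Hypothesis reg : forall s, \forall a \ae mu,
  (forall t, differentiable (fun t => g t s a) t) /\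
  forall i t h, `|g (t + h *: delta_mx 0 i) s a - g t s a| <= M * `|h|.

Let fmu : (mu setT < +oo)%E := fin_mu mu.
Let fo : ((o : {measure set _ -> \bar R}) setT < +oo)%E := prob_fin o.

Definition average (t : 'rV[R]_n) : R :=
  rint o (fun s => rint mu (fun a => w (s, a) * g t s a)).

Let bgt t : bmf (fun x : borel S * borel A => g t x.1 x.2).
Proof. exact: (bmf_comp bg (measurable_pair1 (t : borel 'rV[R]_n))). Qed.

Lemma bmf_average : bmf (average : borel 'rV[R]_n -> R).
Proof.
pose H (x : borel 'rV[R]_n * (borel S * borel A)) := w x.2 * g x.1 x.2.1 x.2.2.
have bH : bmf H by apply: bmfM => //; exact: (bmf_comp bw measurable_snd).
have bH' : bmf (fun y : (borel 'rV[R]_n * borel S) * borel A => H (y.1.1, (y.1.2, y.2))).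
  apply: (bmf_comp bH); apply: measurable_fun_pair.
    exact: measurableT_comp.
  by apply: measurable_fun_pair => //; exact: measurableT_comp.
exact: (bmf_rint1 o (bmf_rint1 mu bH')).
Qed.

(** Clamping makes the difference quotient bounded for every action, so that the bounded calculus
    applies; by the Lipschitz condition it changes nothing for almost every action. *)
Let quot i x (h : R) (y : borel S * borel A) : R :=
  clamp M (h^-1 * (g (x + h *: delta_mx 0 i) y.1 y.2 - g x y.1 y.2)).

Let bquot i x h : bmf (quot i x h).
Proof.
apply: bmf_clamp => //; apply: measurable_funM => //.
by apply: measurable_funB; [case: (bgt (x + h *: delta_mx 0 i))|case: (bgt x)].
Qed.

Let quotE i x h s : h != 0 ->
  \forall a \ae mu, quot i x h (s, a) = h^-1 * (g (x + h *: delta_mx 0 i) s a - g x s a).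
Proof.
move=> h0; apply: ae_imp (reg s) => a [_ lip]; rewrite /quot clamp_id//.
rewrite normrM normfV mulrC ler_pdivrMr ?normr_gt0//; exact: lip.
Qed.

Let average_quot i x h : h != 0 ->
  h^-1 * (average (x + h *: delta_mx 0 i) - average x) =
  rint o (fun s => rint mu (fun a => w (s, a) * quot i x h (s, a))).
Proof.
move=> h0; have bwg t : bmf (fun s : borel S => rint mu (fun a => w (s, a) * g t s a)).
  by apply: (bmf_rint1 mu (h := fun y => w y * g t y.1 y.2)); exact: bmfM.
rewrite /average -rintB// -rintZ//; last exact: bmfB.
apply: eq_rint => s; have bws := bmf_act s bw.
have bgs t : bmf (fun a : borel A => g t s a) by exact: (bmf_act s (bgt t)).
rewrite -rintB; [|exact: fmu|exact: bmfM|exact: bmfM].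
rewrite -rintZ; [|exact: fmu|by apply: bmfB; exact: bmfM].
apply: ae_eq_rint.
- by apply: (proj1 (_ : bmf _)); apply: bmfZ; apply: bmfB; exact: bmfM.
- by apply: (proj1 (_ : bmf _)); apply: bmfM => //; exact: (bmf_act s (bquot i x h)).
by apply: ae_imp (quotE i x s h0) => a ->; ring.
Qed.

Lemma average_lipschitz : exists2 C : R, 0 <= C & forall i x h,
  `|average (x + h *: delta_mx 0 i) - average x| <= C * `|h|.
Proof.
have [_ [Mw wM]] := bw.
have Mw0 : 0 <= Mw by exact: le_trans (normr_ge0 _) (wM (point, point)).
exists (Mw * M * fine (mu setT)) => [|i x h].
  by rewrite !mulr_ge0// fine_ge0.
have [->|h0] := eqVneq h 0; first by rewrite scale0r addr0 subrr normr0 mulr0.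
rewrite -ler_pdivrMr ?normr_gt0// mulrC -normfV -normrM average_quot//.
have bq : bmf (fun y => w y * quot i x h y) by exact: bmfM.
apply: rint_pabs_le => [|s]; first exact: (bmf_rint1 mu bq).
apply: rint_abs_le => [//||a]; first exact: (bmf_act s bq).
by rewrite normrM ler_pM//; exact: clamp_abs_le.
Qed.

Lemma average_derivable i x : derivable average x (delta_mx 0 i).
Proof.
pose u0 k : R := k.+1%:R^-1.
have u0n k : u0 k != 0 by rewrite invr_neq0.
have u0c : u0 @ \oo --> (0 : R) by exact: cvg_harmonic.
(* The limit is taken along one fixed sequence so that [limn] gives a measurable function, also at
   pairs without a derivative; where the derivative exists, every null sequence has this limit. *)
pose ql (y : borel S * borel A) := limn (fun k => quot i x (u0 k) y).
have mql : measurable_fun setT ql.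
  by apply: measurable_fun_limn => k; case: (bquot i x (u0 k)).
have qlc (u : nat -> R) s : (forall k, u k != 0) -> u @ \oo --> (0 : R) ->
    \forall a \ae mu, quot i x (u k) (s, a) @[k --> \oo] --> ql (s, a).
  move=> un uc; apply: ae_imp (reg s) => a [dg lip].
  have main (v : nat -> R) : (forall k, v k != 0) -> v @ \oo --> (0 : R) ->
      quot i x (v k) (s, a) @[k --> \oo] --> 'D_(delta_mx 0 i) (fun t => g t s a) x.
    move=> vn vc.
    have := @diff_derivable _ _ _ (fun t => g t s a) x (delta_mx 0 i) (dg x).
    move=> /cvgr_dnbhsP/(_ v (conj vn vc)); apply: cvg_trans; apply: near_eq_cvg.
    apply: nearW => k; rewrite /quot clamp_id /= ?[v k *: _ + x]addrC//.
    rewrite normrM normfV mulrC ler_pdivrMr ?normr_gt0//; exact: lip.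
  by rewrite /ql (cvg_lim _ (main _ u0n u0c))//; exact: main.
pose L := rint o (fun s => rint mu (fun a => w (s, a) * ql (s, a))).
apply/cvg_ex; exists L; apply/cvgr_dnbhsP => u [un uc].
have [_ [Mw wM]] := bw.
have bq k : bmf (fun y => w y * quot i x (u k) y) by exact: bmfM.
have bound k y : `|w y * quot i x (u k) y| <= Mw * M.
  by rewrite normrM ler_pM//; exact: clamp_abs_le.
have mw : measurable_fun setT w by case: bw.
have E : (fun k => rint o (fun s => rint mu (fun a => w (s, a) * quot i x (u k) (s, a))))
    @ \oo --> L.
  apply: (cvg_rint fo (M := Mw * M * fine (mu setT))).
  - by move=> k; exact: (bmf_rint1 mu (bq k)).
  - by move=> k s; apply: rint_abs_le => //; exact: (bmf_act s (bq k)).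
  - apply: (measurable_rint2 mu (h := fun z : borel A * borel S => w (z.2, z.1) * ql (z.2, z.1))).
    have msw : measurable_fun setT (fun z : borel A * borel S => (z.2, z.1)).
      by apply: measurable_fun_pair.
    by apply: measurable_funM; exact: measurableT_comp.
  apply: aeW => s; apply: (cvg_rint fmu (M := Mw * M)).
  - by move=> k; exact: (bmf_act s (bq k)).
  - by [].
  - by apply: measurable_funM; exact: (measurableT_comp _ (measurable_pair1 s)).
  by apply: ae_imp (qlc u s un uc) => a; apply: cvgMr.
apply: cvg_trans E; apply: near_eq_cvg; apply: nearW => k.
rewrite -(average_quot i x (un k)) (addrC x); reflexivity.
Qed.

End weighted_average.

Section class_A1_objective.
Context {R : realType} {S A : ptopologicalType} {n : nat}.
Variables (P : R.-pker (borel S * borel A)%type ~> borel S) (r : S -> A -> R).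
Variables (gamma tau : R) (mu : {finite_measure set (borel A) -> \bar R}).
Hypothesis hgamma : 0 <= gamma < 1.
Hypothesis htau : 0 <= tau.
Hypothesis hr : bmf (fun x : borel S * borel A => r x.1 x.2).
Hypothesis mu_gt0 : (0 < mu setT)%E.
Variables (rho : probability (borel S) R) (f : 'rV[R]_n -> S -> A -> R).
Hypothesis hf : classA1 mu f.
Local Notation D nu := (dJ P r gamma tau mu f rho nu).

Let mf : measurable_fun setT (fun x : borel 'rV[R]_n * (borel S * borel A) => f x.1 x.2.1 x.2.2).
Proof. by case: hf. Qed.

(** Clamping [f] at its essential bound makes the bound valid for every action and keeps joint
    measurability; for almost every action it leaves [f] unchanged for all parameters at once. *)
Lemma classA1_truncation : exists2 M : R, 0 <= M & exists g : 'rV[R]_n -> S -> A -> R,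
  [/\ bmf (fun x : borel 'rV[R]_n * (borel S * borel A) => g x.1 x.2.1 x.2.2),
      forall t s a, `|g t s a| <= M,
      forall s, \forall a \ae mu, forall t, f t s a = g t s a
    & forall s, \forall a \ae mu, (forall t, differentiable (fun t => g t s a) t) /\
        forall i t h, `|g (t + h *: delta_mx 0 i) s a - g t s a| <= M * `|h| ].
Proof.
have [M M0 fM] := classA1_regular hf; exists M => //.
exists (fun t s a => clamp M (f t s a)); split.
- exact: bmf_clamp.
- by move=> t s a; exact: clamp_abs_le.
- by move=> s; apply: ae_imp (fM s) => a [_ fa _] t; rewrite clamp_id.
move=> s; apply: ae_imp (fM s) => a [da fa la].
have E : (fun t => clamp M (f t s a)) = (fun t => f t s a).
  by apply/funext => t; rewrite clamp_id.
by rewrite E; split => // i t h; rewrite !clamp_id.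
Qed.

Lemma dJ_regular nu : [/\ bmf (D nu : borel 'rV[R]_n -> R),
  exists2 C : R, 0 <= C & forall i x h, `|D nu (x + h *: delta_mx 0 i) - D nu x| <= C * `|h|
  & forall i x, derivable (D nu) x (delta_mx 0 i)].
Proof.
have [M M0 [g [bg gM fg reg]]] := classA1_truncation.
have [wt hwt [pr wE]] := dJ_weightE P tau hgamma hr mu_gt0 rho mf bg gM fg nu.
have DE : D nu = fun t => (1 - gamma)^-1 * average mu pr wt g t by apply/funext.
rewrite DE; split.
- by apply: bmfZ; exact: bmf_average.
- have [C C0 hC] := average_lipschitz pr M0 hwt bg reg.
  exists (`|(1 - gamma)^-1| * C) => [|i x h]; first by rewrite mulr_ge0.
  by rewrite -mulrBr normrM -mulrA ler_wpM2l.
- move=> i x; have h : derivable (average mu pr wt g) x (delta_mx 0 i).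
    exact: (average_derivable M0 hwt bg reg).
  change (derivable ((1 - gamma)^-1 \*: average mu pr wt g) x (delta_mx 0 i)).
  exact: (@derivableZ _ _ _ _ _ _ _ h).
Qed.

Lemma value_at_mix_A1 (nu nu' : probability (borel 'rV[R]_n) R) : exists2 C : R, 0 <= C &
  exists2 e1 : R, 0 < e1 <= 1 & forall (e : R) (he : 0 <= e <= 1), e <= e1 ->
    e * (rint nu' (D nu) - rint nu (D nu)) - C * e ^+ 2 <=
    value_at P r gamma tau mu (softmax mu f (mix_prob nu nu' he)) rho -
    value_at P r gamma tau mu (softmax mu f nu) rho.
Proof.
have [M M0 [g [bg gM fg _]]] := classA1_truncation.
exact: (value_at_mix P hgamma htau hr mu_gt0 rho mf bg gM fg nu nu').
Qed.

End class_A1_objective.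

(** * The Wasserstein distance along mixtures *)

Section euclidean_norm.
Context {R : realType} {n : nat}.
Implicit Types x y z : 'rV[R]_n.

Lemma enorm_ge0 x : 0 <= enorm x. Proof. exact: sqrtr_ge0. Qed.

Lemma enorm0 : enorm (0 : 'rV[R]_n) = 0.
Proof. by rewrite /enorm /dotv big1 ?sqrtr0// => i _; rewrite mxE mul0r. Qed.

Lemma enorm_le_sum z : enorm z <= \sum_i `|z 0 i|.
Proof.
rewrite /enorm -[leRHS]ger0_norm ?sumr_ge0// -sqrtr_sqr ler_wsqrtr// /dotv expr2 mulr_suml.
apply: ler_sum => i _.
apply: le_trans (ler_norm _) _; rewrite normrM ler_wpM2l// (bigD1 i)//= lerDl.
exact: sumr_ge0.
Qed.

Lemma enorm_le_norm z : enorm z <= n%:R * `|z|.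
Proof.
apply: (le_trans (enorm_le_sum z)).
apply: (le_trans (ler_sum _ (fun i _ => coord_le_norm z i))).
by rewrite sumr_const card_ord mulr_natl.
Qed.

Lemma norm_le_enorm z : `|z| <= enorm z.
Proof.
rewrite [leLHS]mx_normrE; apply: bigmax_le; first exact: enorm_ge0.
by move=> [i j] _; rewrite ord1; exact: abs_coord_le_enorm.
Qed.

(** The factor [n] is the price of passing through the maximum norm; it is harmless, since only the
    smallness of transport costs matters. *)
Lemma enormB_le x y : enorm (x - y) <= n%:R * (enorm x + enorm y).
Proof.
apply: (le_trans (enorm_le_norm _)); rewrite ler_wpM2l//.
by apply: (le_trans (ler_normB _ _)); rewrite lerD ?norm_le_enorm.
Qed.

Lemma measurable_enorm : measurable_fun [set: borel 'rV[R]_n] (enorm : 'rV[R]_n -> R).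
Proof.
have ms : measurable_fun setT (Num.sqrt : R -> R).
  by apply: continuous_measurable_fun => t; exact: sqrt_continuous.
apply: (measurableT_comp ms); rewrite /dotv; apply: measurable_sum => i.
by apply: measurable_funM; exact: borel_measurable_coord.
Qed.

Lemma nnmfun_enorm d (T : measurableType d) (h : T -> borel 'rV[R]_n) :
  measurable_fun setT h -> nnmfun (fun x : T => (enorm (h x : 'rV[R]_n))%:E).
Proof.
move=> mh; split => [|x]; last by rewrite lee_fin enorm_ge0.
by apply/measurable_EFinP; exact: (measurableT_comp measurable_enorm).
Qed.

End euclidean_norm.

Section product_probability.
Context d1 d2 (T1 : measurableType d1) (T2 : measurableType d2) (R : realType).
Variables (m1 : probability T1 R) (m2 : probability T2 R).

Lemma prod_setT : (m1 \x m2)%E setT = 1%E.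
Proof.
have e1 : (m1 : {measure set _ -> \bar R}) setT = 1%E by exact: probability_setT.
have e2 : (m2 : {measure set _ -> \bar R}) setT = 1%E by exact: probability_setT.
by rewrite -setXTT [LHS]product_measure1E// e1 e2 mule1.
Qed.

Definition prod_prob : probability (T1 * T2)%type R := mkprob prod_setT.

Lemma prod_probE B1 B2 : measurable B1 -> measurable B2 ->
  prod_prob (B1 `*` B2) = (m1 B1 * m2 B2)%E.
Proof. exact: product_measure1E. Qed.

Lemma integral_prod_prob (h : T1 * T2 -> \bar R) : nnmfun h ->
  (\int[prod_prob]_z h z = \int[m1]_x \int[m2]_y h (x, y))%E.
Proof. by move=> [mh h0]; exact: fubini_tonelli1. Qed.

End product_probability.

Section wasserstein_mixture.
Context {R : realType} {n : nat}.
Notation Theta := (borel 'rV[R]_n).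
Implicit Types nu : probability Theta R.

Lemma integral_pcst d (T : measurableType d) (m : probability T R) (c : \bar R) :
  (\int[m]_x c = c)%E.
Proof.
have e1 : (m : {measure set _ -> \bar R}) setT = 1%E by exact: probability_setT.
by rewrite [LHS]integral_cst// e1 mule1.
Qed.

Definition push_prob d d' (T : measurableType d) (T' : measurableType d') (m : probability T R)
    (phi : T -> T') (mphi : measurable_fun setT phi) : probability T' R.
Proof.
apply: (@mkprob _ _ _ (meas_push m mphi)).
by rewrite meas_pushE// preimage_setT; exact: probability_setT.
Defined.

Lemma push_probE d d' (T : measurableType d) (T' : measurableType d') (m : probability T R)
    (phi : T -> T') (mphi : measurable_fun setT phi) B : measurable B ->
  push_prob m mphi B = m (phi @^-1` B).
Proof. by move=> mB; rewrite -(meas_pushE m mphi mB). Qed.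

Lemma integral_push_prob d d' (T : measurableType d) (T' : measurableType d') (m : probability T R)
    (phi : T -> T') (mphi : measurable_fun setT phi) h : nnmfun h ->
  (\int[push_prob m mphi]_y h y = \int[m]_x h (phi x))%E.
Proof. by move=> [mh h0]; rewrite -(integral_meas_push m mphi). Qed.

Lemma W1_le nu nu' (g : probability (Theta * Theta)%type R) : coupling nu nu' g ->
  (W1 nu nu' <= \int[g]_xy (enorm (xy.1 - xy.2 : 'rV[R]_n))%:E)%E.
Proof. by move=> hg; apply: ereal_inf_lbound; exists g. Qed.

Lemma measurable_subv : measurable_fun setT (fun z : Theta * Theta => (z.1 : 'rV[R]_n) - z.2 : Theta).
Proof.
apply: measurable_fun_rV => i; under eq_fun do rewrite !mxE.
by apply: measurable_funB;
  exact: (measurableT_comp (@borel_measurable_coord R n i)).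
Qed.

Lemma P1_mix nu nu' e (he : 0 <= e <= 1) : P1 nu -> P1 nu' -> P1 (mix_prob nu nu' he).
Proof.
rewrite /P1 => h h'; rewrite integral_mix_prob; last exact: nnmfun_enorm.
by apply: lte_add_pinfty; apply: lte_mul_pinfty => //; rewrite lee_fin; lra.
Qed.

Lemma integral_prod_enormB d (X : measurableType d) (m1 : probability X R)
    (m2 : probability Theta R) (a : X -> Theta) : measurable_fun setT a ->
  (\int[prod_prob m1 m2]_z (enorm ((a z.1 : 'rV[R]_n) - z.2))%:E <=
   n%:R%:E * (\int[m1]_x (enorm (a x : 'rV[R]_n))%:E + \int[m2]_y (enorm (y : 'rV[R]_n))%:E))%E.
Proof.
move=> ma.
have m1a : measurable_fun setT (fun z : X * Theta => a z.1) by exact: measurableT_comp.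
have mB : measurable_fun setT (fun z : X * Theta => (a z.1 : 'rV[R]_n) - z.2 : Theta).
  exact: (measurableT_comp measurable_subv (measurable_fun_pair m1a measurable_snd)).
have hA := nnmfun_enorm m1a; have hY := nnmfun_enorm (@measurable_snd _ _ X Theta).
have [[mA A0] [mY Y0] [mE E0]] := And3 hA hY (nnmfun_enorm mB).
apply: (@le_trans _ _ (\int[prod_prob m1 m2]_z (n%:R%:E *
    ((enorm (a z.1 : 'rV[R]_n))%:E + (enorm (z.2 : 'rV[R]_n))%:E)))%E).
  apply: ge0_le_integral => //.
  - by move=> z _; exact: E0.
  - by apply: measurable_funeM; exact: emeasurable_funD.
  - by move=> z _; rewrite -EFinD -EFinM lee_fin; exact: enormB_le.
rewrite ge0_integralZl//; last 2 first.
- exact: emeasurable_funD.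
- by move=> z _; rewrite -EFinD lee_fin addr_ge0 ?enorm_ge0.
have -> : (\int[prod_prob m1 m2]_z ((enorm (a z.1 : 'rV[R]_n))%:E + (enorm (z.2 : 'rV[R]_n))%:E) =
    \int[prod_prob m1 m2]_z (enorm (a z.1 : 'rV[R]_n))%:E +
    \int[prod_prob m1 m2]_z (enorm (z.2 : 'rV[R]_n))%:E)%E.
  by apply: ge0_integralD => // z _; rewrite lee_fin enorm_ge0.
have -> : (\int[prod_prob m1 m2]_z (enorm (a z.1 : 'rV[R]_n))%:E = \int[m1]_x (enorm (a x : 'rV[R]_n))%:E)%E.
  by apply: (etrans (integral_prod_prob _ _ hA)); apply: eq_integral => x _ /=; exact: integral_pcst.
have -> // : (\int[prod_prob m1 m2]_z (enorm (z.2 : 'rV[R]_n))%:E = \int[m2]_y (enorm (y : 'rV[R]_n))%:E)%E.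
by apply: (etrans (integral_prod_prob _ _ hY)) => /=; exact: integral_pcst.
Qed.

(** The coupling leaves the point in place with weight [1 - e] and draws an independent pair with
    weight [e], so only the latter costs. *)
Lemma W1_mix nu nu' : P1 nu -> P1 nu' -> exists2 K : R, 0 <= K &
  forall e (he : 0 <= e <= 1), (W1 nu (mix_prob nu nu' he) <= (e * K)%:E)%E.
Proof.
rewrite /P1 => h h'.
pose I (m : probability Theta R) := fine (\int[m]_x (enorm (x : 'rV[R]_n))%:E)%E.
have I0 m : 0 <= I m.
  by rewrite fine_ge0// integral_ge0// => x _; rewrite lee_fin enorm_ge0.
exists (n%:R * (I nu + I nu')) => [|e he]; first by rewrite mulr_ge0// addr_ge0 ?I0.
have [e0 e1] : 0 <= e /\ 0 <= 1 - e by lra.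
have mdiag : measurable_fun setT (fun x : Theta => (x, x)) by exact: measurable_fun_pair.
pose g := mix_prob (push_prob nu mdiag) (prod_prob nu nu') he.
have hg : coupling nu (mix_prob nu nu' he) g.
  move=> B mB; rewrite !mix_probE//; try exact: measurableX.
  rewrite !push_probE; try exact: measurableX.
  rewrite !prod_probE//.
  have T1 (m : probability Theta R) : m setT = 1%E by exact: probability_setT.
  rewrite !T1 mule1 mul1e; split.
    rewrite (_ : _ @^-1` _ = B); last by apply/seteqP; split => x // [].
    by rewrite -ge0_muleDl ?lee_fin// -EFinD subrK mul1e.
  by rewrite (_ : _ @^-1` _ = B)//; apply/seteqP; split => x // [].
apply: (le_trans (W1_le hg)).
have hE : nnmfun (fun xy : Theta * Theta => (enorm ((xy.1 : 'rV[R]_n) - xy.2))%:E).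
  exact: (nnmfun_enorm measurable_subv).
rewrite (integral_mix_prob _ _ _ hE) (integral_push_prob _ _ hE).
under eq_integral do rewrite subrr enorm0.
rewrite integral0 mule0 add0e EFinM lee_wpmul2l ?lee_fin//.
apply: (le_trans (integral_prod_enormB nu nu' (a := id) _)); first exact: measurable_id.
have fin (m : probability Theta R) : (\int[m]_x (enorm (x : 'rV[R]_n))%:E < +oo)%E ->
    (\int[m]_x (enorm (x : 'rV[R]_n))%:E = (I m)%:E)%E.
  by move=> hm; rewrite fineK// ge0_fin_numE// integral_ge0// => x _; rewrite lee_fin enorm_ge0.
by rewrite (fin _ h) (fin _ h') EFinM EFinD.
Qed.

End wasserstein_mixture.

(** * Relative entropy *)

Section kl_integrand.
Context {R : realType}.
Implicit Types v q e : R.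

(** The usual integrand of relative entropy, corrected by [v - q], which integrates to zero for
    probability densities. The correction makes it nonnegative, so that infinite entropies are
    handled without integrability conditions. *)
Definition kl_fun v q : R := q * ln q - q * ln v - q + v.

Lemma kl_fun_ge0 v q : 0 < v -> 0 <= q -> 0 <= kl_fun v q.
Proof.
move=> v0; rewrite le_eqVlt => /predU1P[<-|q0]; first by rewrite /kl_fun !mul0r; lra.
have vq : 0 < v / q by rewrite divr_gt0.
have := ln_le_sub1 vq; rewrite lnM ?posrE ?invr_gt0// lnV ?posrE// => h.
have : q * (ln v - ln q) <= q * (v / q - 1) by rewrite ler_wpM2l// ltW.
have -> : q * (v / q - 1) = v - q by field; rewrite gt_eqF.
rewrite /kl_fun; lra.
Qed.

Lemma kl_fun_eq0 v q : 0 < v -> 0 <= q -> kl_fun v q = 0 -> q = v.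
Proof.
move=> v0; rewrite le_eqVlt => /predU1P[<-|q0]; first by rewrite /kl_fun !mul0r; lra.
move=> kl0; apply: contrapT => /eqP qv.
have vq : 0 < v / q by rewrite divr_gt0.
have l0 : ln (v / q) != 0.
  rewrite ln_eq0//; apply: contra qv => /eqP h.
  by rewrite -[v](divfK (lt0r_neq0 q0)) h mul1r.
have := expR_gt1Dx l0; rewrite lnK ?posrE// lnM ?posrE ?invr_gt0// lnV ?posrE// => h.
have : q * (1 + (ln v - ln q)) < q * (v / q) by rewrite ltr_pM2l.
have -> : q * (v / q) = v by field; rewrite gt_eqF.
move: kl0; rewrite /kl_fun; lra.
Qed.

(** With [y] the mixture, the claim is [0 <= (1 - e) * kl_fun y q + e * kl_fun y q'] rearranged, the
    tangent inequality at [y]. The case [y = 0] is separate, as [kl_fun_ge0] asks for a positive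
    reference value. *)
Lemma kl_fun_convex q q' e : 0 <= q -> 0 <= q' -> 0 <= e <= 1 ->
  kl_fun 1 ((1 - e) * q + e * q') <= (1 - e) * kl_fun 1 q + e * kl_fun 1 q'.
Proof.
move=> q0 q'0 /andP[e0 e1]; have e1' : 0 <= 1 - e by rewrite subr_ge0.
set y := _ + _; have : 0 <= y by rewrite addr_ge0// mulr_ge0.
rewrite le_eqVlt => /predU1P[y0|y0].
  have h1 : (1 - e) * q = 0 by have := mulr_ge0 e1' q0; have := mulr_ge0 e0 q'0; rewrite /y in y0; lra.
  have h2 : e * q' = 0 by rewrite /y in y0; lra.
  rewrite -y0 /kl_fun ln1 !mul0r !mulr0 !subr0.
  have -> : (1 - e) * (q * ln q - q + 1) = (1 - e) * q * ln q - (1 - e) * q + (1 - e) by ring.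
  have -> : e * (q' * ln q' - q' + 1) = e * q' * ln q' - e * q' + e by ring.
  by rewrite h1 h2; lra.
have := mulr_ge0 e1' (kl_fun_ge0 y0 q0); have := mulr_ge0 e0 (kl_fun_ge0 y0 q'0).
have yE : y = (1 - e) * q + e * q' by [].
rewrite /kl_fun ln1 !mulr0 !subr0.
have : y * ln y = ((1 - e) * q + e * q') * ln y by rewrite yE.
clearbody y; nra.
Qed.

Lemma kl_fun_split v q : kl_fun v q + q * ln v + 1 = kl_fun 1 q + v.
Proof. by rewrite /kl_fun ln1; ring. Qed.

Lemma measurable_kl_fun d (T : measurableType d) (v q : T -> R) :
  measurable_fun setT v -> measurable_fun setT q ->
  measurable_fun setT (fun x => kl_fun (v x) (q x)).
Proof.
move=> mv mq; apply: measurable_funD => //; apply: measurable_funB => //.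
have ml (h : T -> R) : measurable_fun setT h -> measurable_fun setT (fun x => ln (h x)).
  by move=> mh; exact: measurableT_comp.
by apply: measurable_funB; apply: measurable_funM => //; exact: ml.
Qed.

End kl_integrand.

Section kl_divergence.
Context d (T : measurableType d) (R : realType).
Variable m : probability T R.
Implicit Types (nu : probability T R) (q v : T -> R).
Local Open Scope ereal_scope.

Lemma fin_addIe (z x y : \bar R) : z \is a fin_num -> x + z = y + z -> x = y.
Proof. by move=> zf E; rewrite -[LHS](addeK _ zf) E addeK. Qed.

Lemma nnmfun_kl v q : measurable_fun setT v -> (forall x, 0 < v x)%R ->
  measurable_fun setT q -> (forall x, 0 <= q x)%R -> nnmfun (fun x => (kl_fun (v x) (q x))%:E).
Proof.
move=> mv v0 mq q0; split => [|x]; last by rewrite lee_fin kl_fun_ge0.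
by apply/measurable_EFinP; exact: measurable_kl_fun.
Qed.

Lemma is_density_integral nu q f : is_density nu m q -> nnmfun f ->
  \int[nu]_x f x = \int[m]_x (f x * (q x)%:E).
Proof. by move=> [mq q0 qE] hf; exact: integral_density. Qed.

Lemma is_density_setT nu q : is_density nu m q -> \int[m]_x (q x)%:E = 1.
Proof. by move=> [_ _ /(_ _ measurableT) <-]; exact: probability_setT. Qed.

Lemma is_density_nnmfun nu q : is_density nu m q -> nnmfun (fun x => (q x)%:E).
Proof. by move=> [mq q0 _]; split => [|x]; [exact/measurable_EFinP|rewrite lee_fin]. Qed.

Lemma is_density_dominated nu q : is_density nu m q -> nu `<< m.
Proof.
move=> [mq q0 qE]; apply/null_content_dominatesP => B mB mB0.
rewrite qE//; apply/eqP; rewrite eq_le; apply/andP; split.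
  by rewrite null_set_integral//; exact/measurable_EFinP/measurable_funTS.
by apply: integral_ge0 => x _; rewrite lee_fin.
Qed.

Lemma dominated_density nu : nu `<< m -> exists q, is_density nu m q.
Proof.
move=> num; have fin := Radon_Nikodym_SigmaFinite.f_fin_num num.
exists (fun x => fine (Radon_Nikodym_SigmaFinite.f nu m x)); split.
- by apply: measurableT_comp => //; exact: measurable_int (Radon_Nikodym_SigmaFinite.f_integrable num).
- by move=> x; rewrite fine_ge0// Radon_Nikodym_SigmaFinite.f_ge0.
move=> B mB; rewrite (Radon_Nikodym_SigmaFinite.f_integral num mB).
by apply: eq_integral => x _; rewrite fineK.
Qed.

Lemma is_density_ae_eq nu q q' : is_density nu m q -> is_density nu m q' ->
  \forall x \ae m, q x = q' x.
Proof.
move=> hq hq'; have [mq q0 qE] := hq; have [mq' q'0 q'E] := hq'.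
have iq : m.-integrable setT (EFin \o q).
  apply/integrableP; split; first exact/measurable_EFinP.
  under eq_integral do rewrite /= ger0_norm//.
  by rewrite (is_density_setT hq) ltry.
have : ae_eq m setT (EFin \o q) (EFin \o q').
  apply: (integral_ae_eq measurableT iq); first exact/measurable_EFinP.
  by move=> B _ mB; rewrite -qE// -q'E.
by apply: ae_imp => x /(_ I) [].
Qed.

(* [q (ln q)^-] is at most 1, so the two halves of [\int q ln q] can be recombined. *)
Lemma integral_ln_density nu q : is_density nu m q ->
  \int[nu]_x (ln (q x))%:E = \int[m]_x (kl_fun 1 (q x))%:E.
Proof.
move=> hq; have [mq q0 _] := hq.
have ml : measurable_fun setT (fun x => (ln (q x))%:E).
  by apply/measurable_EFinP; exact: measurableT_comp.
have m1 : measurable_fun setT (fun _ : T => 1%R : R) by [].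
have hk : nnmfun (fun x => (kl_fun 1 (q x))%:E) by exact: (nnmfun_kl m1).
have hp : nnmfun ((fun x => (ln (q x))%:E)^\+) by split => //; exact: measurable_funepos.
have hn : nnmfun ((fun x => (ln (q x))%:E)^\-) by split => //; exact: measurable_funeneg.
have hqq := is_density_nnmfun hq.
rewrite [LHS]integralE !(is_density_integral hq)//.
set p1 := fun x => _ * (q x)%:E; set p2 := (X in _ - integral _ _ X).
have hp1 : nnmfun p1 by exact: nnmfunM.
have hp2 : nnmfun p2 by exact: nnmfunM.
have pE x : ((kl_fun 1 (q x))%:E + (q x)%:E) + p2 x = p1 x + 1.
  rewrite /p1 /p2 funeposE funenegE -!EFin_max -!EFinM -!EFinD; congr (_%:E).
  rewrite /kl_fun ln1 mulr0 subr0.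
  by have [h|h] := leP 0%R (ln (q x)); [rewrite max_r|rewrite max_l]; lra.
have p2le x : p2 x <= 1.
  rewrite /p2 funenegE -EFin_max -EFinM lee_fin.
  have := kl_fun_ge0 (@ltr01 R) (q0 x); rewrite /kl_fun ln1 mulr0 subr0 => h.
  by have [h'|h'] := leP (- ln (q x))%R 0%R; rewrite ?mul0r//; have := q0 x; lra.
have I2 : \int[m]_x p2 x \is a fin_num.
  rewrite ge0_fin_numE; last by apply: integral_ge0 => x _; case: hp2.
  apply: (@le_lt_trans _ _ (\int[m]_x 1)); last by rewrite integral_pcst ltry.
  by apply: ge0_le_integral => //; [case: hp2|case: hp2].
have : \int[m]_x (((kl_fun 1 (q x))%:E + (q x)%:E) + p2 x) = \int[m]_x (p1 x + 1).
  by apply: eq_integral => x _; exact: pE.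
have [[mk k0] [mqq qq0] [mp1 p10] [mp2 p20]] := And4 hk hqq hp1 hp2.
rewrite ge0_integralD//; last 2 first.
- by move=> x _; exact: adde_ge0.
- exact: emeasurable_funD.
rewrite ge0_integralD// ge0_integralD// integral_pcst (is_density_setT hq) => E.
have -> : \int[m]_x p1 x = \int[m]_x (kl_fun 1 (q x))%:E + \int[m]_x p2 x.
  by apply: (@fin_addIe 1) => //; rewrite -E addeAC.
by rewrite addeK.
Qed.

Lemma KL_density nu q : is_density nu m q ->
  KL nu m = \int[m]_x (kl_fun 1 (q x))%:E.
Proof.
move=> hq; rewrite /KL asboolT; last exact: is_density_dominated hq.
set q' := xget _ _.
have hq' : is_density nu m q' by exact: (xgetPex _ (ex_intro _ q hq)).
have [[mq _ _] [mq' _ _]] := (hq, hq').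
rewrite (integral_ln_density hq'); apply: ae_eq_integral => //.
- by apply/measurable_EFinP; exact: measurable_kl_fun.
- by apply/measurable_EFinP; exact: measurable_kl_fun.
- by apply: ae_imp (is_density_ae_eq hq' hq) => x ->.
Qed.

Lemma KL_lty_density nu : KL nu m < +oo -> exists q, is_density nu m q.
Proof.
by rewrite /KL; case: asboolP => [num _|]; [exact: dominated_density|rewrite ltxx].
Qed.

Lemma KL_ge0 nu : 0 <= KL nu m.
Proof.
have [num|num] := pselect (nu `<< m); last by rewrite /KL asboolF.
have [q hq] := dominated_density num; have [_ q0 _] := hq.
by rewrite (KL_density hq) integral_ge0// => x _; rewrite lee_fin kl_fun_ge0.
Qed.

Lemma is_density_mix nu nu' q q' e (he : (0 <= e <= 1)%R) :
  is_density nu m q -> is_density nu' m q' ->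
  is_density (mix_prob nu nu' he) m (fun x => (1 - e) * q x + e * q' x)%R.
Proof.
move=> [mq q0 qE] [mq' q'0 q'E]; have [e0 e1] : (0 <= e /\ 0 <= 1 - e)%R by lra.
split => [|x|B mB].
- by apply: measurable_funD; exact: measurable_funM.
- by rewrite addr_ge0// mulr_ge0.
have h (g : T -> R) : measurable_fun setT g -> (forall x, 0 <= g x)%R ->
    measurable_fun B (fun x => (g x)%:E) /\ (forall x, B x -> 0 <= (g x)%:E).
  by move=> mg g0; split => [|x _]; [exact/measurable_EFinP/measurable_funTS|rewrite lee_fin].
have [[mqB q0B] [mqB' q0B']] := (h _ mq q0, h _ mq' q'0).
rewrite mix_probE// qE// q'E// -!ge0_integralZl// -ge0_integralD//.
- by move=> x Bx; rewrite mule_ge0// q0B.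
- exact: measurable_funeM.
- by move=> x Bx; rewrite mule_ge0// q0B'.
- exact: measurable_funeM.
Qed.

Lemma KL_mix_le nu nu' e (he : (0 <= e <= 1)%R) : KL nu m < +oo -> KL nu' m < +oo ->
  KL (mix_prob nu nu' he) m <= (1 - e)%:E * KL nu m + e%:E * KL nu' m.
Proof.
move=> /KL_lty_density[q hq] /KL_lty_density[q' hq'].
have [e0 e1] : (0 <= e /\ 0 <= 1 - e)%R by lra.
have [mq q0 _] := hq; have [mq' q'0 _] := hq'.
have m1 : measurable_fun setT (fun _ : T => 1%R : R) by [].
have [mk k0] : nnmfun (fun x => (kl_fun 1 (q x))%:E) by exact: (nnmfun_kl m1).
have [mk' k'0] : nnmfun (fun x => (kl_fun 1 (q' x))%:E) by exact: (nnmfun_kl m1).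
have hm := is_density_mix he hq hq'.
rewrite (KL_density hm) (KL_density hq) (KL_density hq') -!ge0_integralZl//.
rewrite -ge0_integralD//; last 4 first.
- by move=> x _; exact: mule_ge0.
- exact: measurable_funeM.
- by move=> x _; exact: mule_ge0.
- exact: measurable_funeM.
have [mmix mix0 _] := hm.
apply: ge0_le_integral => //.
- by move=> x _; rewrite lee_fin kl_fun_ge0.
- by apply/measurable_EFinP; exact: measurable_kl_fun.
- by apply: emeasurable_funD; exact: measurable_funeM.
- by move=> x _; rewrite -!EFinM -EFinD lee_fin; exact: kl_fun_convex.
Qed.

(** The integral on the left is the entropy of [nu] relative to the law of density [v], so this is
    the change of reference measure. As it may be infinite, [ln v] is shifted by [N] and only
    nonnegative integrands are added. *)
Lemma relative_entropy nu q v : is_density nu m q -> measurable_fun setT v ->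
  (forall x, 0 < v x)%R -> bmf (fun x => ln (v x)) -> \int[m]_x (v x)%:E = 1 ->
  \int[m]_x (kl_fun (v x) (q x))%:E + (rint nu (fun x => ln (v x)))%:E = KL nu m.
Proof.
move=> hq mv v0 bl v1; have [mq q0 _] := hq; have [N N0 lN] := bmf_shift bl.
have m1 : measurable_fun setT (fun _ : T => 1%R : R) by [].
have [mk k0] : nnmfun (fun x => (kl_fun 1 (q x))%:E) by exact: (nnmfun_kl m1).
have [mkv kv0] : nnmfun (fun x => (kl_fun (v x) (q x))%:E) by exact: nnmfun_kl.
have blN : bmf (fun x => ln (v x) + N)%R by apply: bmfD => //; exact: bmf_cst.
have hlN := bmf_nnmfun blN lN.
have hqq := is_density_nnmfun hq.
have hql := nnmfunM hlN hqq.
have mvE : nnmfun (fun x => (v x)%:E).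
  by split => [|x]; [exact/measurable_EFinP|rewrite lee_fin ltW].
have hNq := nnmfunZ N0 hqq.
have E : \int[m]_x (((kl_fun (v x) (q x))%:E + (ln (v x) + N)%:E * (q x)%:E) + 1) =
    \int[m]_x (((kl_fun 1 (q x))%:E + (v x)%:E) + N%:E * (q x)%:E).
  apply: eq_integral => x _; rewrite -!EFinM -!EFinD; congr (_%:E).
  have := kl_fun_split (v x) (q x); lra.
have [[mql ql0] [mvv vv0] [mNq Nq0]] := And3 hql mvE hNq.
move: E; rewrite ge0_integralD//; last 2 first.
- by move=> x _; exact: adde_ge0.
- exact: emeasurable_funD.
rewrite ge0_integralD// integral_pcst -(is_density_integral hq hlN).
rewrite ge0_integralD//; last 2 first.
- by move=> x _; exact: adde_ge0.
- exact: emeasurable_funD.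
rewrite ge0_integralD// v1 ge0_integralZl//; last by case: hqq.
rewrite (is_density_setT hq) mule1 -(KL_density hq) (rintE (prob_fin nu) blN).
rewrite (rintD (prob_fin nu) bl (bmf_cst _ _)) rint_pcst => E.
apply: (@fin_addIe (1 + N%:E)) => //.
have F (a b : R) : a%:E + (1 + b%:E) = (a + b)%:E + 1.
  by rewrite -!EFinD addrAC addrA.
  rewrite -addeA F [RHS]addeA -E addeA //.
exact/measurable_EFinP.
Qed.

End kl_divergence.

Section densities.
Context d (T : measurableType d) (R : realType).
Local Open Scope ereal_scope.

Lemma prob_density (m : {measure set T -> \bar R}) (q : T -> R) :
  measurable_fun setT q -> (forall x, 0 <= q x)%R -> \int[m]_x (q x)%:E = 1 ->
  exists nu : probability T R, is_density nu m q.
Proof.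
move=> mq q0 q1; have hF := posfun_mul (posfun_integral m) mq q0.
have F1 : meas_posfun hF setT = 1.
  rewrite [LHS](mposfunE hF)//; rewrite -[RHS]q1.
  by apply: eq_integral => x _; rewrite indicT mul1e.
exists (mkprob F1); split => // B mB.
transitivity (meas_posfun hF B); first by [].
rewrite [LHS](mposfunE hF)// [RHS]integral_mkcond; apply: eq_integral => x _.
by rewrite patchE indicE; case: ifPn; rewrite ?mul1e ?mul0e.
Qed.

Lemma KL_eq_setfun (nu m1 m2 : set T -> \bar R) : (forall B, measurable B -> m1 B = m2 B) ->
  KL nu m1 = KL nu m2.
Proof.
move=> m12.
have nE : m1.-null_set = m2.-null_set.
  by apply/seteqP; split => N h B mB BN; [rewrite -m12|rewrite m12] => //; exact: h.
have dE : is_density nu m1 = is_density nu m2.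
  have E q B : \int[m1]_(x in B) (q x)%:E = \int[m2]_(x in B) (q x)%:E :> \bar R.
    have res (m' : set T -> \bar R) (f : T -> \bar R) : \int[m']_(x in B) f x = \int[m']_x (f \_ B) x.
      by rewrite /integral patch_setT.
    by rewrite !res; exact: eq_setfun_integral.
  apply/funext => q; apply/propext; split => -[mq q0 h]; split => // B mB; rewrite h//.
by rewrite /KL /null_dominates nE dE.
Qed.

Lemma KL_lty_bounded (m nu : probability T R) (q : T -> R) (Q : R) : is_density nu m q ->
  (forall x, q x <= Q)%R -> KL nu m < +oo.
Proof.
move=> hq qQ; have [mq q0 _] := hq; rewrite (KL_density hq).
have m1 : measurable_fun setT (fun _ : T => 1%R : R) by [].
(* By [ln q <= q - 1] the integrand is at most [(q - 1) ^+ 2], hence at most [Q ^+ 2 + 1]. *)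
apply: (@le_lt_trans _ _ (\int[m]_x (Q ^+ 2 + 1)%:E)); last by rewrite integral_pcst ltry.
apply: ge0_le_integral => //.
- by move=> x _; rewrite lee_fin kl_fun_ge0.
- by apply/measurable_EFinP; exact: measurable_kl_fun.
move=> x _; rewrite lee_fin /kl_fun ln1 mulr0 subr0.
have qx := q0 x; have qQx := qQ x.
have [->|qx0] := eqVneq (q x) 0%R; first by rewrite !mul0r; have := sqr_ge0 Q; lra.
have qgt : (0 < q x)%R by rewrite lt0r qx0.
have := ln_le_sub1 qgt; nra.
Qed.

End densities.

Section smoothing.
Context {R : realType} {n : nat}.
Notation Theta := (borel 'rV[R]_n).
Local Notation lam := (@lebesgue_rV R n).
Implicit Types nu : probability Theta R.

Lemma continuous_bounded_ball (g : 'rV[R]_n -> R) (K : R) : continuous g ->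
  exists2 M : R, 0 <= M & forall x, `|x| <= K -> `|g x| <= M.
Proof.
move=> cg; pose B := [set x : 'rV[R]_n | `|x| <= K].
have cB : compact B.
  apply: bounded_closed_compact.
    by exists K; split => [|M KM x /= xK]; [exact: num_real|exact: le_trans xK (ltW KM)].
  rewrite (_ : B = (fun x : 'rV[R]_n => `|x|) @^-1` [set t | t <= K])//.
  by apply: closed_comp; [move=> x _; exact: norm_continuous|exact: closed_le].
have : bounded_set (g @` B).
  apply: compact_bounded; apply: continuous_compact => //.
  by apply: continuous_subspaceT => x; exact: cg.
move=> [M [_ hM]]; exists `|M + 1| => // x xK.
apply: (le_trans _ (ler_norm _)); apply: hM; last by exists x.
by rewrite ltrDl.
Qed.

Lemma measurable_ball_rV (x : 'rV[R]_n) (e : R) : measurable (ball x e : set Theta).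
Proof. by apply: borel_open_measurable; exact: ball_open. Qed.

Lemma measurable_norm_rV : measurable_fun [set: Theta] (fun x : Theta => `|x : 'rV[R]_n|).
Proof. by apply: continuous_borel_measurable => x; exact: norm_continuous. Qed.

Lemma uniform_ball (eta : R) : 0 < eta -> exists m : probability Theta R,
  is_density m lam (fun x => \1_(ball (0 : 'rV[R]_n) eta) x / ((2 * eta) ^+ n)).
Proof.
move=> e0; have v0 : 0 < (2 * eta) ^+ n by rewrite exprn_gt0// mulr_gt0.
apply: prob_density.
- by apply: measurable_funM => //; apply: measurable_indic; exact: measurable_ball_rV.
- by move=> x; rewrite mulr_ge0// invr_ge0 ltW.
under eq_integral do rewrite mulrC EFinM.
rewrite ge0_integralZl//; last 2 first.
- by apply/measurable_EFinP; apply: measurable_indic; exact: measurable_ball_rV.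
- by rewrite lee_fin invr_ge0 ltW.
rewrite integral_indic ?setIT//; last exact: measurable_ball_rV.
by rewrite lebesgue_rV_ball// -EFinM mulVf// gt_eqF.
Qed.

Lemma uniform_ball_moment (eta : R) (m : probability Theta R) : 0 < eta ->
  is_density m lam (fun x => \1_(ball (0 : 'rV[R]_n) eta) x / ((2 * eta) ^+ n)) ->
  (\int[m]_y (enorm (y : 'rV[R]_n))%:E <= (n%:R * eta)%:E)%E.
Proof.
move=> e0 hm; have [mq q0 qE] := hm.
have mE : nnmfun (fun y : Theta => (enorm (y : 'rV[R]_n))%:E) by exact: nnmfun_enorm.
have q1 : (\int[lam]_x (\1_(ball (0 : 'rV[R]_n) eta) x / ((2 * eta) ^+ n))%:E = 1)%E.
  by rewrite -qE//; exact: probability_setT.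
rewrite (integral_density mq q0 qE mE) -[leRHS]mule1 -q1 -ge0_integralZl//; last 3 first.
- exact/measurable_EFinP.
- by move=> x _; rewrite lee_fin.
- by rewrite lee_fin mulr_ge0// ltW.
have [mE1 mE0] := mE.
apply: ge0_le_integral => //.
- by move=> x _; rewrite mule_ge0// lee_fin.
- by apply: emeasurable_funM => //; exact/measurable_EFinP.
- by apply: measurable_funeM; exact/measurable_EFinP.
move=> x _; rewrite -!EFinM lee_fin indicE. case: (boolP (x \in _)) => [xB|_]; last by rewrite !mul0r !mulr0.
rewrite ler_wpM2r ?mul1r ?invr_ge0 ?exprn_ge0 ?mulr_ge0 ?(ltW e0)//.
apply: (le_trans (enorm_le_norm x)); rewrite ler_wpM2l//.
move: xB; rewrite inE -ball_normE/= sub0r normrN; exact: ltW.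
Qed.

End smoothing.

(** * A smoothed competitor *)

Section smoothed_law.
Context {R : realType} {n : nat}.
Notation Theta := (borel 'rV[R]_n).
Local Notation lam := (@lebesgue_rV R n).
Implicit Types nu : probability Theta R.

Lemma enormN (x : 'rV[R]_n) : enorm (- x) = enorm x.
Proof. by rewrite /enorm /dotv; congr Num.sqrt; apply: eq_bigr => i _; rewrite !mxE mulrNN. Qed.

Let cball K : set Theta := [set x : 'rV[R]_n | `|x| <= K].

Let mcball K : measurable (cball K).
Proof.
rewrite -[X in measurable X]setTI.
exact: (@measurable_norm_rV R n measurableT `]-oo, K]%classic (measurable_itv _)).
Qed.

(** Points outside the ball go to the origin, so the transport cost is a tail of the first
    moment. *)
Definition truncate (K : R) (x : 'rV[R]_n) : 'rV[R]_n := \1_(cball K) x *: x.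

Lemma measurable_truncate K : measurable_fun setT (truncate K : Theta -> Theta).
Proof.
apply: measurable_fun_rV => i; under eq_fun do rewrite mxE.
by apply: measurable_funM; [exact: measurable_indic|exact: borel_measurable_coord].
Qed.

Lemma truncate_norm_le K x : 0 <= K -> `|truncate K x| <= K.
Proof.
move=> K0; rewrite /truncate indicE; case: (boolP (x \in _)) => [|_].
  by rewrite scale1r inE.
by rewrite scale0r normr0.
Qed.

Lemma truncate_tail K x : enorm (x - truncate K x) <= enorm x.
Proof.
rewrite /truncate indicE; case: (x \in _); rewrite ?scale1r ?scale0r ?subr0//.
by rewrite subrr enorm0 enorm_ge0.
Qed.

Lemma measurable_tail K : measurable_fun setT (fun x : Theta => (x : 'rV[R]_n) - truncate K x : Theta).
Proof.
apply: measurable_fun_rV => i; under eq_fun do rewrite !mxE.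
apply: measurable_funB; first exact: borel_measurable_coord.
by apply: measurable_funM; [exact: measurable_indic|exact: borel_measurable_coord].
Qed.

Lemma tail_moment nu (eps : R) : P1 nu -> 0 < eps -> exists2 K : R, 0 <= K &
  (\int[nu]_x (enorm ((x : 'rV[R]_n) - truncate K x))%:E <= eps%:E)%E.
Proof.
move=> nu1 e0.
pose f (k : nat) (x : Theta) := (enorm ((x : 'rV[R]_n) - truncate k%:R x))%:E.
have mE := measurable_enorm (R := R) (n := n).
have h : (\int[nu]_x f k x)%E @[k --> \oo] --> (\int[nu]_x (cst 0%E x))%E.
  apply: (dominated_cvg measurableT (g := fun x : Theta => (enorm (x : 'rV[R]_n))%:E)).
  - by move=> k; apply/measurable_EFinP; exact: (measurableT_comp mE (measurable_tail k%:R)).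
  - move=> x _; apply: cvg_near_cst.
    exists (Num.Def.truncn `|x : 'rV[R]_n|).+1 => // k /= xk.
    have xk' : `|x : 'rV[R]_n| <= k%:R.
      by apply: ltW; apply: lt_le_trans (truncnS_gt _) _; rewrite ler_nat.
    by rewrite /f /truncate indicE mem_set// scale1r subrr enorm0.
  - by [].
  - apply/integrableP; split; first exact/measurable_EFinP.
    by under eq_integral do rewrite /= ger0_norm ?enorm_ge0//.
  - by move=> k x _; rewrite /f /= lee_fin ger0_norm ?enorm_ge0//; exact: truncate_tail.
move: h; rewrite integral0 => /fine_cvgP[fin /cvgr0_norm_le/(_ _ e0) le].
have [k [fk lek]] : exists k, (\int[nu]_x f k x)%E \is a fin_num /\ `|fine (\int[nu]_x f k x)%E| <= eps.
  by near \oo => k; exists k; split; near: k.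
exists k%:R => //; rewrite -(fineK fk) lee_fin; exact: le_trans (ler_norm _) lek.
Unshelve. all: by end_near. Qed.

Variables (U : 'rV[R]_n -> R) (gm : probability Theta R).
Hypothesis cU : continuous U.
Hypothesis gmU : is_density gm lam (fun x => expR (- U x)).

Section smoothed.
Variables (nu u : probability Theta R) (K eta : R).
Hypotheses (K0 : 0 <= K) (eta0 : 0 < eta).
Let p (y : Theta) : R := \1_(ball (0 : 'rV[R]_n) eta) y / ((2 * eta) ^+ n).
Hypothesis uE : is_density u lam p.

Let psi (z : Theta * Theta) : Theta := truncate K z.1 + (z.2 : 'rV[R]_n).

Let mpsi : measurable_fun setT psi.
Proof.
apply: measurable_fun_rV => i; under eq_fun do rewrite mxE.
apply: measurable_funD; last exact: (measurableT_comp (@borel_measurable_coord R n i) measurable_snd).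
exact: (measurableT_comp (@borel_measurable_coord R n i)
  (measurableT_comp (measurable_truncate K) measurable_fst)).
Qed.

(** Truncation gives bounded support, on which [U] is bounded, and the independent uniform noise
    gives a bounded Lebesgue density [H]; together they bound the density with respect to [gm]. *)
Definition smoothed : probability Theta R := push_prob (prod_prob nu u) mpsi.

Let bp : bmf p.
Proof.
have [mp _ _] := uE; split=> //; exists ((2 * eta) ^- n) => y.
have v0 : 0 <= (2 * eta) ^- n by rewrite invr_ge0 exprn_ge0// mulr_ge0// ltW.
by rewrite /p indicE normrM (ger0_norm v0); case: (_ \in _); rewrite ?normr1 ?normr0 ?mul1r ?mul0r.
Qed.

Let p0 y : 0 <= p y. Proof. by have [_ p0 _] := uE; exact: p0. Qed.

Let bG : bmf (fun z : Theta * Theta => p ((z.2 : 'rV[R]_n) - truncate K z.1)).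
Proof.
apply: (bmf_comp bp).
have mt : measurable_fun setT (fun z : Theta * Theta => truncate K z.1 : Theta).
  exact: (measurableT_comp (measurable_truncate K) measurable_fst).
exact: (measurableT_comp (measurable_subv (R := R) (n := n)) (measurable_fun_pair measurable_snd mt)).
Qed.

Let H (z : Theta) : R := rint nu (fun x : Theta => p ((z : 'rV[R]_n) - truncate K x)).

Let bH : bmf H. Proof. exact: (bmf_rint2 nu bG). Qed.

Let bGz (z : Theta) : bmf (fun x : Theta => p ((z : 'rV[R]_n) - truncate K x)).
Proof. exact: (bmf_pair2 z bG). Qed.

Let H0 z : 0 <= H z.
Proof. by rewrite fine_ge0// integral_ge0// => x _; rewrite lee_fin. Qed.

Lemma smoothed_lebesgue B : measurable B -> (smoothed B = \int[lam]_z ((\1_B z)%:E * (H z)%:E))%E.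
Proof.
move=> mB; have iB : nnmfun (fun z : Theta => (\1_B z)%:E : \bar R) by exact: nnmfun_indic.
have s1 : smoothed B = (\int[smoothed]_z (\1_B z)%:E)%E by rewrite integral_indic// setIT.
rewrite s1 (integral_push_prob _ _ iB).
have iBpsi : nnmfun (fun z => (\1_B (psi z))%:E : \bar R).
  split => [|z]; last by rewrite lee_fin.
  by apply/measurable_EFinP; exact: (measurableT_comp (measurable_indic mB)).
rewrite (integral_prod_prob _ _ iBpsi).
pose G (z : Theta * Theta) : \bar R := ((\1_B z.2)%:E * (p ((z.2 : 'rV[R]_n) - truncate K z.1))%:E)%E.
have mG : measurable_fun setT G.
  apply: emeasurable_funM; apply/measurable_EFinP; last by case: bG.
  exact: (measurableT_comp (measurable_indic mB) measurable_snd).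
have G0 z : (0 <= G z)%E by rewrite mule_ge0// lee_fin.
transitivity (\int[nu]_x \int[@lebV R n]_y G (x, y))%E.
  apply: eq_integral => x _.
  have iBx : nnmfun (fun y : Theta => (\1_B (psi (x, y)))%:E : \bar R).
    split => [|y]; last by rewrite lee_fin.
    by case: iBpsi => m _; exact: (measurableT_comp m (measurable_pair1 x)).
  have [mp _ pE] := uE.
  rewrite (integral_density mp p0 pE iBx).
  have mGx : measurable_fun setT (fun y : Theta => G (x, y)).
    exact: (measurableT_comp mG (measurable_pair1 x)).
  rewrite -(integral_lebesgue_shift (truncate K x) mGx (fun y => G0 (x, y))).
  apply: eq_integral => y _; rewrite /G /psi /= addrK.
  by rewrite [(y : 'rV[R]_n) + _]addrC.
rewrite (fubini_tonelli (m1 := nu) (m2 := @lebV R n) G mG G0).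
apply: eq_integral => z _; rewrite /G /=.
have hz := bmf_nnmfun (bGz z) (fun x => p0 _).
rewrite ge0_integralZl//; last by case: hz.
  by rewrite (rintE (prob_fin nu) (bGz z)).
by case: hz.
Qed.

Lemma smoothed_density : is_density smoothed gm (fun z => H z * expR (U z)).
Proof.
have mU : measurable_fun [set: Theta] U by exact: continuous_borel_measurable.
have [mg g0 gE] := gmU.
have mq : measurable_fun setT (fun z : Theta => H z * expR (U z)).
  by apply: measurable_funM; [case: bH|exact: measurableT_comp].
have q0 z : 0 <= H z * expR (U z) by rewrite mulr_ge0// expR_ge0.
split => // B mB.
rewrite smoothed_lebesgue// [RHS]integral_mkcond.
have nB : nnmfun ((fun z : Theta => (H z * expR (U z))%:E) \_ B).
  split=> [|z]; last by rewrite patchE; case: ifP; rewrite ?lee_fin.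
  by apply/(measurable_restrictT _ mB); exact/measurable_EFinP/measurable_funTS.
rewrite (integral_density mg g0 gE nB); apply: eq_integral => z _.
rewrite patchE indicE; case: ifPn => _; rewrite ?mul0e// mul1e -EFinM.
by rewrite -mulrA -expRD subrr expR0 mulr1.
Qed.

Lemma smoothed_KL : (KL smoothed gm < +oo)%E.
Proof.
have [M M0 UM] := continuous_bounded_ball (K + eta) cU.
have [_ [Mp pM]] := bp.
have Mp0 : 0 <= Mp by exact: le_trans (normr_ge0 _) (pM 0).
apply: (KL_lty_bounded smoothed_density (Q := Mp * expR M)) => z.
have [zK|zK] := leP `|z : 'rV[R]_n| (K + eta).
  apply: ler_pM => //.
  - apply: le_trans (ler_norm _) _; apply: rint_pabs_le => // x; exact: pM.
  - by rewrite ler_expR; exact: le_trans (ler_norm _) (UM _ zK).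
suff -> : H z = 0 by rewrite mul0r mulr_ge0// expR_ge0.
rewrite /H -[RHS](rint_pcst nu 0); apply: eq_rint => x; rewrite /p indicE.
case: (boolP (_ \in _)) => [|_]; last by rewrite mul0r.
rewrite inE -ball_normE/= sub0r normrN => h.
have := lerB_normD (z : 'rV[R]_n) (- truncate K x); rewrite normrN.
have := truncate_norm_le (x : 'rV[R]_n) K0; lra.
Qed.

Lemma smoothed_W1 : (W1 nu smoothed <= n%:R%:E *
  (\int[nu]_x (enorm ((x : 'rV[R]_n) - truncate K x))%:E + (n%:R * eta)%:E))%E.
Proof.
have mg : measurable_fun setT (fun z : Theta * Theta => (z.1, psi z)) by exact: measurable_fun_pair.
have hg : coupling nu smoothed (push_prob (prod_prob nu u) mg).
  move=> B mB; have T1 (m : probability Theta R) : m setT = 1%E by exact: probability_setT.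
  rewrite !push_probE//; try exact: measurableX.
  split; last by rewrite (_ : _ @^-1` (setT `*` B) = psi @^-1` B)//; apply/seteqP; split => z // [].
  by rewrite (_ : _ @^-1` _ = B `*` setT) ?prod_probE ?T1 ?mule1.
apply: (le_trans (W1_le hg)).
have hE : nnmfun (fun xy : Theta * Theta => (enorm ((xy.1 : 'rV[R]_n) - xy.2))%:E).
  exact: (nnmfun_enorm (measurable_subv (R := R) (n := n))).
rewrite (integral_push_prob _ _ hE) /=.
under eq_integral do rewrite /psi opprD addrA.
apply: (le_trans (integral_prod_enormB nu u (measurable_tail K))).
by rewrite lee_wpmul2l ?lee_fin// leeD2l// uniform_ball_moment.
Qed.

Lemma smoothed_P1 : P1 nu -> P1 smoothed.
Proof.
rewrite /P1 => nu1.
have hE : nnmfun (fun x : Theta => (enorm (x : 'rV[R]_n))%:E) by exact: nnmfun_enorm.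
rewrite (integral_push_prob _ _ hE).
have mN : measurable_fun setT (fun x : Theta => - truncate K x : Theta).
  apply: measurable_fun_rV => i; under eq_fun do rewrite mxE.
  apply: measurableT_comp => //.
  exact: (measurableT_comp (@borel_measurable_coord R n i) (measurable_truncate K)).
under eq_integral do rewrite /psi -enormN opprD.
apply: (le_lt_trans (integral_prod_enormB nu u mN)).
apply: lte_mul_pinfty => //; apply: lte_add_pinfty; last first.
  by apply: le_lt_trans (uniform_ball_moment eta0 uE) (ltry _).
apply: le_lt_trans (nu1); apply: ge0_le_integral => //.
- by move=> x _; rewrite lee_fin enorm_ge0.
- by apply/measurable_EFinP; exact: (measurableT_comp (measurable_enorm (R := R) (n := n))).
- by case: hE.
move=> x _; rewrite lee_fin enormN /truncate indicE.
by case: (_ \in _); rewrite ?scale1r// scale0r enorm0 enorm_ge0.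
Qed.

End smoothed.

Lemma smoothing_competitor nu (delta : R) : P1 nu -> 0 < delta ->
  exists nu0, [/\ P1 nu0, (W1 nu nu0 < delta%:E)%E & (KL nu0 gm < +oo)%E].
Proof.
move=> nu1 d0; pose N : R := n%:R + 1.
have N1 : 0 < N by rewrite /N ltr_wpDl.
(* With these values each of the two terms of [smoothed_W1] is at most [delta / 4]; [N] exceeds [n]
   so as to be positive in dimension 0 too. *)
pose eps := delta / (4 * N); pose eta := delta / (4 * N ^+ 2).
have eps0 : 0 < eps by rewrite divr_gt0// mulr_gt0.
have eta0 : 0 < eta by rewrite divr_gt0// mulr_gt0// exprn_gt0.
have [K K0 hK] := tail_moment nu1 eps0.
have [u uE] := uniform_ball (n := n) eta0.
exists (smoothed nu u K); split; last by apply: smoothed_KL uE.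
  by apply: smoothed_P1 uE nu1.
have hW := smoothed_W1 nu K eta0 uE; apply: (le_lt_trans hW).
apply: (@le_lt_trans _ _ (n%:R * (eps + n%:R * eta))%:E).
  by rewrite [leRHS]EFinM lee_wpmul2l ?lee_fin// EFinD leeD2r.
rewrite lte_fin; have n0 : 0 <= n%:R :> R by [].
have e1 : N * eps = delta / 4 by rewrite /eps; field; rewrite gt_eqF.
have e2 : N * (N * eta) = delta / 4 by rewrite /eta; field; rewrite gt_eqF.
have : n%:R * eps <= N * eps by rewrite ler_wpM2r ?ltW// /N; lra.
have : n%:R * (n%:R * eta) <= N * (N * eta).
  have nN : n%:R <= N by rewrite /N; lra.
  by apply: ler_pM => //; [rewrite mulr_ge0// ltW|rewrite ler_wpM2r// ltW].
lra.
Qed.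

End smoothed_law.

(** * First-order conditions *)

Section first_order.
Context {R : realType} {n : nat}.
Notation Theta := (borel 'rV[R]_n).
Variables (nu : probability Theta R) (V : probability Theta R -> R) (D : Theta -> R).
Hypothesis nu1 : P1 nu.
Hypothesis bD : bmf D.
Hypothesis V_mix : forall nu' : probability Theta R, exists2 C : R, 0 <= C & exists2 e1 : R, 0 < e1 <= 1 &
  forall (e : R) (he : 0 <= e <= 1), e <= e1 ->
    e * (rint nu' D - rint nu D) - C * e ^+ 2 <= V (mix_prob nu nu' he) - V nu.

Lemma linear_le_of_quadratic (a b C e2 : R) : 0 <= C -> 0 < e2 ->
  (forall e, 0 < e -> e < e2 -> e * a - C * e ^+ 2 <= e * b) -> a <= b.
Proof.
move=> C0 e20 h; rewrite leNgt; apply/negP => ba.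
(* The second bound makes [C * e] at most half of [a - b]; the summand 1 covers [C = 0]. *)
pose e := Num.min (e2 / 2) ((a - b) / (2 * (C + 1))).
have e0 : 0 < e by rewrite lt_min !divr_gt0 ?subr_gt0 ?mulr_gt0//; lra.
have ee2 : e < e2 by apply: (@le_lt_trans _ _ (e2 / 2)); [rewrite ge_min lexx|lra].
have eab : e * (2 * (C + 1)) <= a - b.
  by rewrite -ler_pdivlMr ?mulr_gt0//; [rewrite ge_min lexx orbT|lra].
have : e * (a - b - C * e) <= 0 by have := h e e0 ee2; rewrite expr2; lra.
rewrite pmulr_rle0// => h'; nra.
Qed.

Lemma mix_local (Jf : probability Theta R -> \bar R) nu' :
  local_max Jf nu -> P1 nu' -> exists2 e2 : R, 0 < e2 &
  forall e (he : 0 <= e <= 1), e < e2 -> (Jf (mix_prob nu nu' he) <= Jf nu)%E.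
Proof.
move=> [delta d0 hd] nu'1; have [K K0 hK] := W1_mix nu1 nu'1.
have K1 : 0 < K + 1 by lra.
exists (delta / (K + 1)) => [|e he ee]; first by rewrite divr_gt0.
apply: hd; first exact: P1_mix.
apply: (le_lt_trans (hK e he)); rewrite lte_fin.
move: ee; rewrite ltr_pdivlMr// => ee; have e0 : 0 <= e by case/andP: he.
nra.
Qed.

Lemma first_order0 nu' : local_max (fun m => (V m)%:E) nu -> P1 nu' -> rint nu' D <= rint nu D.
Proof.
move=> hmax nu'1; have [e2 e20 he2] := mix_local hmax nu'1.
have [C C0 [e1 /andP[e10 e11] he1]] := V_mix nu'.
rewrite -subr_le0; apply: (linear_le_of_quadratic C0 (e2 := Num.min e1 e2)).
  by rewrite lt_min e10.
move=> e e0; rewrite lt_min mulr0 => /andP[ee1 ee2].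
have he : 0 <= e <= 1 by lra.
by apply: (le_trans (he1 e he (ltW ee1))); rewrite subr_le0 -lee_fin; exact: he2.
Qed.

Variables (U : 'rV[R]_n -> R) (gm : probability Theta R) (c0 : R).
Hypothesis gmU : is_density gm (@lebesgue_rV R n) (fun x => expR (- U x)).
Hypothesis c00 : 0 < c0.
Hypothesis hmax : local_max (fun m => (V m)%:E - c0%:E * KL m gm)%E nu.

Let KLfin m : (KL (m : probability Theta R) gm < +oo)%E -> KL m gm = (fine (KL m gm))%:E.
Proof. by move=> h; rewrite fineK// ge0_fin_numE//; exact: KL_ge0. Qed.

Lemma first_order_KL nu' : P1 nu' -> (KL nu gm < +oo)%E -> (KL nu' gm < +oo)%E ->
  rint nu' D - rint nu D <= c0 * (fine (KL nu' gm) - fine (KL nu gm)).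
Proof.
move=> nu'1 kf kf'; have [e2 e20 he2] := mix_local hmax nu'1.
have [C C0 [e1 /andP[e10 e11] he1]] := V_mix nu'.
apply: (linear_le_of_quadratic C0 (e2 := Num.min e1 e2)); first by rewrite lt_min e10.
move=> e e0; rewrite lt_min => /andP[ee1 ee2].
have he : 0 <= e <= 1 by lra.
apply: (le_trans (he1 e he (ltW ee1))).
have := KL_mix_le he kf kf'; have := he2 e he ee2.
set k := fine (KL nu gm); set k' := fine (KL nu' gm).
have [kE k'E] : KL nu gm = k%:E /\ KL nu' gm = k'%:E by split; exact: KLfin.
rewrite kE k'E -!EFinM -EFinD => hJ hK.
have km : (KL (mix_prob nu nu' he) gm < +oo)%E by exact: le_lt_trans hK (ltry _).
move: hJ hK; rewrite (KLfin km) -EFinM -!EFinB !lee_fin => h1 h2.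
have : c0 * fine (KL (mix_prob nu nu' he) gm) <= c0 * ((1 - e) * k + e * k') by rewrite ler_wpM2l// ltW.
lra.
Qed.

Hypothesis cU : continuous U.

(** An infinite entropy would make the objective [-oo] at [nu], below its finite value at a
    competitor arbitrarily close. *)
Lemma local_max_KL_lty : (KL nu gm < +oo)%E.
Proof.
have [delta d0 hd] := hmax.
have [nu0 [nu01 W0 KL0]] := smoothing_competitor cU gmU nu1 d0.
have := hd _ nu01 W0; rewrite (KLfin KL0) -EFinM -EFinB.
have := KL_ge0 gm nu; case: (KL nu gm) => [k|_|//]; first by rewrite ltry.
by rewrite gt0_muley ?lte_fin//=.
Qed.

Let w (x : Theta) := expR (D x / c0).
Let Z := rint gm w.

Let bw : bmf w.
Proof. by apply: bmf_expR; under eq_fun do rewrite mulrC; exact: bmfZ. Qed.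

Let fgm : ((gm : {measure set _ -> \bar R}) setT < +oo)%E := prob_fin gm.

Lemma tilt_constant_gt0 : 0 < Z.
Proof.
have [_ [M DM]] := bD.
have h : expR (- (M / c0)) <= Z.
  rewrite -[leLHS](rint_pcst gm); apply: (le_rint fgm (bmf_cst _ _) bw) => x.
  by rewrite ler_expR -mulNr ler_wpM2r ?invr_ge0 ?(ltW c00)//; have := DM x; rewrite ler_norml => /andP[].
exact: lt_le_trans (expR_gt0 _) h.
Qed.

(** The density with respect to [gm] of the Gibbs law with which [nu] is identified; its logarithm
    is [D / c0] up to a constant. *)
Let v (x : Theta) := w x / Z.

Let v0 x : 0 < v x. Proof. by rewrite divr_gt0 ?expR_gt0 ?tilt_constant_gt0. Qed.

Let bv : bmf v. Proof. by under [X in bmf X]eq_fun do rewrite /v mulrC; exact: bmfZ. Qed.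

Let lnvE x : ln (v x) = D x / c0 - ln Z.
Proof.
have Z0 := tilt_constant_gt0.
by rewrite lnM ?posrE ?expR_gt0 ?invr_gt0// lnV ?posrE// expRK.
Qed.

Let blnv : bmf (fun x => ln (v x)).
Proof.
under eq_fun do rewrite lnvE mulrC.
by apply: bmfB; [exact: bmfZ|exact: bmf_cst].
Qed.

Let rv1 : rint gm v = 1.
Proof.
rewrite /v; under [X in rint _ X]eq_fun do rewrite mulrC.
by rewrite (rintZ fgm _ bw) mulVf// gt_eqF// tilt_constant_gt0.
Qed.

Let Iv1 : (\int[gm]_x (v x)%:E = 1)%E.
Proof. by rewrite (rintE fgm bv) rv1. Qed.

Let rint_lnv (m : probability Theta R) : rint m (fun x => ln (v x)) = c0^-1 * rint m D - ln Z.
Proof.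
under [X in rint _ X]eq_fun do rewrite lnvE mulrC.
by rewrite (rintB (prob_fin m) (bmfZ _ bD) (bmf_cst _ _)) rint_pcst (rintZ (prob_fin m) _ bD).
Qed.

Section ball_competitor.
Variable K : R.
Let B : set Theta := ball (0 : 'rV[R]_n) K.
Let mB : measurable B. Proof. exact: measurable_ball_rV. Qed.
Let b := rint gm (fun x => \1_B x * v x).
Hypothesis b0 : 0 < b.

Let bBv : bmf (fun x => \1_B x * v x).
Proof. by apply: bmfM => //; exact: bmf_indic. Qed.

Let q x := b^-1 * (\1_B x * v x).

Let bq : bmf q. Proof. exact: bmfZ. Qed.

Let q0 x : 0 <= q x.
Proof. by rewrite mulr_ge0 ?invr_ge0 ?(ltW b0)// mulr_ge0// ltW. Qed.

(** Since [ln v] is [D / c0] up to a constant, the first-order condition says that the entropy of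
    [nu] relative to the law of density [v] is at most that of any admissible competitor. For that
    law conditioned on a ball of mass [b], this entropy is [- ln b]. *)
Lemma ball_competitor q' : is_density nu gm q' ->
  (\int[gm]_x (kl_fun (v x) (q' x))%:E <= (- ln b)%:E)%E.
Proof.
move=> hq'.
have [nu' hnu'] : exists nu' : probability Theta R, is_density nu' gm q.
  apply: prob_density => //; first by case: bq.
  by rewrite (rintE fgm bq) (rintZ fgm _ bBv) mulVf// gt_eqF.
have [mq _ qE] := hnu'.
have nu'1 : P1 nu'.
  have hE : nnmfun (fun x : Theta => (enorm (x : 'rV[R]_n))%:E) by exact: nnmfun_enorm.
  rewrite /P1 (is_density_integral hnu' hE).
  apply: (@le_lt_trans _ _ (\int[gm]_x ((n%:R * K)%:E * (q x)%:E))%E); last first.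
    rewrite ge0_integralZl//; last 3 first.
    - exact/measurable_EFinP.
    - by move=> x _; rewrite lee_fin.
    - rewrite lee_fin mulr_ge0//; apply: contrapT => /negP; rewrite -ltNge => K0.
      move: b0; rewrite /b (_ : (fun x => _) = fun=> 0) ?rint_pcst ?ltxx//.
      apply/funext => x; rewrite indicE memNset ?mul0r//.
      by rewrite /B -ball_normE/= => h; have := lt_trans (le_lt_trans (normr_ge0 _) h) K0; rewrite ltxx.
    by rewrite (is_density_setT hnu') mule1 ltry.
  apply: ge0_le_integral => //.
  - by move=> x _; rewrite mule_ge0 ?lee_fin ?enorm_ge0.
  - by apply: emeasurable_funM; [case: hE|exact/measurable_EFinP].
  - by apply: measurable_funeM; exact/measurable_EFinP.
  move=> x _; rewrite -!EFinM lee_fin /q indicE.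
  case: (boolP (x \in B)) => [xB|_]; last by rewrite !(mul0r, mulr0).
  apply: ler_wpM2r; first by apply: mulr_ge0; [rewrite invr_ge0 ltW|rewrite mul1r ltW].
  apply: (le_trans (enorm_le_norm _)); rewrite ler_wpM2l//.
  by move: xB; rewrite inE /B -ball_normE/= sub0r normrN; exact: ltW.
have kf' : (KL nu' gm < +oo)%E.
  have [_ [Q qQ]] := bq; apply: (KL_lty_bounded hnu' (Q := Q)) => x.
  exact: le_trans (ler_norm _) (qQ x).
have kf := local_max_KL_lty.
have [mv _] := bv.
have e' := relative_entropy hnu' mv v0 blnv Iv1.
have e := relative_entropy hq' mv v0 blnv Iv1.
have I' : (\int[gm]_x (kl_fun (v x) (q x))%:E = (- ln b)%:E)%E.
  have klE x : kl_fun (v x) (q x) = (- ln b - 1) * q x + v x.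
    rewrite /kl_fun /q indicE; case: (x \in B); last by rewrite !(mul0r, mulr0); lra.
    by rewrite mul1r lnM ?posrE ?invr_gt0// lnV ?posrE//; ring.
  under eq_integral do rewrite klE.
  have bZq : bmf (fun x => (- ln b - 1) * q x) by exact: bmfZ.
  rewrite (rintE fgm (bmfD bZq bv)) (rintD fgm bZq bv) (rintZ fgm _ bq) rv1.
  rewrite /q (rintZ fgm _ bBv) mulVf ?gt_eqF// mulr1.
  by congr (_%:E); ring.
have fo := first_order_KL nu'1 kf kf'.
rewrite I' in e'.
move: e'; rewrite (KLfin kf') -EFinD => -[e'].
move: e; rewrite (KLfin kf) => e.
have eR : (\int[gm]_x (kl_fun (v x) (q' x))%:E = (fine (KL nu gm) - rint nu (fun x => ln (v x)))%:E)%E.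
  by rewrite EFinB -e addeK.
rewrite eR lee_fin; move: e'; rewrite !rint_lnv.
have : c0^-1 * (rint nu' D - rint nu D) <= fine (KL nu' gm) - fine (KL nu gm).
  by rewrite ler_pdivrMl.
lra.
Qed.

End ball_competitor.

(** The masses of the balls tend to 1, so the entropy of [nu] relative to the law of density [v] is
    zero; its integrand is nonnegative and vanishes only where the densities agree. *)
Lemma local_max_gibbs : is_density nu gm (fun x => expR (D x / c0) / Z).
Proof.
have [q hq] := KL_lty_density local_max_KL_lty.
have [mq q0 qE] := hq; have [mv [Mv vM]] := bv.
pose b k := rint gm (fun x : Theta => \1_(ball (0 : 'rV[R]_n) k%:R) x * v x).
have bc : b k @[k --> \oo] --> (1 : R).
  rewrite -rv1; apply: (cvg_rint fgm (M := Mv)) => //.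
  - by move=> k; apply: bmfM => //; apply: bmf_indic; exact: measurable_ball_rV.
  - move=> k x; rewrite normrM -[leRHS]mul1r ler_pM// indicE.
    by case: (_ \in _); rewrite ?normr1 ?normr0.
  apply: aeW => x; apply: cvg_near_cst.
  exists (Num.Def.truncn `|x : 'rV[R]_n|).+1 => // k /= xk.
  rewrite indicE mem_set ?mul1r// -ball_normE/= sub0r normrN.
  by apply: lt_le_trans (truncnS_gt _) _; rewrite ler_nat.
have hk : nnmfun (fun x => (kl_fun (v x) (q x))%:E) by exact: nnmfun_kl.
have I0 : (\int[gm]_x (kl_fun (v x) (q x))%:E = 0)%E.
  apply/eqP; rewrite eq_le integral_ge0 ?andbT; last by move=> x _; case: hk.
  apply/lee_addgt0Pr => e e0; rewrite add0e.
  have [k bk] : exists k, expR (- e) < b k.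
    near \oo => k; exists k; near: k; apply: (cvgr_gt _ bc).
    by rewrite expR_lt1 oppr_lt0.
  have bk0 : 0 < b k := lt_trans (expR_gt0 _) bk.
  apply: (le_trans (ball_competitor bk0 hq)); rewrite lee_fin lerNl.
  by rewrite -[leLHS]expRK ler_ln ?posrE ?expR_gt0// ltW.
have qv : \forall x \ae gm, q x = v x.
  have [mk k0] := hk.
  have := ae_eq_integral_abs gm measurableT mk.
  under eq_integral do rewrite gee0_abs//.
  move=> [/(_ I0) H _]; apply: ae_imp H => x /(_ I) [h].
  exact: (kl_fun_eq0 (v0 x) (q0 x) h).
split => //; first by move=> x; exact: ltW (v0 x).
move=> B mB; rewrite qE//; apply: ae_eq_integral => //.
- exact/measurable_EFinP/measurable_funTS.
- exact/measurable_EFinP/measurable_funTS.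
- by apply: ae_imp qv => x -> _.
Unshelve. all: by end_near. Qed.

End first_order.

(** * Integration by parts *)

Section constant_density.
Context {R : realType} {n : nat}.
Notation Theta := (borel 'rV[R]_n).

Lemma rint_dirac (x : Theta) (g : Theta -> R) : measurable_fun setT g ->
  rint (\d_x : set Theta -> \bar R) g = g x.
Proof. by move=> mg; rewrite /rint integral_dirac ?diracT ?mul1e//; exact/measurable_EFinP. Qed.

Lemma P1_dirac (x : Theta) : P1 (\d_x : probability Theta R).
Proof.
rewrite /P1 integral_dirac//; first by rewrite diracT mul1e ltry.
by apply/measurable_EFinP; exact: measurable_enorm.
Qed.

(** The nonnegative function [rint nu D - D] has integral zero, so the open set where [D] lies below
    its mean is null; full support makes it empty. *)
Lemma full_support_max_cst (nu : probability Theta R) (D : 'rV[R]_n -> R) :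
  full_support nu -> continuous D -> bmf (D : Theta -> R) ->
  (forall x, D x <= rint nu D) -> forall x, D x = rint nu D.
Proof.
move=> fs cD bD Dle x; apply/eqP; rewrite eq_le Dle leNgt /=; apply/negP => Dx.
pose O := D @^-1` [set t | t < rint nu D].
have oO : open O by apply: open_comp => [y _|]; [exact: cD|exact: open_lt].
have := fs O oO (ex_intro _ x Dx); rewrite lt0e => /andP[/eqP nuO _]; apply: nuO.
have bB : bmf (fun y : Theta => rint nu D - D y) by apply: bmfB => //; exact: bmf_cst.
have I0 : (\int[nu]_y (rint nu D - D y)%:E = 0)%E.
  by rewrite (rintE (prob_fin nu) bB) (rintB (prob_fin nu) (bmf_cst _ _) bD) rint_pcst subrr.
have [mB _] := bB.
have := ae_eq_integral_abs nu measurableT (_ : measurable_fun setT (fun y : Theta => (rint nu D - D y)%:E)).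
move=> /(_ (iffRL (measurable_EFinP _ _) mB)).
under eq_integral do rewrite gee0_abs ?lee_fin ?subr_ge0//.
move=> [/(_ I0) [N [mN N0 NB]] _].
apply/eqP; rewrite eq_le measure_ge0 andbT -N0; apply: le_measure; rewrite ?inE//.
  exact: borel_open_measurable.
move=> y Oy; apply: NB => /(_ I) [] /eqP; rewrite subr_eq0 => /eqP E.
by move: Oy; rewrite /O /= -E ltxx.
Qed.

End constant_density.

Section integration_by_parts.
Context {R : realType} {n : nat}.
Notation Theta := (borel 'rV[R]_n).
Local Notation lam := (@lebesgue_rV R n).
Implicit Types (F G H : 'rV[R]_n -> R) (x v : 'rV[R]_n).

(** Carries one-variable rules, such as the chain rule for [expR], over to directional
    derivatives. *)
Lemma line_is_derive F x v (a : R) :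
  is_derive (0 : R) (1 : R) (fun t : R => F (x + t *: v)) a <-> is_derive x v F a.
Proof.
have E : (fun h : R => h^-1 *: (((fun t : R => F (x + t *: v)) \o shift 0) (h *: 1) - F (x + 0 *: v))) =
    (fun h : R => h^-1 *: ((F \o shift x) (h *: v) - F x)).
  apply/funext => h /=; rewrite addr0 scale0r addr0 [h *: 1]mulr1.
  by rewrite (addrC x).
split => -[d e]; split; move: d e; rewrite /derivable /derive.
- by rewrite E.
- by rewrite E.
- by rewrite -E.
- by rewrite -E.
Qed.

Lemma is_derive_expR_comp F x v (a : R) : is_derive x v F a ->
  is_derive x v (fun y => expR (F y)) (expR (F x) * a).
Proof.
move=> /line_is_derive h; apply/line_is_derive.
have h' : is_derive (F (x + 0 *: v)) (1 : R) expR (expR (F (x + 0 *: v))) by exact: is_derive_expR.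
have := is_derive1_comp h' h.
by rewrite scale0r addr0 mulrC.
Qed.

Lemma measurable_partial i F : measurable_fun [set: Theta] F ->
  (forall x, derivable F x (delta_mx 0 i)) -> measurable_fun [set: Theta] (partial i F).
Proof.
move=> mF dF; set v := delta_mx 0 i in dF *.
pose u0 k : R := k.+1%:R^-1.
have u0n k : u0 k != 0 by rewrite invr_neq0.
have u0c : u0 @ \oo --> (0 : R) by exact: cvg_harmonic.
have -> : partial i F = fun x : Theta => limn (fun k => (u0 k)^-1 * (F ((x : 'rV[R]_n) + u0 k *: v) - F x)).
  apply/funext => x; apply/esym/cvg_lim => //.
  have := dF x; move=> /cvgr_dnbhsP/(_ u0 (conj u0n u0c)); apply: cvg_trans; apply: near_eq_cvg.
  by apply: nearW => k /=; rewrite [_ + x]addrC.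
apply: measurable_fun_limn => k; apply: measurable_funM => //; apply: measurable_funB => //.
exact: (measurableT_comp mF (measurable_shift (u0 k *: v))).
Qed.

Definition null_integral F : Prop :=
  lam.-integrable setT (EFin \o F) /\ (\int[lam]_x (F x)%:E = 0)%E.

Lemma null_integral_lin (c : R) F G : null_integral F -> null_integral G ->
  null_integral (fun x => F x + c * G x).
Proof.
move=> [iF F0] [iG G0].
have iZ : lam.-integrable setT (EFin \o (fun x => c * G x)).
  have := integrableZl measurableT c iG; congr (integrable _ _ _).
split.
  have := integrableD measurableT iF iZ; congr (integrable _ _ _).
rewrite (integralD_EFin measurableT iF iZ) F0 add0e.
under eq_integral do rewrite /= EFinM.
by rewrite integralZl// G0 mule0.
Qed.

Lemma null_integral_sum (c : R) (F : 'I_n -> 'rV[R]_n -> R) :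
  (forall i, null_integral (F i)) -> null_integral (fun x => \sum_i c * F i x).
Proof.
move=> hF; elim: (index_enum _) => [|i s ih].
  under eq_fun do rewrite big_nil; split; last exact: integral0.
  exact: integrable0.
by under eq_fun do rewrite big_cons addrC; exact: null_integral_lin.
Qed.

Lemma integral_lebesgue_shift_fin v F : measurable_fun [set: Theta] F ->
  (\int[lam]_x (F ((x : 'rV[R]_n) + v))%:E = \int[lam]_x (F x)%:E)%E.
Proof.
move=> mF; have mFE : measurable_fun [set: Theta] (fun x : Theta => (F x)%:E) by exact/measurable_EFinP.
rewrite [LHS]integralE [RHS]integralE; congr (_ - _)%E.
  rewrite -(integral_lebesgue_shift v (measurable_funepos mFE) (fun x => funepos_ge0 _ _)).
  by apply: eq_integral => x _; rewrite !funeposE.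
rewrite -(integral_lebesgue_shift v (measurable_funeneg mFE) (fun x => funeneg_ge0 _ _)).
by apply: eq_integral => x _; rewrite !funenegE.
Qed.

Lemma bounded_support_integrable F (M K : R) : measurable_fun [set: Theta] F ->
  (forall x, `|F x| <= M) -> (forall x, K <= `|x| -> F x = 0) -> lam.-integrable setT (EFin \o F).
Proof.
move=> mF FM FK; have M0 : 0 <= M by exact: le_trans (normr_ge0 _) (FM 0).
pose K' := Num.max K 1; have K'0 : 0 < K' by rewrite lt_max ltr01 orbT.
pose g (x : Theta) : R := M * \1_(ball (0 : 'rV[R]_n) K') x.
have mg : measurable_fun setT g.
  by apply: measurable_funM => //; apply: measurable_indic; exact: measurable_ball_rV.
have ig : lam.-integrable setT (EFin \o g).
  apply/integrableP; split; first exact/measurable_EFinP.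
  under eq_integral do rewrite /= ger0_norm ?mulr_ge0// EFinM.
  rewrite ge0_integralZl//; last first.
    by apply/measurable_EFinP; apply: measurable_indic; exact: measurable_ball_rV.
  rewrite integral_indic ?setIT//; last exact: measurable_ball_rV.
  by rewrite lebesgue_rV_ball// -EFinM ltry.
apply: (le_integrable measurableT _ _ ig); first exact/measurable_EFinP.
move=> x _ /=; rewrite lee_fin [leRHS]ger0_norm ?mulr_ge0// /g indicE.
case: (boolP (x \in _)) => [_|]; first by rewrite mulr1.
rewrite notin_setE -ball_normE/= sub0r normrN => /negP; rewrite -leNgt => K'x.
by rewrite FK ?normr0 ?mulr0//; apply: le_trans K'x; rewrite le_max lexx.
Qed.

(** Difference quotients of [H] integrate to zero by translation invariance. They are bounded by
    [C], as [H] is Lipschitz along lines, and have a common bounded support, so dominated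
    convergence passes to the possibly discontinuous [G]. *)
Lemma integral_partial_eq0 i H G (C K : R) : measurable_fun [set: Theta] H ->
  (forall x, is_derive x (delta_mx 0 i) H (G x)) -> (forall x, `|G x| <= C) ->
  0 <= K -> (forall x, K <= `|x| -> H x = 0) -> null_integral G.
Proof.
move=> mH dH GC K0 HK; set v : 'rV[R]_n := delta_mx 0 i in dH *.
have C0 : 0 <= C by exact: le_trans (normr_ge0 _) (GC 0).
have v1 : `|v| = 1.
  apply/eqP; rewrite eq_le; apply/andP; split; last first.
    by have := coord_le_norm v i; rewrite mxE !eqxx normr1.
  rewrite [leLHS]mx_normrE; apply: bigmax_le => // -[j k] _ /=.
  by rewrite mxE; case: (_ && _); rewrite ?normr1 ?normr0.
have lip x t : `|H (x + t *: v) - H x| <= C * `|t|.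
  have dl u : derivable (fun t : R => H (x + t *: v)) u 1.
    by apply: line_derivable; case: (dH (x + u *: v)).
  have hl : \forall u \ae lebesgue_measure, `|'D_1 (fun t : R => H (x + t *: v)) u| <= C.
    by apply: aeW => u; rewrite line_deriveE; case: (dH (x + u *: v)) => _ ->.
  by have := ae_derive_lipschitz dl hl 0 t; rewrite scale0r addr0 subr0.
(* From a point of norm below [K], a step [2 * K] along [v] reaches a zero of [H]. *)
have Hb x : `|H x| <= C * (2 * K).
  have [xK|xK] := leP K `|x|; first by rewrite HK// normr0 !mulr_ge0.
  have := lip x (2 * K); rewrite (HK (x + _)) ?sub0r ?normrN; last first.
    have := lerB_normD ((2 * K) *: v) x; rewrite [_ + x]addrC normrZ v1 ger0_norm ?mulr_ge0//; lra.
  by rewrite [`|2 * K|]ger0_norm ?mulr_ge0.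
have iH := bounded_support_integrable mH Hb HK.
pose u0 k : R := k.+1%:R^-1.
have u0n k : u0 k != 0 by rewrite invr_neq0.
have u0c : u0 @ \oo --> (0 : R) by exact: cvg_harmonic.
have u01 k : `|u0 k| <= 1 by rewrite ger0_norm ?invr_ge0// invf_le1// ler1n.
pose q k (x : Theta) := (u0 k)^-1 * (H ((x : 'rV[R]_n) + u0 k *: v) - H x).
have mHs k : measurable_fun [set: Theta] (fun x : Theta => H ((x : 'rV[R]_n) + u0 k *: v)).
  exact: (measurableT_comp mH (measurable_shift (u0 k *: v))).
have mq k : measurable_fun setT (q k) by apply: measurable_funM => //; exact: measurable_funB.
have qC k x : `|q k x| <= C.
  by rewrite /q normrM normfV mulrC ler_pdivrMr ?normr_gt0//; exact: lip.
have qK k x : K + 1 <= `|x : 'rV[R]_n| -> q k x = 0.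
  move=> xK; rewrite /q (HK x) ?(HK (_ + _)) ?subrr ?mulr0//; last by lra.
  have := lerB_normD (x : 'rV[R]_n) (u0 k *: v); rewrite normrZ v1 mulr1.
  have := u01 k; lra.
have qc x : q k x @[k --> \oo] --> G x.
  have [dHx <-] := dH x.
  have := dHx; move=> /cvgr_dnbhsP/(_ u0 (conj u0n u0c)); apply: cvg_trans; apply: near_eq_cvg.
  by apply: nearW => k /=; rewrite /q [_ + x]addrC.
have mG : measurable_fun [set: Theta] G.
  by apply: (measurable_fun_cvg mq) => x _; exact: qc.
have GK x : K + 1 <= `|x| -> G x = 0.
  move=> xK; have := qc x; under eq_fun do rewrite qK//.
  have h0 : (fun _ : nat => 0 : R) @ \oo --> (0 : R) by exact: cvg_cst.
  by move=> h; exact: (cvg_unique _ h h0).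
have iG := bounded_support_integrable mG GC GK.
split => //.
have iq k : lam.-integrable setT (EFin \o q k) := bounded_support_integrable (mq k) (qC k) (qK k).
have I0 k : (\int[lam]_x (q k x)%:E = 0)%E.
  have iHs : lam.-integrable setT (EFin \o (fun x : Theta => H ((x : 'rV[R]_n) + u0 k *: v))).
    apply: (bounded_support_integrable (K := K + 1) (mHs k) (fun x => Hb _)) => x xK.
    apply: HK; have := lerB_normD (x : 'rV[R]_n) (u0 k *: v); rewrite normrZ v1 mulr1.
    have := u01 k; lra.
  rewrite /q; under eq_integral do rewrite EFinM.
  rewrite integralZl//; last exact: (integrableB measurableT iHs iH).
  rewrite (integralB_EFin measurableT iHs iH) (integral_lebesgue_shift_fin _ mH) subee ?mule0//.
  exact: integrable_fin_num.
pose g (x : Theta) : R := C * \1_(ball (0 : 'rV[R]_n) (K + 1)) x.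
have ig : lam.-integrable setT (EFin \o g).
  apply: (bounded_support_integrable (M := C) (K := K + 1)).
  - by apply: measurable_funM => //; apply: measurable_indic; exact: measurable_ball_rV.
  - by move=> x; rewrite /g indicE; case: (_ \in _); rewrite ?mulr1 ?mulr0 ?normr0// ger0_norm.
  by move=> x xK; rewrite /g indicE memNset ?mulr0// -ball_normE/= sub0r normrN => /lt_geF; rewrite xK.
have : (\int[lam]_x (EFin \o q k) x)%E @[k --> \oo] --> (\int[lam]_x (EFin \o G) x)%E.
  apply: (dominated_cvg measurableT (g := EFin \o g)) => //.
  - by move=> k; exact/measurable_EFinP.
  - by move=> x _; apply: cvg_EFin; [exact: nearW|exact: qc].
  move=> k x _ /=; rewrite lee_fin /g indicE; case: (boolP (x \in _)) => [_|]; first by rewrite mulr1.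
  rewrite notin_setE -ball_normE/= sub0r normrN => /negP; rewrite -leNgt => xK.
  by rewrite qK// normr0 mulr0.
rewrite (_ : (fun k => _) = fun=> 0%E); last by apply/funext => k; exact: I0.
have h0 : (fun _ : nat => 0%E : \bar R) @ \oo --> 0%E by exact: cvg_cst.
by move=> h; exact: (cvg_unique _ h h0).
Qed.

End integration_by_parts.

(** * The generator against the Gibbs law *)

Section stationary_gibbs.
Context {R : realType} {n : nat}.
Notation Theta := (borel 'rV[R]_n).
Local Notation lam := (@lebesgue_rV R n).
Implicit Types (F : 'rV[R]_n -> R) (x : 'rV[R]_n).

Let u0 k : R := k.+1%:R^-1.
Let u0n k : u0 k != 0. Proof. by rewrite invr_neq0. Qed.
Let u0c : u0 @ \oo --> (0 : R). Proof. exact: cvg_harmonic. Qed.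

Lemma partial_lipschitz_le F i (C : R) :
  (forall x, derivable F x (delta_mx 0 i)) ->
  (forall x h, `|F (x + h *: delta_mx 0 i) - F x| <= C * `|h|) ->
  forall x, `|partial i F x| <= C.
Proof.
move=> dF lip x; have := dF x; move=> /cvgr_dnbhsP/(_ u0 (conj u0n u0c)) /cvg_norm h.
rewrite leNgt; apply/negP => Cx.
have [k] : exists k, C < `|(u0 k)^-1 *: ((F \o shift x) (u0 k *: delta_mx 0 i) - F x)|.
  by near \oo => k; exists k; near: k; exact: (cvgr_gt _ h).
rewrite ltNge => /negP; apply; rewrite /= [_ + x]addrC /GRing.scale/= normrM normfV mulrC.
by rewrite ler_pdivrMr ?normr_gt0//; exact: lip.
Unshelve. all: by end_near. Qed.

Lemma norm_delta_le i : `|delta_mx 0 i : 'rV[R]_n| <= 1.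
Proof.
rewrite [leLHS]mx_normrE; apply: bigmax_le => // -[j k] _ /=.
by rewrite mxE; case: (_ && _); rewrite ?normr1 ?normr0.
Qed.

(** The radius grows by one so that difference quotients with steps below 1 only see zeros of
    [F]. *)
Lemma partial_support F i (K : R) : (forall x, K <= `|x| -> F x = 0) ->
  forall x, K + 1 <= `|x| -> partial i F x = 0.
Proof.
move=> FK x xK; apply: cvg_lim => //; apply: cvg_near_cst.
exists 1 => //= h; rewrite /ball_/= sub0r normrN => h1 _.
rewrite (FK x) ?(FK (_ + x)) ?subrr ?scaler0//; last by lra.
have := lerB_normD x (h *: delta_mx 0 i); rewrite normrZ [x + _]addrC.
have := ler_pM (normr_ge0 _) (normr_ge0 _) (ltW h1) (norm_delta_le i); lra.
Qed.

Lemma compact_support_bounded F : compactly_supported F ->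
  exists2 K : R, 0 <= K & forall x, K <= `|x| -> F x = 0.
Proof.
move=> /compact_bounded[M [_ hM]]; exists (`|M| + 2) => [|x xM]; first by rewrite addr_ge0.
apply: contrapT => /eqP Fx.
have clx : closure [set x | F x != 0] x by exact: subset_closure.
have MM : M < `|M| + 1 by have := ler_norm M; lra.
by have := hM _ MM x clx; rewrite /=; lra.
Qed.

Lemma continuous_support_bounded F (K : R) : continuous F -> (forall x, K <= `|x| -> F x = 0) ->
  exists2 M : R, 0 <= M & forall x, `|F x| <= M.
Proof.
move=> cF FK; have [M M0 hM] := continuous_bounded_ball K cF; exists M => // x.
by have [xK|xK] := leP `|x| K; [exact: hM|rewrite FK ?normr0// ltW].
Qed.

Variables (U D : 'rV[R]_n -> R) (nu gm : probability Theta R) (c0 Z CU C : R).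
Hypothesis mU : measurable_fun [set: Theta] U.
Hypothesis U0 : forall x, 0 < U x.
Hypothesis dU : forall x, differentiable U x.
Hypothesis CU0 : 0 < CU.
Hypothesis UC : forall x, enorm (grad U x) <= CU * (1 + enorm x).
Hypothesis bD : bmf (D : Theta -> R).
Hypothesis dD : forall i x, derivable D x (delta_mx 0 i).
Hypothesis DC : forall i x h, `|D (x + h *: delta_mx 0 i) - D x| <= C * `|h|.
Hypothesis c00 : 0 < c0.
Hypothesis Z0 : 0 < Z.
Hypothesis gmU : is_density gm lam (fun x => expR (- U x)).
Hypothesis nuD : is_density nu gm (fun x => expR (D x / c0) / Z).
Variable phi : 'rV[R]_n -> R.
Hypothesis sphi : smooth phi.
Hypothesis kphi : compactly_supported phi.

(* [G i] is the i-th partial derivative of [partial i phi * w]; up to a factor the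
   generator integrates against [nu] as the sum of the [G i]. *)
Let w x := expR (D x / c0 - U x).
Let b i x := partial i D x / c0 - partial i U x.
Let G i x := partial i (partial i phi) x * w x + partial i phi x * (w x * b i x).

Let dUi i x : derivable U x (delta_mx 0 i).
Proof. exact: diff_derivable. Qed.

Let is_derive_w i x : is_derive x (delta_mx 0 i) w (w x * b i x).
Proof.
apply: is_derive_expR_comp.
have h1 : is_derive x (delta_mx 0 i) D (partial i D x) by split.
have h2 : is_derive x (delta_mx 0 i) U (partial i U x) by split.
have h3 : is_derive x (delta_mx 0 i) (c0^-1 \*: D) (c0^-1 *: partial i D x) by exact: is_deriveZ.
have -> : (fun y => D y / c0 - U y) = (c0^-1 \*: D) \- U.
  by apply/funext => y /=; rewrite mulrC.
have h4 := is_deriveB h3 h2.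
by apply: is_derive_eq h4 _; rewrite /b mulrC.
Qed.

Let is_derive_H i x : is_derive x (delta_mx 0 i) (fun y => partial i phi y * w y) (G i x).
Proof.
have [_ /(_ i) h] := sphi [:: i] x.
have h1 : is_derive x (delta_mx 0 i) (partial i phi) (partial i (partial i phi) x) by split.
apply: is_derive_eq (is_deriveM h1 (is_derive_w i x)) _.
by rewrite /G /GRing.scale/= addrC [w x * partial _ _ _]mulrC.
Qed.

Let cphi i : continuous (partial i phi).
Proof. by move=> x; have [h _] := sphi [:: i] x. Qed.

Let cphi2 i : continuous (partial i (partial i phi)).
Proof. by move=> x; have [h _] := sphi [:: i; i] x. Qed.

Let mw : measurable_fun [set: Theta] w.
Proof.
apply: measurableT_comp => //; apply: measurable_funB => //.
by apply: measurable_funM => //; case: bD.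
Qed.

Let Dpartial i x : `|partial i D x| <= C.
Proof. by apply: partial_lipschitz_le; [exact: dD|exact: DC]. Qed.

Let Upartial i x : `|partial i U x| <= CU * (1 + n%:R * `|x|).
Proof.
have := abs_coord_le_enorm (grad U x) i; rewrite mxE => h.
apply: (le_trans h); apply: (le_trans (UC x)); rewrite ler_wpM2l ?(ltW CU0)//.
by rewrite lerD2l enorm_le_norm.
Qed.

Section bounds.
Variables (K M1 M2 : R).
Hypothesis K0 : 0 <= K.
Hypothesis phi1K : forall i x, K <= `|x| -> partial i phi x = 0.
Hypothesis phi2K : forall i x, K <= `|x| -> partial i (partial i phi) x = 0.
Hypothesis phi1M : forall i x, `|partial i phi x| <= M1.
Hypothesis phi2M : forall i x, `|partial i (partial i phi) x| <= M2.

(** Bounds the partial derivatives of [U] on the ball of radius [K]; the factor [n] converts between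
    the Euclidean and the maximum norm. *)
Let BU : R := CU * (1 + n%:R * K).

Let bound_b i x : `|x| < K -> `|b i x| <= C / c0 + BU.
Proof.
move=> xK; apply: (le_trans (ler_normB _ _)); apply: lerD.
  by rewrite normrM [`|c0^-1|]ger0_norm ?invr_ge0 ?(ltW c00)// ler_wpM2r ?invr_ge0 ?(ltW c00).
apply: (le_trans (Upartial i x)); rewrite ler_wpM2l ?(ltW CU0)// lerD2l ler_wpM2l//.
exact: ltW.
Qed.

Lemma null_integral_G i : null_integral (G i).
Proof.
have [_ [MD DM]] := bD.
have wM x : `|w x| <= expR (MD / c0).
  rewrite ger0_norm ?expR_ge0// ler_expR.
  have : D x / c0 <= MD / c0.
    by rewrite ler_wpM2r ?invr_ge0 ?(ltW c00)//; exact: le_trans (ler_norm _) (DM x).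
  by have := U0 x; lra.
have M10 : 0 <= M1 by exact: le_trans (normr_ge0 _) (phi1M i 0).
have M20 : 0 <= M2 by exact: le_trans (normr_ge0 _) (phi2M i 0).
have C0 : 0 <= C by exact: le_trans (normr_ge0 _) (Dpartial i 0).
have BU0 : 0 <= BU by rewrite mulr_ge0 ?(ltW CU0)// addr_ge0// mulr_ge0.
pose B := M2 * expR (MD / c0) + M1 * (expR (MD / c0) * (C / c0 + BU)).
have B0 : 0 <= B.
  have e0 := expR_ge0 (MD / c0); have k0 : 0 <= C / c0 by rewrite divr_ge0// ltW.
  by rewrite addr_ge0 ?mulr_ge0 ?addr_ge0.
apply: (integral_partial_eq0 (i := i) (C := B) (K := K) _ (is_derive_H i)) => //.
- by apply: measurable_funM => //; exact: continuous_borel_measurable.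
- move=> x; have [xK|xK] := leP K `|x|.
    by rewrite /G phi1K// phi2K// !mul0r addr0 normr0.
  apply: (le_trans (ler_normD _ _)); apply: lerD; rewrite normrM; first by rewrite ler_pM.
  by rewrite ler_pM// normrM ler_pM// bound_b.
- by move=> x xK; rewrite phi1K// mul0r.
Qed.

Let Lphi x := c0 * laplacian phi x + dotv (grad D x - c0 *: grad U x) (grad phi x).

Lemma bmf_generator : bmf (Lphi : Theta -> R).
Proof.
have LE x : Lphi x = \sum_i (c0 * partial i (partial i phi) x + c0 * b i x * partial i phi x).
  rewrite big_split/= -mulr_sumr; congr (_ + _); apply: eq_bigr => i _.
  by rewrite !mxE /b; congr (_ * _); field; rewrite gt_eqF.
split.
  rewrite (_ : Lphi = fun x => \sum_i (c0 * partial i (partial i phi) x + c0 * b i x * partial i phi x)); last exact/funext.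
  apply: measurable_sum => i; apply: measurable_funD.
    by apply: measurable_funM => //; exact: continuous_borel_measurable.
  apply: measurable_funM; last exact: continuous_borel_measurable.
  apply: measurable_funM => //; apply: measurable_funB; last exact: measurable_partial.
  by apply: measurable_funM => //; apply: measurable_partial => //; case: bD.
exists (\sum_(i < n) (c0 * M2 + c0 * (C / c0 + BU) * M1)) => x.
rewrite LE; apply: (le_trans (ler_norm_sum _ _ _)); apply: ler_sum => i _.
have M10 : 0 <= M1 by exact: le_trans (normr_ge0 _) (phi1M i 0).
have M20 : 0 <= M2 by exact: le_trans (normr_ge0 _) (phi2M i 0).
have C0 : 0 <= C by exact: le_trans (normr_ge0 _) (Dpartial i 0).
have BU0 : 0 <= BU by rewrite mulr_ge0 ?(ltW CU0)// addr_ge0// mulr_ge0.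
have k0 : 0 <= C / c0 by rewrite divr_ge0// ltW.
have cc : 0 <= c0 by exact: ltW.
have [xK|xK] := leP K `|x|.
  by rewrite phi1K// phi2K// !mulr0 addr0 normr0 addr_ge0 ?mulr_ge0 ?addr_ge0.
apply: (le_trans (ler_normD _ _)); rewrite !normrM (ger0_norm cc); apply: lerD.
  by rewrite ler_wpM2l.
by rewrite ler_pM ?mulr_ge0// ler_wpM2l// bound_b.
Qed.

(** With respect to Lebesgue measure [nu] has density [w / Z], and the drift has components
    [c0 * b i]; hence the generator times the density is [c0 / Z] times the sum of the [G i], each
    of integral zero. *)
Lemma stationary_gibbs_bounds : (\int[nu]_x (Lphi x)%:E = 0)%E.
Proof.
rewrite (rintE (prob_fin nu) bmf_generator); congr (_%:E).
have [mL _] := bmf_generator; have [mv v0 vE] := nuD; have [mg g0 gE] := gmU.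
rewrite (rint_density mv v0 vE mL) (rint_density mg g0 gE); last exact: measurable_funM.
have [_ hI] := null_integral_sum (c0 / Z) null_integral_G.
rewrite /rint (_ : (fun x => _) = fun x => (\sum_i c0 / Z * G i x)%:E) ?hI//.
apply/funext => x; congr (_%:E).
have wE : expR (D x / c0) / Z * expR (- U x) = w x / Z by rewrite /w expRD; ring.
rewrite -mulrA wE /Lphi /laplacian /dotv mulr_sumr -big_split/= mulr_suml.
apply: eq_bigr => i _; rewrite !mxE /G /b; field.
by rewrite !gt_eqF.
Qed.

End bounds.

Lemma stationary_gibbs : (\int[nu]_x (c0 * laplacian phi x +
  dotv (grad D x - c0 *: grad U x) (grad phi x))%:E = 0)%E.
Proof.
have [K K0 phiK] := compact_support_bounded kphi.
have p1 i x : K + 2 <= `|x| -> partial i phi x = 0.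
  by move=> xK; apply: (partial_support i phiK); lra.
have p2 i x : K + 2 <= `|x| -> partial i (partial i phi) x = 0.
  move=> xK; apply: (partial_support (K := K + 1) i) => [y yK|]; last by lra.
  exact: (partial_support i phiK).
have uni (F : 'I_n -> 'rV[R]_n -> R) : (forall i, continuous (F i)) ->
    (forall i x, K + 2 <= `|x| -> F i x = 0) -> exists M : R, forall i x, `|F i x| <= M.
  move=> cF FK; have /choice[M hM] i : exists M : R, forall x, `|F i x| <= M.
    by have [M _ hM] := continuous_support_bounded (cF i) (FK i); exists M.
  exists (\sum_i `|M i|) => i x; apply: (le_trans (hM i x)); apply: (le_trans (ler_norm _)).
  by rewrite (bigD1 i)//= lerDl sumr_ge0.
have [M1 hM1] := uni _ cphi p1; have [M2 hM2] := uni _ cphi2 p2.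
by apply: (stationary_gibbs_bounds (K := K + 2) _ p1 p2 hM1 hM2); rewrite addr_ge0.
Qed.

End stationary_gibbs.

Lemma lipschitz_continuous (R : realType) (n : nat) (F : 'rV[R]_n -> R) (M : R) : 0 <= M ->
  (forall x y, `|F y - F x| <= M * `|y - x|) -> continuous F.
Proof.
move=> M0 FM x B /nbhs_ballP[e /= e0 eB]; have M1 : 0 < M + 1 by lra.
apply/nbhs_ballP; exists (e / (M + 1)); first by rewrite /= divr_gt0.
move=> y; rewrite -ball_normE/= ltr_pdivlMr// => xy; apply: eB; rewrite /ball/=.
apply: (le_lt_trans (FM y x)); have := normr_ge0 (x - y); nra.
Qed.

(** * The objective with and without entropy, and the stationarity theorem *)

Section objective_forms.
Context {R : realType} {S A : ptopologicalType} {d : nat}.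
Variables (P : R.-pker (borel S * borel A)%type ~> borel S) (r : S -> A -> R).
Variables (gamma tau sigma : R).
Variables (mu : {finite_measure set (borel A) -> \bar R}).
Variables (rho : probability (borel S) R).
Variables (f : 'rV[R]_d -> S -> A -> R) (U : 'rV[R]_d -> R).

Lemma J_sigma0 : sigma = 0 -> J P r gamma tau sigma mu rho f U =
  fun m => (value_at P r gamma tau mu (softmax mu f m) rho)%:E.
Proof.
move=> s0; apply/funext => m; rewrite /J; move: (value_at _ _ _ _ _ _ _) => x.
by rewrite s0 eqxx sube0.
Qed.

Lemma J_gibbs (gm : probability (borel 'rV[R]_d) R) : 0 < sigma ->
  is_density gm (@lebesgue_rV R d) (fun x => expR (- U x)) ->
  J P r gamma tau sigma mu rho f U =
  fun m => ((value_at P r gamma tau mu (softmax mu f m) rho)%:E - (sigma ^+ 2 / 2)%:E * KL m gm)%E.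
Proof.
move=> s0 [_ _ gE]; apply/funext => m; rewrite /J; move: (value_at _ _ _ _ _ _ _) => x.
have KE : KL m (gibbs U) = KL m gm by apply: KL_eq_setfun => B mB; rewrite gE.
by rewrite (gt_eqF s0) KE.
Qed.

End objective_forms.

Theorem corollary2p7 (R : realType) (S A : ptopologicalType) (d : nat)
  (hS : polish R S) (hA : polish R A)
  (P : R.-pker (borel S * borel A)%type ~> borel S)
  (r : S -> A -> R)
  (mr : measurable_fun [set: borel S * borel A] (fun x => r x.1 x.2))
  (br : exists M : R, forall s a, `|r s a| <= M)
  (gamma : R) (hgamma : 0 <= gamma < 1)
  (tau : R) (htau : 0 <= tau)
  (mu : {finite_measure set (borel A) -> \bar R})
  (mu_pos : forall O : set A, open O -> O !=set0 -> (0 < mu O)%E)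
  (rho : probability (borel S) R)
  (htau0 : tau = 0 ->
    [/\ compact [set: A],
        forall (a : A) (h : borel S -> R), measurable_fun setT h ->
          (exists M : R, forall s, `|h s| <= M) ->
          continuous (fun s : S => rint (P (s, a)) h)
      & forall s, upper_semicontinuous (r s)])
  (U : 'rV[R]_d -> R)
  (mU : measurable_fun [set: borel 'rV[R]_d] U)
  (U_pos : forall theta, 0 < U theta)
  (dU : forall theta, differentiable U theta)
  (U_norm : (\int[@lebesgue_rV R d]_theta (expR (- U theta))%:E = 1)%E)
  (sigma : R) (hsigma : 0 <= sigma)
  (f : 'rV[R]_d -> S -> A -> R) (hf : classA1 mu f)
  (hCU : exists2 C : R, 0 < C &
    forall theta, enorm (grad U theta) <= C * (1 + enorm theta))
  (nu : probability (borel 'rV[R]_d) R)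
  (hnu1 : P1 nu)
  (hmax : local_max (J P r gamma tau sigma mu rho f U) nu)
  (hsupp : full_support nu) :
  forall phi : 'rV[R]_d -> R, smooth phi -> compactly_supported phi ->
    (\int[nu]_theta (L P r gamma tau sigma mu rho f U nu phi theta)%:E = 0)%E.
Proof.
move=> phi sphi kphi.
have hr : bmf (fun x : borel S * borel A => r x.1 x.2).
  by split => //; have [M rM] := br; exists M => x; exact: rM.
have mu_gt0 : (0 < mu setT)%E by apply: mu_pos; [exact: openT|exists point].
have [bD [C C0 DC] dD] := dJ_regular P tau hgamma hr mu_gt0 rho hf nu.
have Vmix := value_at_mix_A1 P hgamma htau hr mu_gt0 rho hf nu.
have [s0|s0] := eqVneq sigma 0.
  have hmax0 : local_max (fun m => (value_at P r gamma tau mu (softmax mu f m) rho)%:E) nu.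
    by move: (hmax); rewrite (J_sigma0 P r gamma tau mu rho f U s0).
  have cD : continuous (dJ P r gamma tau mu f rho nu).
    apply: (lipschitz_continuous (M := d%:R * C)) => [|x y]; first by rewrite mulr_ge0.
    exact: line_lipschitz_total.
  have Dle x : dJ P r gamma tau mu f rho nu x <= rint nu (dJ P r gamma tau mu f rho nu).
    have := first_order0 hnu1 Vmix hmax0 (P1_dirac (x : borel _)).
    by rewrite rint_dirac//; case: bD.
  have DE := full_support_max_cst hsupp cD bD Dle.
  apply: integral0_eq => theta _; congr (_%:E).
  rewrite /L s0 expr0n/= !mul0r scale0r subr0 add0r /dotv big1// => i _.
  rewrite !mxE /partial (_ : dJ _ _ _ _ _ _ _ _ = cst (rint nu (dJ P r gamma tau mu f rho nu))).
    by rewrite derive_cst mul0r.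
  by apply/funext => x; exact: DE.
have sigma_gt0 : 0 < sigma by rewrite lt0r s0.
have c00 : 0 < sigma ^+ 2 / 2 by rewrite divr_gt0// exprn_gt0.
have [gm gmU] : exists gm : probability (borel 'rV[R]_d) R,
    is_density gm (@lebesgue_rV R d) (fun x => expR (- U x)).
  apply: prob_density => //.
  by apply: measurableT_comp => //; exact: measurableT_comp.
have cU : continuous U by move=> x; exact: differentiable_continuous.
have hmaxKL : local_max (fun m => (value_at P r gamma tau mu (softmax mu f m) rho)%:E -
    (sigma ^+ 2 / 2)%:E * KL m gm)%E nu.
  by move: (hmax); rewrite (J_gibbs P r gamma tau mu rho f sigma_gt0 gmU).
have nuD := local_max_gibbs hnu1 bD Vmix gmU c00 hmaxKL cU.
have Z0 := tilt_constant_gt0 bD gm c00.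
have [CU CU0 UC] := hCU.
exact: (stationary_gibbs mU U_pos dU CU0 UC bD dD DC c00 Z0 gmU nuD sphi kphi).
Qed.
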